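(* There is a randomized algorithm which, given a set $X$ of $n$ points in $\mathbb{R}^d$, a positive integer $k$ and a parameter $\varepsilon>0$, outputs a list $\mathcal{L}$ of $2^{\tilde{O}(k/\varepsilon)}$ sets of $k$ centers in $\mathbb{R}^d$ such that for any clustering $\mathbb{O}^\star=\{O_1^\star,\dots,O_k^\star\}$ of $X$ the following event happens with probability at least $1/2$: there is a set $C\in\mathcal{L}$ with $$\mathrm{cost}_C(\mathbb{O}^\star)\le (1+\varepsilon)\cdot \mathrm{opt}_k(\mathbb{O}^\star).$$ Moreover, the running time of the algorithm is $O\!\left(nd\cdot 2^{\tilde{O}(k/\varepsilon)}\right)$. The same statement holds for the list $k$-median problem (where squared Euclidean distances are replaced by Euclidean distances in the definitions of $\mathrm{cost}_C$ and $\mathrm{opt}_k$), except that the list size becomes $2^{\tilde{O}(k/\varepsilon^{O(1)})}$ and the running time becomes $O\!\left(nd\cdot 2^{\tilde{O}(k/\varepsilon^{O(1)})}\right)$.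
   Context: A clustering of a finite set $X\subset\mathbb{R}^d$ is a partition of $X$ into $k$ disjoint subsets $O_1,\dots,O_k$. For a finite set $Y$, $\Gamma(Y)=\frac{1}{|Y|}\sum_{y\in Y}y$ is its centroid. For a set $C=\{c_1,\dots,c_k\}$ of $k$ centers and a clustering $\mathbb{O}=\{O_1,\dots,O_k\}$, $\mathrm{cost}_C(\mathbb{O})$ is the minimum over all permutations $\pi$ of $\{1,\dots,k\}$ of $\sum_{i=1}^k\sum_{x\in O_i}\|x-c_{\pi(i)}\|^2$, and $\mathrm{opt}_k(\mathbb{O})=\sum_{i=1}^k\sum_{x\in O_i}\|x-\Gamma(O_i)\|^2$ is the optimal $k$-means cost of $\mathbb{O}$. In the $k$-median version, $\mathrm{cost}_C(\mathbb{O})$ is the minimum over permutations $\pi$ of $\sum_{i}\sum_{x\in O_i}\|x-c_{\pi(i)}\|$ and $\mathrm{opt}_k(\mathbb{O})=\sum_i\min_{c\in\mathbb{R}^d}\sum_{x\in O_i}\|x-c\|$. The notation $\tilde{O}(\cdot)$ hides a factor $O(\log(k/\varepsilon))$, e.g. $2^{\tilde{O}(k/\varepsilon)}=2^{O((k/\varepsilon)\log(k/\varepsilon))}$.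
   Formalization: The constants hidden in the O and Õ bounds are uniform for ε in any bounded range (0,E] but may depend on E (for all ε>0 at once the claim fails, e.g. ε=k), and the hidden logarithm is read as log(2+k/ε) rather than log(k/ε). *)

(* Defs.v *)
From mathcomp Require Import all_boot all_order all_algebra all_fingroup.
From mathcomp Require Import all_classical all_reals all_analysis.

Set Implicit Arguments.
Unset Strict Implicit.
Unset Printing Implicit Defensive.

Import Order.TTheory GRing.Theory Num.Theory.
Local Open Scope ring_scope.

(** * Clusterings, k-means and k-median costs

    A set of n points of R^d is an injective family [X : 'I_n -> 'rV[R]_d]; a
    subset of it is given by a set of indices.  A set of k centers is a family
    [C : 'I_k -> 'rV[R]_d], so that centers may coincide. *)

(* The library norm on ['rV[R]_d] is the sup norm, hence these definitions. *)
Definition sqdist (R : realType) (d : nat) (u v : 'rV[R]_d) : R :=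
  \sum_(j < d) (u 0 j - v 0 j) ^+ 2.

Definition edist (R : realType) (d : nat) (u v : 'rV[R]_d) : R :=
  Num.sqrt (sqdist u v).

Definition centroid (R : realType) (n d : nat) (X : 'I_n -> 'rV[R]_d)
    (Y : {set 'I_n}) : 'rV[R]_d :=
  (#|Y|%:R)^-1 *: \sum_(x in Y) X x.

(* Clusters may be empty; an empty cluster contributes 0 to every cost. *)
Definition clustering (n k : nat) (O : 'I_k -> {set 'I_n}) : Prop :=
  (forall i j : 'I_k, i != j -> [disjoint O i & O j]) /\
  \bigcup_(i < k) O i = [set: 'I_n].

(* The initial value of the iterated minimum is the value at the identity
   permutation, so this is the minimum over ['S_k]. *)
Definition min_cost (R : realType) (n d k : nat)
    (dist : 'rV[R]_d -> 'rV[R]_d -> R) (X : 'I_n -> 'rV[R]_d)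
    (C : 'I_k -> 'rV[R]_d) (O : 'I_k -> {set 'I_n}) : R :=
  let F (s : 'S_k) := \sum_(i < k) \sum_(x in O i) dist (X x) (C (s i)) in
  \big[Num.min/F 1%g]_(s : 'S_k) F s.

Definition kmeans_cost (R : realType) (n d k : nat) :=
  @min_cost R n d k (@sqdist R d).

Definition kmeans_opt (R : realType) (n d k : nat) (X : 'I_n -> 'rV[R]_d)
    (O : 'I_k -> {set 'I_n}) : R :=
  \sum_(i < k) \sum_(x in O i) sqdist (X x) (centroid X (O i)).

Definition kmedian_cost (R : realType) (n d k : nat) :=
  @min_cost R n d k (@edist R d).

(* The infimum is attained: the sum is continuous and coercive in [c]. *)
Definition kmedian_opt (R : realType) (n d k : nat) (X : 'I_n -> 'rV[R]_d)
    (O : 'I_k -> {set 'I_n}) : R :=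
  \sum_(i < k) inf (range (fun c : 'rV[R]_d => \sum_(x in O i) edist (X x) c)).

(** * Randomized real RAM

    Programs are finite syntax with two kinds of memory, natural numbers and
    reals, each organized as finitely many (those named by the program)
    unbounded arrays with computed indices.  Naturals serve for
    counting and addressing; they have no multiplication, so unit-cost
    arithmetic on them cannot build huge integers quickly.  Reals have exact
    field operations, square roots and comparisons, no rounding to naturals,
    and no constants other than naturals. *)

Inductive nexp : Type :=
| NConst of nat
| NGet of nat & nexp          (* array name, index *)
| NAdd of nexp & nexp
| NSub of nexp & nexp.        (* truncated *)

Inductive rexp : Type :=
| ROfNat of nexp
| RGet of nat & nexp          (* array name, index *)
| RAdd of rexp & rexp
| RSub of rexp & rexp
| RMul of rexp & rexp
| RDiv of rexp & rexp         (* x / 0 = 0 *)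
| RSqrt of rexp.              (* 0 on negative numbers *)

Inductive bexp : Type :=
| BNle of nexp & nexp
| BRle of rexp & rexp
| BNot of bexp
| BAnd of bexp & bexp.

Inductive cmd : Type :=
| Skip
| NSet of nat & nexp & nexp   (* array name, index, value *)
| RSet of nat & nexp & rexp   (* array name, index, value *)
| Flip of nat & nexp & rexp   (* array name, index, bias of the coin *)
| Seq of cmd & cmd
| If of bexp & cmd & cmd
| While of bexp & cmd.

Record state (R : realType) : Type := State {
  nmem : nat -> nat -> nat;
  rmem : nat -> nat -> R
}.

Definition upd (T : Type) (m : nat -> nat -> T) (a i : nat) (v : T) :
    nat -> nat -> T :=
  fun b j => if (b == a) && (j == i) then v else m b j.

Definition set_nat (R : realType) (s : state R) (a i v : nat) : state R :=
  State (upd (nmem s) a i v) (rmem s).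

Definition set_real (R : realType) (s : state R) (a i : nat) (v : R) :
    state R :=
  State (nmem s) (upd (rmem s) a i v).

Fixpoint neval (R : realType) (s : state R) (e : nexp) : nat :=
  match e with
  | NConst c => c
  | NGet a i => nmem s a (neval s i)
  | NAdd e1 e2 => (neval s e1 + neval s e2)%N
  | NSub e1 e2 => (neval s e1 - neval s e2)%N
  end.

Fixpoint reval (R : realType) (s : state R) (e : rexp) : R :=
  match e with
  | ROfNat e1 => (neval s e1)%:R
  | RGet a i => rmem s a (neval s i)
  | RAdd e1 e2 => reval s e1 + reval s e2
  | RSub e1 e2 => reval s e1 - reval s e2
  | RMul e1 e2 => reval s e1 * reval s e2
  | RDiv e1 e2 => reval s e1 / reval s e2
  | RSqrt e1 => Num.sqrt (reval s e1)
  end.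

Fixpoint beval (R : realType) (s : state R) (b : bexp) : bool :=
  match b with
  | BNle e1 e2 => (neval s e1 <= neval s e2)%N
  | BRle e1 e2 => reval s e1 <= reval s e2
  | BNot b1 => ~~ beval s b1
  | BAnd b1 b2 => beval s b1 && beval s b2
  end.

(* The stack of commands that remain to be executed, and the memory. *)
Definition config (R : realType) : Type := (seq cmd * state R)%type.

Definition halted (R : realType) (cf : config R) : bool := nilp cf.1.

(* One step, as the list of the possible successors with their probabilities.
   [Flip a i e] stores the truth value of [U < e] for a fresh [U] uniform on
   [0, 1]. *)
Definition step (R : realType) (cf : config R) : seq (R * config R) :=
  let: (K, s) := cf in
  match K with
  | [::] => [:: (1, cf)]
  | Skip :: K' => [:: (1, (K', s))]
  | NSet a i e :: K' => [:: (1, (K', set_nat s a (neval s i) (neval s e)))]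
  | RSet a i e :: K' => [:: (1, (K', set_real s a (neval s i) (reval s e)))]
  | Flip a i e :: K' =>
      let p := Num.max 0 (Num.min 1 (reval s e)) in
      [:: (p, (K', set_nat s a (neval s i) 1));
          (1 - p, (K', set_nat s a (neval s i) 0))]
  | Seq c1 c2 :: K' => [:: (1, (c1 :: c2 :: K', s))]
  | If b c1 c2 :: K' => [:: (1, ((if beval s b then c1 else c2) :: K', s))]
  | While b c :: K' =>
      [:: (1, (if beval s b then c :: While b c :: K' else K', s))]
  end.

(* The distribution of the configuration after [T] steps.  Every step has unit
   cost: the expressions of a fixed program have bounded size. *)
Fixpoint steps (R : realType) (T : nat) (cf : config R) :
    seq (R * config R) :=
  if T is T'.+1 then
    flatten [seq [seq (q.1 * r.1, r.2) | r <- steps T' q.2] | q <- step cf]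
  else [:: (1, cf)].

(** * List algorithms *)

(* Input layout: n, d, k in cells 0, 1, 2 of natural array 0; the coordinates
   of the points, row by row, in real array 0; the accuracy parameter in cell 0
   of real array 1; everything else is 0. *)
Definition input (R : realType) (n d k : nat) (eps : R)
    (X : 'I_n -> 'rV[R]_d) : state R :=
  State
    (fun a i => if a == 0%N then nth 0%N [:: n; d; k] i else 0%N)
    (fun a i =>
       if a == 0%N then
         \sum_(x < n) \sum_(j < d | (x * d + j)%N == i) X x 0 j
       else if (a == 1%N) && (i == 0%N) then eps else 0).

(* Output layout: the number of center sets in cell 0 of natural array 1; the
   coordinates of the centers, set after set, in real array 2. *)
Definition output (R : realType) (d k : nat) (s : state R) :
    seq ('I_k -> 'rV[R]_d) :=
  mkseq (fun l (i : 'I_k) => \row_(j < d) rmem s 2 ((l * k + i) * d + j))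
        (nmem s 1 0).

(* On input [(n, d, k, eps, X)], whatever the random choices, [P] halts within
   [T] steps with a list of at most [L] sets of centers; and for every
   clustering, fixed before the random choices are made, the list contains a
   (1 + eps)-approximate set of centers with probability at least 1/2. *)
Definition list_solves (R : realType) (P : cmd) (n d k : nat) (eps : R)
    (X : 'I_n -> 'rV[R]_d)
    (cost : ('I_n -> 'rV[R]_d) -> ('I_k -> 'rV[R]_d) ->
            ('I_k -> {set 'I_n}) -> R)
    (opt : ('I_n -> 'rV[R]_d) -> ('I_k -> {set 'I_n}) -> R)
    (T : nat) (L : R) : Prop :=
  let D := steps T ([:: P], input k eps X) in
  all (fun q : R * config R => (0 < q.1) ==>
         (halted q.2 && ((size (output d k q.2.2))%:R <= L))) D /\
  forall O : 'I_k -> {set 'I_n}, clustering O ->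
    1 / 2 <=
    \sum_(q <- D |
            has (fun C => cost X C O <= (1 + eps) * opt X O)
                (output d k q.2.2)) q.1.

(* 2 ^ (c * x * log (k / eps)), with the logarithm kept away from 0 so that the
   bound stays meaningful when k / eps is small.  As O-notation for eps -> 0,
   the constant c is meant to be uniform over eps in any bounded range (0, E].
   It cannot be uniform over all eps > 0: for eps = k the bound would be a
   constant, whereas for k / 2 widely separated groups of nearby points, a list
   good for every distribution of the k clusters among the groups has
   2 ^ Omega(k) elements, whatever eps. *)
Definition exp2_tilde (R : realType) (k : nat) (eps c x : R) : R :=
  2 `^ (c * x * ln (2 + k%:R / eps)).

(* Main.v *)
Require Import Defs.
From mathcomp Require Import all_boot all_order all_algebra all_fingroup.
From mathcomp Require Import all_classical all_reals all_analysis.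
From mathcomp Require Import zify ring lra.
(* [all_analysis] also defines an [edist]. *)
Require Import Defs.

(** Program a trial which succeeds with probability p = 2^(-O~(k/eps)) whatever
    the clustering, and repeat it ceil(1/p) times.  A trial builds k centers one
    by one.  A sample is, with equal probabilities, one of the centers found so
    far (or the origin) or a point drawn with probability proportional to its
    cost with respect to them.  Let O_j be the uncovered cluster of largest cost.
    Its points that are too close to the pool to be sampled often enough can be
    replaced by their nearest pool elements at a negligible cost, and each point
    of the modified cluster then has probability at least poly(eps/k) / |O_j|.
    So, up to a factor poly(eps/k)^M, M samples behave like M uniform samples of
    the modified cluster.  For k-means the mean of M = O(1/eps) uniform samples
    is good with probability 1/2.  For k-median, a stochastic subgradient descent
    of O(1/eps^3) steps, whose scale is the distance between two samples and
    which stops at a random time, is good with probability 2^(-O(M)). *)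

Set Implicit Arguments.
Unset Strict Implicit.
Unset Printing Implicit Defensive.

Import Order.TTheory GRing.Theory Num.Theory.
Local Open Scope ring_scope.

(** * Finite distributions *)

Section FiniteDistributions.
Variable R : realType.
Implicit Types A B : Type.

(** The program never sees the target clustering, so the choice of [O_j] lives in the analysis
    alone. It is linked to the actual run by [dominates]: every nonnegative test has expectation at
    least c times its value under ideal uniform sampling. This one-sided comparison composes through
    adaptive rounds, at the price of one factor c per sample, so the exponent of the success
    probability of a trial is the number [M * k] of samples. Replacing points costs a small part of
    the total optimum, possibly much more than the optimum of the cluster itself; hence each center
    is granted the additive slack [e / (2 * k) * opt]. Both costs have the form [g (sqdist u v)],
    with g the identity or the square root. Apart from the estimate for a single center, the
    analysis relies on g being nonnegative and monotone with [g 0 = 0], and on a weighted triangle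
    inequality, so it is done once for both. The program works with [e = eps / (1 + eps)], which is
    in (0, 1) for every eps > 0; the gap between e and eps leaves room for reference centers that
    are only nearly optimal. *)

Definition expect A (D : seq (R * A)) (F : A -> R) : R :=
  \sum_(q <- D) q.1 * F q.2.

Definition dret A (a : A) : seq (R * A) := [:: (1, a)].

Definition dbind A B (D : seq (R * A)) (k : A -> seq (R * B)) : seq (R * B) :=
  flatten [seq [seq (q.1 * r.1, r.2) | r <- k q.2] | q <- D].

Definition dmix A (p : R) (D1 D0 : seq (R * A)) : seq (R * A) :=
  dbind [:: (p, true); (1 - p, false)] (fun b => if b then D1 else D0).

Fixpoint diter A (f : nat -> A -> seq (R * A)) (i N : nat) (a : A) :
    seq (R * A) :=
  if N is N'.+1 then dbind (f i a) (diter f i.+1 N') else dret a.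

(** Positivity is asked of the expectation functional, not of each weight; [steps_ge0] gives the
    signs of the weights where single outcomes are inspected. *)
Definition isdist A (D : seq (R * A)) : Prop :=
  (forall F, (forall a, 0 <= F a) -> 0 <= expect D F) /\
  expect D (fun=> 1) = 1.

Lemma expect_ret A (a : A) F : expect (dret a) F = F a.
Proof. by rewrite /expect big_seq1 mul1r. Qed.

Lemma expect_bind A B (D : seq (R * A)) (k : A -> seq (R * B)) F :
  expect (dbind D k) F = expect D (fun a => expect (k a) F).
Proof.
rewrite /expect big_flatten big_map; apply: eq_bigr => q _.
by rewrite big_map mulr_sumr; apply: eq_bigr => r _; rewrite mulrA.
Qed.

Lemma expect_mix A p (D1 D0 : seq (R * A)) F :
  expect (dmix p D1 D0) F = p * expect D1 F + (1 - p) * expect D0 F.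
Proof. by rewrite expect_bind /expect big_cons big_seq1. Qed.

Lemma expectZ A (D : seq (R * A)) c F :
  expect D (fun a => c * F a) = c * expect D F.
Proof. by rewrite /expect mulr_sumr; apply: eq_bigr => q _; rewrite mulrCA. Qed.

Lemma expectD A (D : seq (R * A)) F G :
  expect D (fun a => F a + G a) = expect D F + expect D G.
Proof.
by rewrite /expect -big_split /=; apply: eq_bigr => q _; rewrite mulrDr.
Qed.

Lemma eq_expect A (D : seq (R * A)) F G : F =1 G -> expect D F = expect D G.
Proof. by move=> FG; apply: eq_bigr => q _; rewrite FG. Qed.

Lemma expect_cst A (D : seq (R * A)) c : isdist D -> expect D (fun=> c) = c.
Proof.
move=> [_ D1]; rewrite -[RHS]mulr1 -D1 -expectZ.
by apply: eq_expect => a; rewrite mulr1.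
Qed.

Lemma le_expect A (D : seq (R * A)) F G :
  isdist D -> (forall a, F a <= G a) -> expect D F <= expect D G.
Proof.
move=> [D0 _] FG; rewrite -subr_ge0.
have /D0 : forall a, 0 <= G a - F a by move=> a; rewrite subr_ge0.
rewrite (@eq_expect _ _ _ (fun a => G a + (-1) * F a)); last first.
  by move=> a; rewrite mulN1r.
by rewrite expectD expectZ mulN1r.
Qed.

Lemma isdist_ret A (a : A) : isdist (dret a).
Proof. by split=> [F F0|]; rewrite expect_ret. Qed.

Lemma isdist_bind A B (D : seq (R * A)) (k : A -> seq (R * B)) :
  isdist D -> (forall a, isdist (k a)) -> isdist (dbind D k).
Proof.
move=> hD hk; split=> [F F0|]; rewrite expect_bind.
  by apply: hD.1 => a; apply: (hk a).1.
rewrite (@eq_expect _ _ _ (fun=> 1)) ?expect_cst // => a.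
exact: (hk a).2.
Qed.

Lemma isdist_mix A p (D1 D0 : seq (R * A)) :
  0 <= p <= 1 -> isdist D1 -> isdist D0 -> isdist (dmix p D1 D0).
Proof.
move=> /andP[p0 p1] h1 h0; split=> [F F0|]; rewrite expect_mix.
  by rewrite addr_ge0 // mulr_ge0 ?subr_ge0 //; [apply: h1.1|apply: h0.1].
by rewrite h1.2 h0.2 !mulr1 addrC subrK.
Qed.

Lemma isdist_iter A (f : nat -> A -> seq (R * A)) N i a :
  (forall i a, isdist (f i a)) -> isdist (diter f i N a).
Proof.
move=> hf; elim: N i a => [|N IH] i a /=; first exact: isdist_ret.
by apply: isdist_bind.
Qed.

(** Nonnegative test functions replace a comparison of point masses, since a list may repeat an
    outcome and A carries no decidable equality. *)
Definition dominates A (c : R) (D D' : seq (R * A)) : Prop :=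
  forall F, (forall a, 0 <= F a) -> c * expect D' F <= expect D F.

(** The one-round comparison holds from every state, so the factor c is paid once per round even
    though the rounds are adaptive. *)
Lemma dominates_iter A (f f' : nat -> A -> seq (R * A)) c :
  0 <= c -> (forall i a, isdist (f i a)) -> (forall i a, isdist (f' i a)) ->
  (forall i a, dominates c (f i a) (f' i a)) ->
  forall N i a, dominates (c ^+ N) (diter f i N a) (diter f' i N a).
Proof.
move=> c0 hf hf' H; elim=> [|N IH] i a F F0 /=.
  by rewrite expr0 mul1r.
rewrite !expect_bind exprSr -mulrA.
apply: le_trans (le_expect (hf _ _) _); last by move=> b; exact: IH.
rewrite expectZ ler_wpM2l ?exprn_ge0 //; apply: H => b.
by apply: (isdist_iter _ _ _ hf').1.
Qed.

End FiniteDistributions.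

(** * A logic for randomized programs *)

Section ProgramLogic.
Variable R : realType.
Implicit Types (A : Type) (s : state R) (K : seq cmd) (G : state R -> R).

(** Runs that have not halted count for 0, so a lower bound on [after] with payoff 1 also proves
    termination. *)
Definition on_halt G (cf : config R) : R := if cf.1 is [::] then G cf.2 else 0.

Definition after (T : nat) (cf : config R) G : R :=
  expect (steps T cf) (on_halt G).

Definition clip (p : R) : R := Num.max 0 (Num.min 1 p).

Lemma clip_itv p : 0 <= clip p <= 1.
Proof. by rewrite /clip le_max lexx /= ge_max ler01 ge_min lexx. Qed.

Lemma clip_id p : 0 <= p <= 1 -> clip p = p.
Proof. by move=> /andP[p0 p1]; rewrite /clip min_r // max_r. Qed.

Lemma isdist_step (cf : config R) : isdist (step cf).
Proof.
case: cf => -[|c K] s; first exact: isdist_ret.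
case: c => [|a i e|a i e|a i e|c1 c2|b c1 c2|b c]; try exact: isdist_ret.
have /andP[p0 p1] := clip_itv (reval s e).
split=> [F F0|]; rewrite /expect big_cons big_seq1 /= -/(clip _).
  by rewrite addr_ge0 // mulr_ge0 // subr_ge0.
by rewrite !mulr1 addrC subrK.
Qed.

Lemma stepsS T (cf : config R) :
  steps T.+1 cf = dbind (step cf) (fun cf' => steps T cf').
Proof. by []. Qed.

Lemma isdist_steps T (cf : config R) : isdist (steps T cf).
Proof.
elim: T cf => [|T IH] cf; first exact: isdist_ret.
by rewrite stepsS; apply: isdist_bind => //; exact: isdist_step.
Qed.

Lemma afterS T cf G :
  after T.+1 cf G = expect (step cf) (fun cf' => after T cf' G).
Proof. by rewrite /after stepsS expect_bind. Qed.

Lemma on_halt_ge0 G cf : (forall s, 0 <= G s) -> 0 <= on_halt G cf.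
Proof. by move=> G0; rewrite /on_halt; case: cf.1. Qed.

Lemma after_ge0 T cf G : (forall s, 0 <= G s) -> 0 <= after T cf G.
Proof.
by move=> G0; apply: (isdist_steps T cf).1 => cf'; exact: on_halt_ge0.
Qed.

(** A halted configuration is fixed by [step], and a running one counts for 0 until it halts. *)
Lemma after_leS T cf G : (forall s, 0 <= G s) -> after T cf G <= after T.+1 cf G.
Proof.
move=> G0; elim: T cf => [|T IH] cf.
  case: cf => -[|c K] s; last first.
    by rewrite {1}/after /= expect_ret /on_halt /=; exact: after_ge0.
  by rewrite afterS /= (expect_ret ([::], s)).
rewrite (afterS T.+1) afterS.
by apply: le_expect => //; exact: isdist_step.
Qed.

Lemma after_le T T' cf G :
  (forall s, 0 <= G s) -> (T <= T')%N -> after T cf G <= after T' cf G.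
Proof.
move=> G0 /subnK <-; elim: (T' - T)%N => [|m IH] //.
by apply: le_trans IH _; rewrite addSn; exact: after_leS.
Qed.

(* The quantification over the remaining stack [K] and over the payoff makes
   the judgement compositional; the nonnegativity of [G] makes it stable under
   longer running times. *)
Definition sim (t : nat) (c : cmd) s A (D : seq (R * A))
    (Rel : A -> state R -> Prop) : Prop :=
  forall K T G F, (forall s', 0 <= G s') ->
    (forall a s', Rel a s' -> F a <= after T (K, s') G) ->
    expect D F <= after (t + T) (c :: K, s) G.

Definition dsim (t : nat) (c : cmd) s (Q : state R -> Prop) : Prop :=
  sim t c s (dret R tt) (fun=> Q).

Lemma sim_time t t' c s A (D : seq (R * A)) Rel :
  sim t c s D Rel -> (t <= t')%N -> sim t' c s D Rel.
Proof.
move=> H tt' K T G F G0 hF; apply: le_trans (H K T G F G0 hF) _.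
by apply: after_le; rewrite ?leq_add2r.
Qed.

Lemma sim_weak t c s A (D : seq (R * A)) (Rel Rel' : A -> state R -> Prop) :
  sim t c s D Rel -> (forall a s', Rel a s' -> Rel' a s') -> sim t c s D Rel'.
Proof.
move=> H RR K T G F G0 hF; apply: (H K T G F) => // a s' /RR; exact: hF.
Qed.

Lemma sim_expect t c s A (D D' : seq (R * A)) (Rel : A -> state R -> Prop) :
  sim t c s D Rel -> (forall F, expect D' F = expect D F) -> sim t c s D' Rel.
Proof. by move=> H DD K T G F G0 hF; rewrite DD; exact: H. Qed.

Lemma sim_ret t c s A (a : A) (Rel : A -> state R -> Prop) :
  dsim t c s (Rel a) -> sim t c s (dret R a) Rel.
Proof.
move=> H K T G F G0 hF; rewrite expect_ret.
have := H K T G (fun=> F a) G0; rewrite expect_ret; apply => _ s'; exact: hF.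
Qed.

Lemma sim_seq t1 t2 c1 c2 s A B (D1 : seq (R * A)) (D2 : A -> seq (R * B))
    (R1 : A -> state R -> Prop) (R2 : B -> state R -> Prop) :
  sim t1 c1 s D1 R1 -> (forall a s', R1 a s' -> sim t2 c2 s' (D2 a) R2) ->
  sim (t1 + t2).+1 (Seq c1 c2) s (dbind D1 D2) R2.
Proof.
move=> H1 H2 K T G F G0 hF.
rewrite expect_bind addSn afterS (expect_ret (c1 :: c2 :: K, s)) -addnA.
by apply: H1 => // a s' /H2; apply.
Qed.

Lemma dsim_seq t1 t2 c1 c2 s B (D : seq (R * B)) (Q : state R -> Prop)
    (R2 : B -> state R -> Prop) :
  dsim t1 c1 s Q -> (forall s', Q s' -> sim t2 c2 s' D R2) ->
  sim (t1 + t2).+1 (Seq c1 c2) s D R2.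
Proof.
move=> H1 H2; apply: sim_expect (sim_seq (D2 := fun=> D) H1 _) _.
  by move=> _ s'; exact: H2.
by move=> F; rewrite expect_bind expect_ret.
Qed.

(** Fused with [Seq], so that straight-line code is executed symbolically: one step for [Seq], one
    for the assignment. *)
Lemma sim_nset a i e s A (D : seq (R * A)) t c2 Rel :
  sim t c2 (set_nat s a (neval s i) (neval s e)) D Rel ->
  sim t.+2 (Seq (NSet a i e) c2) s D Rel.
Proof.
move=> H K T G F G0 hF; rewrite !addSn !afterS (expect_ret (_, s)) afterS.
rewrite expect_ret; exact: H.
Qed.

Lemma sim_rset a i e s A (D : seq (R * A)) t c2 Rel :
  sim t c2 (set_real s a (neval s i) (reval s e)) D Rel ->
  sim t.+2 (Seq (RSet a i e) c2) s D Rel.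
Proof.
move=> H K T G F G0 hF; rewrite !addSn !afterS (expect_ret (_, s)) afterS.
rewrite expect_ret; exact: H.
Qed.

Lemma dsim_skip s (Q : state R -> Prop) : Q s -> dsim 1 Skip s Q.
Proof.
move=> Qs K T G F G0 hF; rewrite expect_ret add1n afterS expect_ret; exact: hF.
Qed.

Lemma dsim_nset a i e s (Q : state R -> Prop) :
  Q (set_nat s a (neval s i) (neval s e)) -> dsim 1 (NSet a i e) s Q.
Proof.
move=> Qs K T G F G0 hF; rewrite expect_ret add1n afterS expect_ret; exact: hF.
Qed.

Lemma dsim_rset a i e s (Q : state R -> Prop) :
  Q (set_real s a (neval s i) (reval s e)) -> dsim 1 (RSet a i e) s Q.
Proof.
move=> Qs K T G F G0 hF; rewrite expect_ret add1n afterS expect_ret; exact: hF.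
Qed.

Lemma sim_flip a i e s A (D1 D0 : seq (R * A)) t c2 Rel :
  sim t c2 (set_nat s a (neval s i) 1) D1 Rel ->
  sim t c2 (set_nat s a (neval s i) 0) D0 Rel ->
  sim t.+2 (Seq (Flip a i e) c2) s (dmix (clip (reval s e)) D1 D0) Rel.
Proof.
move=> H1 H0 K T G F G0 hF; rewrite !addSn !afterS (expect_ret (_, s)) afterS.
rewrite expect_mix [leRHS]/expect big_cons big_seq1 /=.
have /andP[p0 p1] := clip_itv (reval s e).
by apply: lerD; apply: ler_wpM2l; rewrite ?subr_ge0 //; [exact: H1|exact: H0].
Qed.

Lemma sim_if b c1 c2 s A (D : seq (R * A)) t Rel :
  sim t (if beval s b then c1 else c2) s D Rel ->
  sim t.+1 (If b c1 c2) s D Rel.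
Proof.
move=> H K T G F G0 hF; rewrite !addSn !afterS expect_ret; exact: H.
Qed.

Lemma sim_skip c s A (D : seq (R * A)) t Rel :
  sim t c s D Rel -> sim t.+2 (Seq Skip c) s D Rel.
Proof.
move=> H K T G F G0 hF; rewrite !addSn !afterS (expect_ret (_, s)) afterS.
rewrite expect_ret; exact: H.
Qed.

(** Both commands reach the same stack, one after two steps and the other after one. *)
Lemma sim_if_seq b c1 c2 c3 s A (D : seq (R * A)) t Rel :
  sim t.+1 (Seq (if beval s b then c1 else c2) c3) s D Rel ->
  sim t.+2 (Seq (If b c1 c2) c3) s D Rel.
Proof.
move=> H K T G F G0 hF; have := H K T G F G0 hF.
by rewrite !addSn !afterS !expect_ret afterS expect_ret.
Qed.

(** The number N of iterations is deterministic: randomness affects the data but never the length of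
    a loop. Each iteration pays one step for the test, and the last test one more. *)
Lemma sim_while b c A (f : nat -> A -> seq (R * A))
    (Inv : nat -> A -> state R -> Prop) tb N :
  (forall i a s, (i < N)%N -> Inv i a s ->
     beval s b /\ sim tb c s (f i a) (Inv i.+1)) ->
  (forall a s, Inv N a s -> beval s b = false) ->
  forall a s, Inv 0%N a s ->
    sim (N * tb.+1).+1 (While b c) s (diter f 0 N a) (Inv N).
Proof.
move=> Hb HN.
suff H : forall m i a s, (i + m = N)%N -> Inv i a s ->
    sim (m * tb.+1).+1 (While b c) s (diter f i m a) (Inv N).
  by move=> a s; apply: (H N 0%N).
elim=> [|m IH] i a s.
  rewrite addn0 => -> Is K T G F G0 hF.
  by rewrite expect_ret mul0n add1n afterS /= (HN _ _ Is) expect_ret; exact: hF.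
move=> imN Is K T G F G0 hF.
have [bs Hc] := Hb i a s (ltac:(lia)) Is.
rewrite addSn afterS /= bs (expect_ret (_, s)) expect_bind.
have -> : (m.+1 * tb.+1 + T = tb + ((m * tb.+1).+1 + T))%N by lia.
apply: Hc => // a' s' Is'.
by apply: (IH i.+1 a' s' _ Is') => //; rewrite addSn -addnS.
Qed.

Lemma dsim_while b c (Inv : nat -> state R -> Prop) tb N :
  (forall i s, (i < N)%N -> Inv i s ->
     beval s b /\ dsim tb c s (Inv i.+1)) ->
  (forall s, Inv N s -> beval s b = false) ->
  forall s, Inv 0%N s ->
    dsim (N * tb.+1).+1 (While b c) s (Inv N).
Proof.
move=> Hb HN s Is.
apply: (@sim_expect _ _ _ _ (diter (fun _ (_ : unit) => dret R tt) 0 N tt)).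
  apply: (@sim_while b c unit _ (fun i _ => Inv i)) => // i _; exact: Hb.
move=> F; rewrite expect_ret; elim: N {Hb HN} 0%N => [|N IH] i /=.
  by rewrite expect_ret.
by rewrite expect_bind expect_ret -IH.
Qed.

End ProgramLogic.

(** * Approximate centers from uniform samples *)

Section Distances.
Variables (R : realType) (d : nat).
Implicit Types u v w z y c : 'rV[R]_d.

Lemma sqdist_ge0 u v : 0 <= sqdist u v.
Proof. by apply: sumr_ge0 => j _; exact: sqr_ge0. Qed.

Lemma sqdistC u v : sqdist u v = sqdist v u.
Proof. by apply: eq_bigr => j _; rewrite -sqrrN opprB. Qed.

Lemma sqdistxx u : sqdist u u = 0.
Proof. by apply: big1 => j _; rewrite subrr expr0n. Qed.

Lemma sqdist_eq0 u v : sqdist u v = 0 -> u = v.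
Proof.
move/eqP; rewrite psumr_eq0 => [/allP H|j _]; last exact: sqr_ge0.
apply/rowP => j; have /H := mem_index_enum j.
by rewrite sqrf_eq0 subr_eq0 => /eqP.
Qed.

Lemma edist_ge0 u v : 0 <= edist u v.
Proof. exact: sqrtr_ge0. Qed.

Lemma edistC u v : edist u v = edist v u.
Proof. by rewrite /edist sqdistC. Qed.

Lemma sqr_edist u v : edist u v ^+ 2 = sqdist u v.
Proof. by rewrite sqr_sqrtr ?sqdist_ge0. Qed.

Lemma edist_eq0 u v : edist u v = 0 -> u = v.
Proof. by move=> H; apply: sqdist_eq0; rewrite -sqr_edist H expr0n. Qed.

(** The norms p and q are parameters, which avoids square roots. Unless p or q is 0, the identity
    [\sum_i (q * a i - p * b i) ^+ 2 = 2 * (p * q) * (p * q - \sum_i a i * b i)] concludes. *)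
Lemma cauchy_schwarz (I : finType) (a b : I -> R) (p q : R) :
  0 <= p -> 0 <= q -> p ^+ 2 = \sum_i a i ^+ 2 -> q ^+ 2 = \sum_i b i ^+ 2 ->
  \sum_i a i * b i <= p * q.
Proof.
move=> p0 q0 pE qE.
have zero (e : I -> R) r : r ^+ 2 = \sum_i e i ^+ 2 -> r = 0 ->
    forall i, e i = 0.
  move=> rE r0 i; move: rE; rewrite r0 expr0n => /esym/eqP.
  rewrite psumr_eq0 => [/allP H|j _]; last exact: sqr_ge0.
  by have /H := mem_index_enum i; rewrite sqrf_eq0 => /eqP.
have [pz|pz] := eqVneq p 0.
  by rewrite pz mul0r big1 // => i _; rewrite (zero _ _ pE pz) mul0r.
have [qz|qz] := eqVneq q 0.
  by rewrite qz mulr0 big1 // => i _; rewrite (zero _ _ qE qz) mulr0.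
have : 0 <= \sum_i (q * a i - p * b i) ^+ 2.
  by apply: sumr_ge0 => i _; exact: sqr_ge0.
have -> : \sum_i (q * a i - p * b i) ^+ 2 =
    2 * (p * q) * (p * q - \sum_i a i * b i).
  transitivity (\sum_i (q ^+ 2 * a i ^+ 2 + p ^+ 2 * b i ^+ 2
      - 2 * (p * q) * (a i * b i))).
    by apply: eq_bigr => i _; ring.
  by rewrite sumrB big_split /= -!mulr_sumr -pE -qE; ring.
rewrite pmulr_rge0 ?subr_ge0 // !mulr_gt0 // lt_neqAle eq_sym.
  by rewrite pz p0.
by rewrite qz q0.
Qed.

Lemma edist_triangle v u w : edist u w <= edist u v + edist v w.
Proof.
rewrite -(ler_pXn2r (n := 2)) ?nnegrE ?edist_ge0 //; last first.
  by rewrite addr_ge0 ?edist_ge0.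
rewrite sqr_edist sqrrD !sqr_edist.
have -> : sqdist u w = sqdist u v +
    (\sum_j (u 0 j - v 0 j) * (v 0 j - w 0 j)) *+ 2 + sqdist v w.
  rewrite /sqdist -mulr_natr mulr_suml -!big_split /=.
  by apply: eq_bigr => j _; ring.
rewrite lerD2r lerD2l lerMn2r /=.
by apply: cauchy_schwarz; rewrite ?edist_ge0 // sqr_edist.
Qed.

(** In each coordinate the difference of the two sides is [a * (p - a^-1 * q) ^+ 2]. *)
Lemma sqdist_young (a : R) v u w : 0 < a ->
  sqdist u w <= (1 + a) * sqdist u v + (1 + a^-1) * sqdist v w.
Proof.
move=> a0; rewrite /sqdist !mulr_sumr -big_split /=.
apply: ler_sum => j _; set p := _ - v 0 j; set q := v 0 j - _.
have -> : u 0 j - w 0 j = p + q by rewrite /p /q; ring.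
rewrite -subr_ge0.
have -> : (1 + a) * p ^+ 2 + (1 + a^-1) * q ^+ 2 - (p + q) ^+ 2 =
    a * (p - a^-1 * q) ^+ 2 by field; lra.
by rewrite mulr_ge0 ?sqr_ge0 // ltW.
Qed.

(** Weaker than the triangle inequality, but of the same form as for squared distances. *)
Lemma edist_young (a : R) v u w : 0 < a ->
  edist u w <= (1 + a) * edist u v + (1 + a^-1) * edist v w.
Proof.
move=> a0; have := edist_triangle v u w.
have : 0 <= a * edist u v by rewrite mulr_ge0 ?edist_ge0 ?ltW.
have : 0 <= a^-1 * edist v w by rewrite mulr_ge0 ?edist_ge0 ?invr_ge0 ?ltW.
lra.
Qed.

(* One subgradient step of length [eta] for [z |-> edist y z]; when [y = z] the
   junk value [eta / 0 = 0] leaves [z] unchanged. *)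
Lemma sgd_step (eta : R) y z c : 0 <= eta ->
  sqdist (z + (eta / edist y z) *: (y - z)) c <=
  sqdist z c + 2 * eta * (edist y c - edist y z) + eta ^+ 2.
Proof.
move=> eta0; have [yz|yz] := eqVneq (edist y z) 0.
  rewrite yz invr0 mulr0 scale0r addr0 subr0 -addrA lerDl addr_ge0 ?sqr_ge0 //.
  by rewrite !mulr_ge0 // edist_ge0.
set g := eta / _.
have gE : g * edist y z = eta by rewrite /g divfK.
have g0 : 0 <= g by rewrite divr_ge0 ?edist_ge0.
have -> : sqdist (z + g *: (y - z)) c = sqdist z c +
    2 * g * (\sum_j (y 0 j - z 0 j) * (y 0 j - c 0 j) - sqdist y z)
    + g ^+ 2 * sqdist y z.
  rewrite /sqdist mulrBr !mulr_sumr -sumrB -!big_split /=.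
  by apply: eq_bigr => j _; rewrite !mxE; ring.
have CS : \sum_j (y 0 j - z 0 j) * (y 0 j - c 0 j) <= edist y z * edist y c.
  by apply: cauchy_schwarz; rewrite ?edist_ge0 // sqr_edist.
rewrite -(sqr_edist y z) -exprMn gE lerD2r lerD2l.
have -> : 2 * eta * (edist y c - edist y z) =
    2 * g * (edist y z * edist y c - edist y z ^+ 2) by rewrite -gE; ring.
apply: ler_wpM2l; first by rewrite mulr_ge0.
by rewrite lerD2r.
Qed.

End Distances.

(** * The inner loop, and k-means by running means *)

Section InnerLoop.
Variables (R : realType) (n d : nat).
Implicit Types (z y c : 'rV[R]_d) (zs : 'rV[R]_d * R).

Definition uniform (O : {set 'I_n}) (y : 'I_n -> 'rV[R]_d) :
    seq (R * 'rV[R]_d) :=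
  [seq (#|O|%:R^-1, y x) | x <- enum O].

(* [gam t s r] is the distribution of the step size, and of the next value of
   the scale register [s], at round [t], for a sample at squared distance [r]
   of the current point. *)
Definition inner_step (gam : nat -> R -> R -> seq (R * (R * R)))
    (smp : seq (R * 'rV[R]_d)) (t : nat) zs : seq (R * ('rV[R]_d * R)) :=
  dbind smp (fun y => dbind (gam t zs.2 (sqdist y zs.1)) (fun gs =>
    dret R (zs.1 + gs.1 *: (y - zs.1), gs.2))).

Lemma expect_uniform (O : {set 'I_n}) (y : 'I_n -> 'rV[R]_d) F :
  expect (uniform O y) F = #|O|%:R^-1 * \sum_(x in O) F (y x).
Proof.
rewrite /expect big_map /= mulr_sumr -big_enum /=.
by apply: eq_bigr.
Qed.

Lemma isdist_uniform (O : {set 'I_n}) (y : 'I_n -> 'rV[R]_d) :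
  (0 < #|O|)%N -> isdist (uniform O y).
Proof.
move=> O0; split=> [F F0|]; rewrite expect_uniform.
  by rewrite mulr_ge0 ?invr_ge0 // sumr_ge0.
by rewrite sumr_const mulVf // pnatr_eq0 -lt0n.
Qed.

Lemma expect_inner_step gam smp t zs F :
  expect (inner_step gam smp t zs) F =
  expect smp (fun y => expect (gam t zs.2 (sqdist y zs.1)) (fun gs =>
    F (zs.1 + gs.1 *: (y - zs.1), gs.2))).
Proof.
rewrite expect_bind; apply: eq_expect => y; rewrite expect_bind.
by apply: eq_expect => gs; rewrite expect_ret.
Qed.

Lemma isdist_inner_step gam smp t zs :
  (forall t s r, isdist (gam t s r)) -> isdist smp ->
  isdist (inner_step gam smp t zs).
Proof.
move=> hg hs; apply: isdist_bind => // y; apply: isdist_bind => // gs.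
exact: isdist_ret.
Qed.

Section Means.
Variables (O : {set 'I_n}) (y : 'I_n -> 'rV[R]_d).
Hypothesis O0 : (0 < #|O|)%N.

(** These step sizes make the current point the running mean of the samples; the step 1 of round 0
    forgets the initial point. *)
Definition gam_means (t : nat) (s r : R) : seq (R * (R * R)) :=
  dret R (t.+1%:R^-1, s).

Let m : R := #|O|%:R.
Let mu : 'rV[R]_d := m^-1 *: \sum_(x in O) y x.
Let V := \sum_(x in O) sqdist (y x) mu.
Let f := inner_step gam_means (uniform O y).

Let m_gt0 : 0 < m. Proof. by rewrite ltr0n. Qed.

Let sum_mu (j : 'I_d) : \sum_(x in O) (y x 0 j - mu 0 j) = 0.
Proof.
rewrite sumrB sumr_const -mulr_natl !mxE summxE mulrA divff ?mul1r ?subrr //.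
by rewrite gt_eqF.
Qed.

(** Parallel axis identity: the cross term vanishes by [sum_mu]. In particular mu minimizes the
    cost, with value V. *)
Let sum_sqdist c : \sum_(x in O) sqdist (y x) c = V + m * sqdist mu c.
Proof.
rewrite /V /sqdist exchange_big [in RHS]exchange_big /= mulr_sumr -big_split /=.
apply: eq_bigr => j _.
transitivity (\sum_(x in O) ((y x 0 j - mu 0 j) ^+ 2
   + 2 * (mu 0 j - c 0 j) * (y x 0 j - mu 0 j) + (mu 0 j - c 0 j) ^+ 2)).
  by apply: eq_bigr => x _; ring.
by rewrite !big_split /= -mulr_sumr sum_mu mulr0 addr0 sumr_const -mulr_natl.
Qed.

Let sum_step g z : \sum_(x in O) sqdist (z + g *: (y x - z)) mu =
  (1 - g) ^+ 2 * (m * sqdist z mu) + g ^+ 2 * V.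
Proof.
rewrite /V /sqdist exchange_big [in RHS]exchange_big /= !mulr_sumr -big_split /=.
apply: eq_bigr => j _.
transitivity (\sum_(x in O) ((1 - g) ^+ 2 * (z 0 j - mu 0 j) ^+ 2
   + 2 * g * (1 - g) * (z 0 j - mu 0 j) * (y x 0 j - mu 0 j)
   + g ^+ 2 * (y x 0 j - mu 0 j) ^+ 2)).
  by apply: eq_bigr => x _; rewrite !mxE; ring.
by rewrite !big_split /= -!mulr_sumr sum_mu mulr0 addr0 sumr_const -mulr_natl; ring.
Qed.

(* The running mean [z_t] satisfies [t ^ 2 * E |z_t - mu| ^ 2 = t * V / m]. *)
Let expect_running_mean t r zs :
  (t + r)%:R ^+ 2 * expect (diter f t r zs) (fun zs' => sqdist zs'.1 mu) =
  t%:R ^+ 2 * sqdist zs.1 mu + r%:R * (V / m).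
Proof.
elim: r t zs => [|r IH] t zs /=; first by rewrite expect_ret addn0 mul0r addr0.
rewrite expect_bind -expectZ.
under eq_expect => a do rewrite -addSnnS IH.
rewrite expect_inner_step expect_uniform /=.
under eq_bigr => x _ do rewrite expect_ret /=.
rewrite big_split /= -mulr_sumr sum_step sumr_const -[_ *+ _]mulr_natl -/m.
have tn : t.+1%:R != 0 :> R by rewrite pnatr_eq0.
have mn : m != 0 by rewrite gt_eqF.
rewrite -[r.+1]addn1 natrD -[in LHS]addn1 natrD in tn *.
by field; rewrite mn -natr1 in tn *.
Qed.

(** The mean of [m * sqdist z mu] is [V / M], so by Markov's inequality it exceeds [e / 8 * V] with
    probability at most [8 / (e * M)], hence at most 1/2. The weaker bound [4^-1 ^+ M] is the form
    shared with k-median. *)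
Lemma inner_means (e : R) c zs M : 0 < e -> 1 <= M%:R * (e / 16) ->
  4^-1 ^+ M <= expect (diter f 0 M zs) (fun zs' =>
    (\sum_(x in O) sqdist (y x) zs'.1 <=
       (1 + e / 8) * \sum_(x in O) sqdist (y x) c)%R%:R).
Proof.
move=> e0 Me.
have M0 : (0 < M)%N.
  by case: M Me => // Me; exfalso; move: Me; rewrite mul0r; lra.
have df t zs' : isdist (f t zs').
  apply: isdist_inner_step; last exact: isdist_uniform.
  by move=> *; exact: isdist_ret.
have V0 : 0 <= V by apply: sumr_ge0 => x _; exact: sqdist_ge0.
have good z : m * sqdist z mu <= e / 8 * V ->
    \sum_(x in O) sqdist (y x) z <= (1 + e / 8) * \sum_(x in O) sqdist (y x) c.
  move=> H; rewrite !sum_sqdist sqdistC.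
  have : 0 <= m * sqdist mu c by rewrite mulr_ge0 ?sqdist_ge0 // ltW.
  have := e0; move: (m * sqdist mu c) => q e0' q0.
  have : 0 <= e / 8 * q by rewrite mulr_ge0 //; lra.
  by rewrite mulrDl mul1r mulrDr; lra.
have le4 : (4^-1 : R) ^+ M <= 4^-1.
  by rewrite -[leRHS]expr1 ler_wiXn2l ?invr_ge0 //; lra.
(* If V = 0 the Markov threshold is 0; but then all points equal mu, and the first step lands there
   for good. *)
have [Vz|Vn] := eqVneq V 0.
  have yE x : x \in O -> y x = mu.
    move=> xO; apply: sqdist_eq0; move/eqP: Vz; rewrite psumr_eq0.
      by move=> /allP/(_ x (mem_index_enum x)); rewrite xO => /eqP.
    by move=> *; exact: sqdist_ge0.
  have stay r t s : 
      expect (diter f t r (mu, s)) (fun zs' => (zs'.1 == mu)%:R) = 1.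
    elim: r t s => [|r IH] t s /=; first by rewrite expect_ret eqxx.
    rewrite expect_bind expect_inner_step expect_uniform /=.
    rewrite (eq_bigr (fun=> 1)).
      by rewrite sumr_const mulVf // gt_eqF.
    by move=> x xO; rewrite expect_ret /= yE // subrr scaler0 addr0 IH.
  apply: le_trans le4 _; apply: (@le_trans _ _ 1); first lra.
  apply: le_trans (le_expect (F := fun zs' => (zs'.1 == mu)%:R) _ _).
  - case: M M0 {Me} => // M _ /=.
    rewrite expect_bind expect_inner_step expect_uniform /=.
    rewrite (eq_bigr (fun=> 1)).
      by rewrite sumr_const mulVf // gt_eqF.
    move=> x xO; rewrite expect_ret /= yE // invr1 scale1r addrC subrK.
    by rewrite stay.
  - exact: isdist_iter.
  - move=> [z s] /=; case: eqP => [->|_]; last exact: ler0n.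
    rewrite good // sqdistxx mulr0 mulr_ge0 //.
    lra.
have Vp : 0 < V by rewrite lt_neqAle eq_sym Vn.
have EX : expect (diter f 0 M zs) (fun zs' => sqdist zs'.1 mu) =
    V / m / M%:R.
  have := expect_running_mean 0 M zs; rewrite add0n expr0n mul0r add0r => H.
  have Mn : M%:R != 0 :> R by rewrite pnatr_eq0 -lt0n.
  apply: (mulfI (expf_neq0 2 Mn)); rewrite H; field.
  by rewrite Mn gt_eqF.
(* Markov's inequality: an affine function of the squared distance lies below the indicator of
   success. *)
apply: le_trans (le_expect (F := fun zs' =>
  1 + (- (m / (e / 8 * V))) * sqdist zs'.1 mu) _ _); last first.
- move=> [z s] /=; have [H|] := leP (m * sqdist z mu) (e / 8 * V).
    rewrite (good _ H) mulNr gerBl mulr_ge0 ?sqdist_ge0 // divr_ge0 ?ltW //.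
    by rewrite mulr_gt0 //; lra.
  move=> H; apply: le_trans (_ : 0 <= _); last exact: ler0n.
  rewrite mulNr subr_le0 mulrAC ler_pdivlMr ?mul1r ?ltW //.
  by rewrite mulr_gt0 //; lra.
- exact: isdist_iter.
- rewrite expectD expectZ EX expect_cst; last exact: isdist_iter.
  apply: le_trans le4 _.
  have Mp : 0 < M%:R :> R by rewrite ltr0n.
  have -> : - (m / (e / 8 * V)) * (V / m / M%:R) = - (M%:R * (e / 8))^-1.
    by field; rewrite !gt_eqF.
  have : (M%:R * (e / 8))^-1 <= 2^-1 by rewrite lef_pV2 ?posrE //; lra.
  by lra.
Qed.

End Means.
End InnerLoop.

Lemma eq_ler (R : realType) (a b : R) : a = b -> a <= b.
Proof. by move->. Qed.

(** * k-median by stochastic subgradient descent *)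

Section Medians.
Variables (R : realType) (n d : nat) (O : {set 'I_n}) (y : 'I_n -> 'rV[R]_d).
Hypothesis O0 : (0 < #|O|)%N.

(* Round 0 moves to the sample, round 1 stores a multiple of the distance to the
   next sample as the length [s] of the subgradient steps, and each later round
   either stops for good, by setting [s] to 0, or makes a step. *)
Definition gam_median (e : R) (t : nat) (s r : R) : seq (R * (R * R)) :=
  match t with
  | 0 => dret R (1, s)
  | 1 => dret R (0, e / 96 * Num.sqrt r)
  | _ => dmix (1 / 2) (dret R (0, 0)) (dret R (s / Num.sqrt r, s))
  end.

Lemma isdist_gam_median e t s r : isdist (gam_median e t s r).
Proof.
case: t => [|[|t]]; try exact: isdist_ret.
by apply: isdist_mix; [lra|exact: isdist_ret..].
Qed.

Lemma expect_gam_median e t s r F : expect (gam_median e t.+2 s r) F =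
  1 / 2 * F (0, 0) + 1 / 2 * F (s / Num.sqrt r, s).
Proof. by rewrite expect_mix !expect_ret; lra. Qed.

Variables (e : R) (c : 'rV[R]_d).
Hypothesis e01 : 0 < e < 1.

Let m : R := #|O|%:R.
Let S := \sum_(x in O) edist (y x) c.
Let fs := S / m.
Let f := inner_step (gam_median e) (uniform O y).
Let good (z : 'rV[R]_d) : bool :=
  \sum_(x in O) edist (y x) z <= (1 + e / 8) * S.

Let m_gt0 : 0 < m. Proof. by rewrite ltr0n. Qed.

Let fsE : m * fs = S. Proof. by rewrite /fs mulrC divfK // gt_eqF. Qed.

Let S_ge0 : 0 <= S. Proof. by apply: sumr_ge0 => x _; exact: edist_ge0. Qed.

Let fs_ge0 : 0 <= fs. Proof. by rewrite divr_ge0 // ltW. Qed.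

Let isdist_f t zs : isdist (f t zs).
Proof.
apply: isdist_inner_step; last exact: isdist_uniform.
exact: isdist_gam_median.
Qed.

Let win r t zs := expect (diter f t r zs) (fun zs' => (good zs'.1)%:R).

Let win_ge0 r t zs : 0 <= win r t zs.
Proof. by apply: (isdist_iter _ _ _ isdist_f).1 => a; exact: ler0n. Qed.

Let win0 r t z : win r t.+2 (z, 0) = (good z)%:R.
Proof.
elim: r t => [|r IH] t; first by rewrite /win expect_ret.
rewrite /win /= expect_bind expect_inner_step.
rewrite -[RHS](expect_cst _ (isdist_uniform y O0)).
apply: eq_expect => x; apply: etrans (expect_gam_median _ _ _ _ _) _.
rewrite /= mul0r !scale0r addr0.
by rewrite -/(win r t.+3 (z, 0)) IH; field.
Qed.

Let winS r t z s : win r.+1 t.+2 (z, s) =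
  1 / 2 * (good z)%:R + 1 / 2 * (m^-1 * \sum_(x in O)
     win r t.+3 (z + (s / edist (y x) z) *: (y x - z), s)).
Proof.
rewrite {1}/win /= expect_bind expect_inner_step expect_uniform -/m.
rewrite (eq_bigr (fun x => 1 / 2 * (good z)%:R + 1 / 2 *
    win r t.+3 (z + (s / edist (y x) z) *: (y x - z), s))); last first.
  move=> x _; apply: etrans (expect_gam_median _ _ _ _ _) _.
  by rewrite /= scale0r addr0 -/(win r t.+3 (z, 0)) win0.
rewrite big_split /= sumr_const -[_ *+ _]mulr_natl -/m -mulr_sumr.
by field; rewrite gt_eqF.
Qed.

Let win_avg_ge0 r t z s : 0 <= 1 / 2 * (m^-1 * \sum_(x in O)
  win r t.+3 (z + (s / edist (y x) z) *: (y x - z), s)).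
Proof.
apply: mulr_ge0; first lra.
by rewrite mulr_ge0 ?invr_ge0 ?(ltW m_gt0) ?sumr_ge0 // => *; exact: win_ge0.
Qed.

(** As z is not good, the linear term of [sgd_step] gains at least [2 * s * (e / 8 * fs)] on
    average, and the bound on s makes the quadratic term lose at most half of it. *)
Let sum_sgd z s : 0 <= s -> ~~ good z -> s <= e / 8 * fs ->
  m^-1 * \sum_(x in O) sqdist (z + (s / edist (y x) z) *: (y x - z)) c <=
  sqdist z c - s * (e / 8 * fs).
Proof.
move=> s0; rewrite -ltNge => bad se.
rewrite mulrC ler_pdivrMr //.
apply: le_trans (ler_sum _ (fun x _ => sgd_step (y x) z c s0)) _.
rewrite !big_split /= -mulr_sumr sumrB -/S !sumr_const.
rewrite -(mulr_natl (sqdist z c)) -(mulr_natl (s ^+ 2)) -/m.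
set P := \sum_(_ in O) edist _ z in bad *.
have : s * (P - S) >= s * (e / 8 * S).
  by rewrite ler_wpM2l //; move: bad; lra.
have : s * s * m <= s * (e / 8 * S).
  by rewrite -mulrA ler_wpM2l // -fsE mulrCA [leRHS]mulrC ler_wpM2r // ltW.
rewrite -fsE; set u := s * (_ * (m * _)); set v := s * (P - _).
have -> : (sqdist z c - s * (e / 8 * fs)) * m = m * sqdist z c - u.
  by rewrite /u; ring.
have -> : 2 * s * (m * fs - P) = - (2 * v) by rewrite /v; ring.
rewrite expr2 [m * (s * s)]mulrC; move: (s * s * m) (m * _) => *; lra.
Qed.

(* While [z] is not good, a step decreases [sqdist z c] by [s * (e / 8 * fs)] on
   average; a good [z] is kept for good with probability 1/2.  Hence the linear
   potential on the left. *)
Let win_sgd N s r t z : 0 < s -> s <= e / 8 * fs ->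
  r%:R * (s * (e / 8 * fs)) <= N -> 0 < N ->
  2^-1 ^+ r * ((r%:R * (s * (e / 8 * fs)) - sqdist z c) / N) <=
  win r t.+2 (z, s).
Proof.
move=> s0 se; set D := s * _; move=> rN N0.
have D0 : 0 <= D by rewrite /D mulr_ge0 ?(le_trans _ se) ?ltW.
elim: r t z rN => [|r IH] t z rN.
  rewrite mul0r sub0r expr0 mul1r; apply: le_trans (win_ge0 _ _ _).
  by rewrite mulNr oppr_le0 divr_ge0 ?sqdist_ge0 ?ltW.
have rN' : r%:R * D <= N.
  by apply: le_trans rN; rewrite ler_wpM2r // ler_nat.
rewrite winS; case: (boolP (good z)) => gz.
  apply: (@le_trans _ _ (1 / 2)); last first.
    by rewrite mulr1 lerDl win_avg_ge0.
  have H1 : (2^-1 : R) ^+ r <= 1 by rewrite exprn_ile1 //; lra.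
  have H0 : 0 <= (2^-1 : R) ^+ r.+1 by rewrite exprn_ge0.
  (* The normalization by N keeps the potential at most 1, so stopping now, with probability 1/2, is
     enough. *)
  have H2 : (r.+1%:R * D - sqdist z c) / N <= 1.
    by rewrite ler_pdivrMr // mul1r; have := sqdist_ge0 z c; lra.
  apply: le_trans (ler_wpM2l H0 H2) _.
  by rewrite mulr1 exprS; lra.
rewrite mulr0 add0r exprS -mulrA div1r ler_wpM2l ?invr_ge0 //.
apply: (@le_trans _ _ (m^-1 * \sum_(x in O) 2^-1 ^+ r *
    ((r%:R * D - sqdist (z + (s / edist (y x) z) *: (y x - z)) c) / N))).
  rewrite -mulr_sumr [leRHS]mulrCA ler_wpM2l ?exprn_ge0 ?invr_ge0 //.
  rewrite -mulr_suml [leRHS]mulrA ler_wpM2r ?invr_ge0 ?(ltW N0) //.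
  rewrite sumrB sumr_const -(mulr_natl (r%:R * D)) -/m mulrBr.
  rewrite mulKf ?gt_eqF //.
  have := sum_sgd (ltW s0) gz se; rewrite -/D -natr1 mulrDl mul1r; lra.
rewrite ler_wpM2l ?invr_ge0 ?(ltW m_gt0) //; apply: ler_sum => x _.
exact: IH.
Qed.

Let win_stop r t z s : good z -> 1 / 2 <= win r.+1 t.+2 (z, s).
Proof.
by move=> gz; rewrite winS gz mulr1 lerDl win_avg_ge0.
Qed.

(** Markov's inequality in counting form. *)
Let sum_le (a : 'I_n -> R) (q : R) : (forall x, 0 <= a x) -> 0 < q ->
  m - q^-1 * \sum_(x in O) a x <= \sum_(x in O) (a x <= q)%R%:R.
Proof.
move=> a0 q0.
have -> : m - q^-1 * \sum_(x in O) a x = \sum_(x in O) (1 - q^-1 * a x).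
  by rewrite sumrB sumr_const -mulr_sumr.
apply: ler_sum => x _; have [H|H] := leP (a x) q.
  by rewrite gerBl mulr_ge0 // invr_ge0 ltW.
by rewrite subr_le0 mulrC ler_pdivlMr // mul1r ltW.
Qed.

(* If [z] is not good then at least half of the points are not close to [z]:
   otherwise moving from [z] to [c] would not gain much. *)
Let scale_guess z : edist z c <= 2 * fs -> ~~ good z ->
  0 < fs /\ m / 4 <= \sum_(x in O)
    (e / 32 * fs <= edist (y x) z <= 12 * fs)%R%:R.
Proof.
move=> Rle; rewrite -ltNge => bad; move: e01 => /andP[e0 e1].
set Z := edist z c in Rle.
have Z0 : 0 <= Z := edist_ge0 _ _.
set P := \sum_(_ in O) edist _ z in bad.
(* With [u = e / 32 * fs], a point within u of z is at distance at least [Z - u] from c and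
   contributes at most [2 * u - Z] to [P - S]; any other contributes at most Z. *)
have PS : P - S <= m * (2 * (e / 32 * fs) - Z) +
    2 * Z * \sum_(x in O) (e / 32 * fs <= edist (y x) z)%R%:R.
  have -> : m * (2 * (e / 32 * fs) - Z) =
      \sum_(x in O) (2 * (e / 32 * fs) - Z) by rewrite sumr_const -[RHS]mulr_natl.
  rewrite /P /S -sumrB mulr_sumr -big_split /=; apply: ler_sum => x _.
  have T1 := edist_triangle c (y x) z.
  have T2 := edist_triangle (y x) z c.
  rewrite (edistC c z) -/Z in T1; rewrite (edistC z (y x)) -/Z in T2.
  have u0 : 0 <= e / 32 * fs.
    by apply: mulr_ge0; [lra|rewrite divr_ge0 // ltW].
  by have [H|H] := leP (e / 32 * fs) (edist (y x) z); rewrite ?mulr1 ?mulr0; lra.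
set Far := \sum_(x in O) _ in PS.
have FarLe : Far <= m.
  rewrite /Far /m -sumr_const; apply: ler_sum => x _.
  by rewrite (ler_nat _ _ 1) leq_b1.
have Zp : 0 < Z.
  rewrite lt_neqAle Z0 andbT eq_sym; apply/eqP => Zz.
  move: PS bad; rewrite Zz -fsE subr0 mulr0 mul0r addr0.
  have : 0 <= m * (e * fs).
    by rewrite mulr_ge0 ?(ltW m_gt0) // mulr_ge0 ?(ltW e0) ?fs_ge0.
  have -> : m * (2 * (e / 32 * fs)) = m * (e * fs) / 16 by field.
  have -> : (1 + e / 8) * (m * fs) = m * fs + m * (e * fs) / 8 by field.
  move: (m * (e * fs)) (m * fs) => *; lra.
have fp : 0 < fs by lra.
split=> //.
have FarGe : m / 2 <= Far.
  have H : 2 * Z * (Far - m / 2) >= 0.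
    move: PS bad; rewrite -fsE.
    have -> : m * (2 * (e / 32 * fs) - Z) = m * (e * fs) / 16 - m * Z by field.
    have -> : (1 + e / 8) * (m * fs) = m * fs + m * (e * fs) / 8 by field.
    have -> : 2 * Z * (Far - m / 2) = 2 * Z * Far - m * Z by field.
    have : 0 <= m * (e * fs).
      by rewrite mulr_ge0 ?(ltW m_gt0) // mulr_ge0 ?(ltW e0) ?fs_ge0.
    move: (m * (e * fs)) (m * fs) (m * Z) (2 * Z * Far) => *; lra.
  by move: H; rewrite pmulr_rge0 ?mulr_gt0 // subr_ge0.
(* The mean distance to z is at most [3 * fs], so at most a quarter of the points lie beyond
   [12 * fs]; as half of them are far enough from z, a quarter fall in the window. *)
have PLe : P <= 3 * S.
  apply: (@le_trans _ _ (S + m * Z)).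
    have -> : m * Z = \sum_(x in O) Z by rewrite sumr_const -[RHS]mulr_natl.
    rewrite /P /S -big_split /=; apply: ler_sum => x _.
    by have := edist_triangle c (y x) z; rewrite (edistC c z).
  have : m * Z <= m * (2 * fs) by rewrite ler_wpM2l ?(ltW m_gt0).
  rewrite (mulrCA m) fsE; lra.
have LeGe := @sum_le (fun x => edist (y x) z) (12 * fs)
  (fun x => edist_ge0 _ _) (ltac:(lra)).
have H3 : (12 * fs)^-1 * P <= m / 4.
  rewrite mulrC ler_pdivrMr; last lra.
  have -> : m / 4 * (12 * fs) = 3 * (m * fs) by field.
  by rewrite fsE.
have : \sum_(x in O) ((e / 32 * fs <= edist (y x) z)%R%:R +
    (edist (y x) z <= 12 * fs)%R%:R - 1) <=
    \sum_(x in O) (e / 32 * fs <= edist (y x) z <= 12 * fs)%R%:R :> R.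
  apply: ler_sum => x _; case: (e / 32 * fs <= _); case: (edist _ _ <= _);
    by rewrite /= ?mulr1n ?mulr0n; lra.
rewrite sumrB big_split /= -/Far sumr_const -/m.
move: LeGe; rewrite -/P; lra.
Qed.

(** The first sample is within [2 * fs] of c with probability 1/2, the second gives a usable scale
    with probability 1/4, and the T = M - 2 remaining rounds succeed with probability
    [2^-1 ^+ T / 2]. The product is at least [4^-1 ^+ M]; a first sample that is already good only
    helps. *)
Lemma inner_median zs M : 1 <= M%:R * (e / 64) ^+ 3 ->
  4^-1 ^+ M <= expect (diter f 0 M zs) (fun zs' =>
    (\sum_(x in O) edist (y x) zs'.1 <=
       (1 + e / 8) * \sum_(x in O) edist (y x) c)%R%:R).
Proof.
move=> Me; have /andP[e0 e1] := e01.
have e3 : (e / 64) ^+ 3 <= 1 / 8.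
  have -> : 1 / 8 = (1 / 2) ^+ 3 :> R by field.
  by rewrite lerXn2r ?nnegrE; lra.
have Mbig : 8 <= M%:R :> R.
  have : M%:R * (e / 64) ^+ 3 <= M%:R * (1 / 8) by rewrite ler_wpM2l.
  by lra.
case: M Me Mbig => [|[|[|r]]] Me Mbig.
- by exfalso; move: Mbig; rewrite mulr0n; lra.
- by exfalso; move: Mbig; rewrite mulr1n; lra.
- by exfalso; lra.
set T := r.+1.
have -> : expect (diter f 0 T.+2 zs) (fun zs' => (good zs'.1)%:R) =
    m^-1 * \sum_(x in O) (m^-1 * \sum_(x' in O)
      win T 2 (y x, e / 96 * edist (y x') (y x))).
  rewrite [diter _ _ _ _]/= expect_bind expect_inner_step expect_uniform -/m.
  congr (_ * _); apply: eq_bigr => x _.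
  rewrite expect_ret expect_bind expect_inner_step expect_uniform -/m.
  congr (_ * _); apply: eq_bigr => x' _.
  by rewrite expect_ret /= scale1r scale0r addr0 addrC subrK.
set B : R := 4^-1 * (2^-1 ^+ T / 2).
have B0 : 0 <= B by rewrite /B !mulr_ge0 ?invr_ge0 ?exprn_ge0.
have pow1 : (2^-1 : R) ^+ T <= 1 by rewrite exprn_ile1 //; lra.
have pow0 : 0 <= (2^-1 : R) ^+ T by rewrite exprn_ge0.
have mn : m != 0 by rewrite gt_eqF.
have start x : edist (y x) c <= 2 * fs -> B <= m^-1 * \sum_(x' in O)
      win T 2 (y x, e / 96 * edist (y x') (y x)).
  move=> Rle; rewrite mulrC ler_pdivlMr //.
  case: (boolP (good (y x))) => gx.
    apply: (@le_trans _ _ (1 / 2 * m)).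
      by rewrite ler_wpM2r ?ltW // /B; lra.
    rewrite mulrC -[m * _]mulr1 /m -mulrA mulr_natl mulr1 -sumr_const.
    by apply: ler_sum => x' _; exact: win_stop.
  have [fp cnt] := scale_guess Rle gx.
  apply: (@le_trans _ _ ((2^-1 ^+ T / 2) * (m / 4))).
    by rewrite /B; apply: eq_ler; field.
  apply: le_trans (ler_wpM2l _ cnt) _; first by rewrite divr_ge0.
  rewrite mulr_sumr; apply: ler_sum => x' _.
  case: (boolP (_ <= _ <= _)); last by rewrite mulr0 win_ge0.
  rewrite mulr1 => /andP[w1 w2].
  (* [96 = 8 * 12]: the upper end [12 * fs] of the window becomes the largest step length
     [e / 8 * fs] allowed by [win_sgd]. *)
  set s := e / 96 * _.
  have s0 : 0 < s.
    have p1 : 0 < e / 32 * fs by apply: mulr_gt0 => //; lra.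
    by apply: mulr_gt0; [lra|exact: lt_le_trans p1 w1].
  have se : s <= e / 8 * fs.
    have : e / 96 * edist (y x') (y x) <= e / 96 * (12 * fs).
      by rewrite ler_wpM2l //; lra.
    by rewrite /s; lra.
  have D0 : 0 < s * (e / 8 * fs).
    by apply: mulr_gt0 => //; apply: mulr_gt0 => //; lra.
  have T0 : 0 < T%:R :> R by rewrite ltr0n.
  apply: le_trans (@win_sgd (T%:R * (s * (e / 8 * fs))) s T 0 (y x) s0 se
    (lexx _) (mulr_gt0 T0 D0)).
  rewrite ler_wpM2l // ler_pdivlMr; last exact: mulr_gt0 T0 D0.
  (* This is twice the bound [(2 * fs) ^+ 2] on the initial squared distance, so the potential
     starts at 1/2 or more. As [(e / 64) ^+ 3 <= 1 / 8], the two rounds of preparation cost at most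
     a quarter, and [3/4 * 32/3 = 8]. *)
  have DT : 8 * fs ^+ 2 <= T%:R * (s * (e / 8 * fs)).
    have s1 : e / 96 * (e / 32 * fs) <= s by rewrite ler_wpM2l //; lra.
    have : e / 96 * (e / 32 * fs) * (e / 8 * fs) <= s * (e / 8 * fs).
      by rewrite ler_wpM2r // mulr_ge0 //; lra.
    have -> : e / 96 * (e / 32 * fs) * (e / 8 * fs) =
      (e / 64) ^+ 3 * (32 / 3) * fs ^+ 2 by field.
    move=> H; apply: le_trans (ler_wpM2l (ltW T0) H).
    have TM : T%:R = T.+2%:R - 2 :> R by rewrite -[T.+2]addn2 natrD; lra.
    have -> : T%:R * ((e / 64) ^+ 3 * (32 / 3) * fs ^+ 2) =
      (T.+2%:R - 2) * (e / 64) ^+ 3 * (32 / 3) * fs ^+ 2 by rewrite TM; ring.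
    apply: ler_wpM2r; first exact: sqr_ge0.
    move: Me e3; move: (T.+2%:R) ((e / 64) ^+ 3) => M q; rewrite mulrBl; lra.
  have : sqdist (y x) c <= (2 * fs) ^+ 2.
    by rewrite -sqr_edist lerXn2r ?nnegrE ?edist_ge0 //; lra.
  rewrite exprMn; lra.
have half : m / 2 <= \sum_(x in O) (edist (y x) c <= 2 * fs)%R%:R.
  (* If fs = 0 Markov's inequality has threshold 0, but then every point is at c. *)
  have [fz|fn] := eqVneq fs 0.
    apply: (@le_trans _ _ m); first by have := m_gt0; lra.
    have -> : m = \sum_(i in O) 1 by rewrite sumr_const.
    apply: ler_sum => i iO; rewrite fz mulr0.
    move: fsE; rewrite fz mulr0 => /esym/eqP.
    rewrite psumr_eq0 => [/allP/(_ i (mem_index_enum i))|*].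
      by rewrite iO => /eqP ->; rewrite lexx.
    exact: edist_ge0.
  have fp : 0 < fs.
    by rewrite lt_neqAle eq_sym fn divr_ge0 // ltW.
  apply: le_trans (sum_le (fun i => edist_ge0 (y i) c) _); last first.
    by apply: mulr_gt0 => //; lra.
  have H (g : R) : g != 0 -> (2 * g)^-1 * (m * g) = m / 2 by move=> *; field.
  by rewrite -/S -fsE H //; lra.
apply: (@le_trans _ _ (B / 2)).
  rewrite /B 2!exprS -/T (_ : 4^-1 = 2^-1 * 2^-1 :> R); last by field.
  rewrite exprMn; have : (2^-1 : R) ^+ T * 2^-1 ^+ T <= 2^-1 ^+ T.
    by rewrite ger_pMl ?exprn_gt0 ?invr_gt0.
  lra.
rewrite [leRHS]mulrC ler_pdivlMr //.
apply: (@le_trans _ _ (B * (m / 2))); first by apply: eq_ler; field.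
apply: le_trans (ler_wpM2l B0 half) _.
rewrite mulr_sumr; apply: ler_sum => x _.
have [H|_] := leP (edist (y x) c) (2 * fs); first by rewrite mulr1 start.
rewrite mulr0; apply: mulr_ge0; first by rewrite invr_ge0 ltW.
by apply: sumr_ge0 => *; exact: win_ge0.
Qed.

End Medians.

(** * Sampling and covering *)

Section Reservoir.
Variable R : realType.

(* Reservoir sampling: the item of index [x] replaces the current one with
   probability [w x] over the total weight seen so far. *)
Definition reservoir_step (w : nat -> R) (x : nat) (a : R * nat) :
    seq (R * (R * nat)) :=
  dmix (clip (w x / (a.1 + w x))) (dret R (a.1 + w x, x))
    (dret R (a.1 + w x, a.2)).

(** Reservoir sampling with unit weights, started with the point already drawn as first item; pool
    entry q is item number [q + 2]. *)
Definition pool_step (n q u : nat) : seq (R * nat) :=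
  dmix (clip (1 / (q + 2)%:R)) (dret R (n + q)%N) (dret R u).

Lemma isdist_reservoir_step w x a : isdist (reservoir_step w x a).
Proof. by apply: isdist_mix; rewrite ?clip_itv //; exact: isdist_ret. Qed.

Lemma isdist_pool_step n q u : isdist (pool_step n q u).
Proof. by apply: isdist_mix; rewrite ?clip_itv //; exact: isdist_ret. Qed.

(** The weight S already seen and the item y held are general for the induction. It is only a lower
    bound: when the total weight is 0 the quotient is 0 by convention, while the expectation may be
    positive. *)
Lemma expect_reservoir w F j N S y :
  (forall x, 0 <= w x) -> (forall x, 0 <= F x) -> 0 <= S ->
  (S * F y + \sum_(j <= x < j + N) w x * F x) / (S + \sum_(j <= x < j + N) w x)
  <= expect (diter (reservoir_step w) j N (S, y)) (fun a => F a.2).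
Proof.
move=> w0 F0; elim: N j S y => [|N IH] j S y S0 /=.
  rewrite expect_ret addn0 !big_geq // !addr0 /=.
  have [->|Sn] := eqVneq S 0; first by rewrite mul0r mul0r.
  by rewrite mulrAC divff // mul1r.
rewrite expect_bind expect_mix !expect_ret /=.
have wS : 0 <= S + w j by rewrite addr_ge0.
have p01 : 0 <= w j / (S + w j) <= 1.
  rewrite divr_ge0 //=; have [->|Sn] := eqVneq (S + w j) 0.
    by rewrite invr0 mulr0.
  by rewrite ler_pdivrMr ?mul1r ?lerDr // lt_neqAle eq_sym Sn.
rewrite clip_id //; set p := w j / _ in p01 *.
have /andP[p0 p1] := p01; rewrite -subr_ge0 in p1.
apply: le_trans (lerD (ler_wpM2l p0 (IH j.+1 _ j wS))
  (ler_wpM2l p1 (IH j.+1 _ y wS))).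
have jN : (j < j + N.+1)%N by lia.
rewrite !addSnnS !(@big_ltn _ _ _ j) //.
rewrite addrA -[S + w j + _]addrA.
set A := \sum_(_ <= _ < _) (_ * _); set B := \sum_(_ <= _ < _) w _.
rewrite !mulrA -mulrDl ler_wpM2r ?invr_ge0 //.
  by rewrite addrA addr_ge0 // sumr_ge0.
have pS : p * (S + w j) = w j.
  rewrite /p; have [Z|Sn] := eqVneq (S + w j) 0; last by rewrite divfK.
  by rewrite Z mulr0; have := w0 j; move: S0 Z; lra.
have -> : p * ((S + w j) * F j + A) + (1 - p) * ((S + w j) * F y + A) =
  p * (S + w j) * F j + ((S + w j) - p * (S + w j)) * F y + A by ring.
rewrite pS; apply: eq_ler; ring.
Qed.

Lemma expect_pool n F q N u :
  expect (diter (pool_step n) q N u) F =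
  ((q + 1)%:R * F u + \sum_(q <= x < q + N) F (n + x)%N) / (q + N + 1)%:R.
Proof.
elim: N q u => [|N IH] q u /=.
  have q1 : (q + 1)%:R != 0 :> R by rewrite pnatr_eq0 addn1.
  by rewrite expect_ret addn0 big_geq // addr0; field.
rewrite expect_bind expect_mix !expect_ret clip_id; last first.
  rewrite divr_ge0 //= ler_pdivrMr ?mul1r ?ler1n ?ltr0n; lia.
rewrite !IH (addSnnS q 1) (addSnnS q N) (@big_ltn _ _ _ q); last lia.
have q2 : (q + 2)%:R != 0 :> R by rewrite pnatr_eq0 addn2.
have N2 : (q + N.+1 + 1)%:R != 0 :> R by rewrite pnatr_eq0 addn1.
have -> : (q + 1)%:R = (q + 2)%:R - 1 :> R by rewrite !natrD; lra.
move: q2 N2; move: (q + 2)%:R (q + N.+1 + 1)%:R => a b a0 b0.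
by field; rewrite a0 b0.
Qed.

End Reservoir.

(** * One trial: covering the clusters one by one *)

Section Trial.
Variables (R : realType) (n d k : nat) (X : 'I_n -> 'rV[R]_d).
Variables (g : R -> R) (gam : nat -> R -> R -> seq (R * (R * R))) (M : nat).
Local Notation vec := 'rV[R]_d.
Implicit Types (cs : nat -> vec) (st : (nat -> vec) * R).

Definition pool cs (q : nat) : vec := if q is q'.+1 then cs q' else 0.

(* Row [n] is the origin, a center which makes the pool nonempty from the start
   and is not part of the output. *)
Definition pts cs (u : nat) : vec :=
  if insub u is Some x then X x else pool cs (u - n).

Fixpoint min_sqdist cs (v : vec) (i : nat) : R :=
  if i is i'.+1 then Num.min (min_sqdist cs v i') (sqdist v (cs i'))
  else sqdist v 0.

Definition weight cs i (x : nat) : R := g (min_sqdist cs (pts cs x) i).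

Definition sample cs i : seq (R * vec) :=
  dbind (diter (reservoir_step (weight cs i)) 0 n (0, 0%N)) (fun a =>
    dbind (diter (pool_step R n) 0 i.+1 a.2) (fun u => dret R (pts cs u))).

Definition set_center cs (i : nat) (z : vec) : nat -> vec :=
  fun q => if q == i then z else cs q.

Definition cluster_step (i : nat) st : seq (R * ((nat -> vec) * R)) :=
  dbind (diter (inner_step gam (sample st.1 i)) 0 M (st.1 i, st.2)) (fun zs =>
    dret R (set_center st.1 i zs.1, zs.2)).

Definition trial st := diter cluster_step 0 k st.

Definition trials_step (l : nat)
    (b : ((nat -> vec) * R) * seq ('I_k -> vec)) :=
  dbind (trial b.1) (fun a => dret R (a, rcons b.2 (fun q => a.1 q))).

Hypothesis isdist_gam : forall t s r, isdist (gam t s r).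

Lemma isdist_sample cs i : isdist (sample cs i).
Proof.
apply: isdist_bind => [|a].
  by apply: isdist_iter => *; exact: isdist_reservoir_step.
apply: isdist_bind => [|u]; last exact: isdist_ret.
by apply: isdist_iter => *; exact: isdist_pool_step.
Qed.

Lemma isdist_cluster_step i st : isdist (cluster_step i st).
Proof.
apply: isdist_bind => *; last exact: isdist_ret.
by apply: isdist_iter => *; apply: isdist_inner_step => //; exact: isdist_sample.
Qed.

Lemma isdist_trial st : isdist (trial st).
Proof. by apply: isdist_iter; exact: isdist_cluster_step. Qed.

Lemma isdist_trials_step l b : isdist (trials_step l b).
Proof.
by apply: isdist_bind => *; [exact: isdist_trial|exact: isdist_ret].
Qed.

Lemma pts_X cs (x : 'I_n) : pts cs x = X x.
Proof. by rewrite /pts valK. Qed.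

Lemma pts_pool cs q : pts cs (n + q) = pool cs q.
Proof. by rewrite /pts insubF ?addKn //; lia. Qed.

Lemma min_sqdist_le cs v i q : (q <= i)%N -> min_sqdist cs v i <= sqdist v (pool cs q).
Proof.
elim: i => [|i IH]; first by rewrite leqn0 => /eqP ->.
rewrite leq_eqVlt => /predU1P[->|/IH H] /=; first by rewrite ge_min lexx orbT.
by rewrite ge_min H.
Qed.

Lemma min_sqdist_attained cs v i :
  exists2 q, (q <= i)%N & min_sqdist cs v i = sqdist v (pool cs q).
Proof.
elim: i => [|i [q qi E]] /=; first by exists 0%N.
case: (leP (min_sqdist cs v i) (sqdist v (cs i))) => H.
  by exists q => //; lia.
by exists i.+1.
Qed.

Hypothesis g_ge0 : forall r, 0 <= r -> 0 <= g r.
Hypothesis g_mono : forall r r', 0 <= r -> r <= r' -> g r <= g r'.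
Let rho (u v : vec) : R := g (sqdist u v).
Hypothesis rho_young : forall (a : R) u v w, 0 < a ->
  rho u w <= (1 + a) * rho u v + (1 + a^-1) * rho v w.

Let rho_ge0 u v : 0 <= rho u v. Proof. by apply: g_ge0; exact: sqdist_ge0. Qed.

Let rhoC u v : rho u v = rho v u. Proof. by rewrite /rho sqdistC. Qed.

Let rho2 u v w : rho u w <= 2 * rho u v + 2 * rho v w.
Proof. by have := rho_young u v w ltr01; rewrite invr1; lra. Qed.

Let weight_ge0 cs i x : 0 <= weight cs i x.
Proof.
rewrite /weight; have [q _ ->] := min_sqdist_attained cs (pts cs x) i.
exact: rho_ge0.
Qed.

Let weight_le cs i (x : 'I_n) q : (q <= i)%N ->
  weight cs i x <= rho (X x) (pool cs q).
Proof.
move=> qi; rewrite /weight pts_X; apply: g_mono; last exact: min_sqdist_le.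
by have [q' _ ->] := min_sqdist_attained cs (X x) i; exact: sqdist_ge0.
Qed.

(** Boolean predicates on ordinals let [sig2W] select the nearest pool element as a function of
    x. *)
Let weight_near cs i (x : 'I_n) :
  exists2 q : 'I_i.+1, true & weight cs i x == rho (X x) (pool cs q).
Proof.
rewrite /weight pts_X; have [q qi ->] := min_sqdist_attained cs (X x) i.
by exists (Ordinal (qi : (q < i.+1)%N)).
Qed.

Let near cs i x : vec := pool cs (s2val (sig2W (weight_near cs i x))).

Let near_pool cs i x : exists2 q, (q < i.+1)%N & near cs i x = pool cs q.
Proof. by exists (s2val (sig2W (weight_near cs i x))). Qed.

Let rho_near cs i x : rho (X x) (near cs i x) = weight cs i x.
Proof.
by rewrite /near; case: (sig2W _) => q _ /= /eqP.
Qed.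

Let total cs i := \sum_(x < n) weight cs i x.

Lemma expect_sample cs i F : (forall v, 0 <= F v) ->
  (i.+2)%:R^-1 * ((\sum_(x < n) weight cs i x * F (X x)) / total cs i +
     \sum_(q < i.+1) F (pool cs q)) <= expect (sample cs i) F.
Proof.
move=> F0; rewrite expect_bind.
rewrite (@eq_expect _ _ _ _ (fun a => (i.+2)%:R^-1 * (F (pts cs a.2) +
    \sum_(q < i.+1) F (pool cs q)))); last first.
  move=> a; rewrite expect_bind.
  rewrite (@eq_expect _ _ _ _ (fun u => F (pts cs u))); last first.
    by move=> u; rewrite expect_ret.
  rewrite (expect_pool n (fun u => F (pts cs u))) !add0n mul1r addn1 mulrC.
  by rewrite big_mkord; under eq_bigr do rewrite pts_pool.
rewrite expectZ ler_wpM2l ?invr_ge0 // expectD expect_cst; last first.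
  by apply: isdist_iter => *; exact: isdist_reservoir_step.
rewrite lerD2r; have H := @expect_reservoir _ (weight cs i)
  (fun u => F (pts cs u)) 0 n 0 0%N (weight_ge0 cs i) (fun=> F0 _) (lexx 0).
apply: le_trans H; rewrite mul0r !add0r add0n !big_mkord.
by under [in leRHS]eq_bigr do rewrite pts_X.
Qed.

Section OneCluster.
Variables (O : {set 'I_n}) (cs : nat -> vec) (i : nat) (al : R).
Hypotheses (O0 : (0 < #|O|)%N) (al01 : 0 <= al <= 1).

Definition moved (x : 'I_n) : vec :=
  if weight cs i x <= al * total cs i / #|O|%:R then near cs i x else X x.

(** A kept point is paid for by the weighted draw. A replaced one takes a share [1 / #|O|] of the
    pool term, which suffices even if the whole cluster goes to one pool element. *)
Lemma sample_dominates :
  dominates (al / i.+2%:R) (sample cs i) (uniform O moved).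
Proof.
move=> F F0; apply: le_trans (expect_sample _ _ F0).
rewrite [al / _]mulrC -mulrA ler_wpM2l ?invr_ge0 //.
have m0 : 0 < #|O|%:R :> R by rewrite ltr0n.
have /andP[al0 al1] := al01.
set B := \sum_(_ < i.+1) _; set W := total cs i.
have B0 : 0 <= B by apply: sumr_ge0 => q _; exact: F0.
have W0 : 0 <= W by apply: sumr_ge0 => x _; exact: weight_ge0.
have wF0 (x : 'I_n) : 0 <= weight cs i x * F (X x) by rewrite mulr_ge0.
apply: (@le_trans _ _ (\sum_(x in O)
    (weight cs i x * F (X x) / W + #|O|%:R^-1 * B))); last first.
  rewrite big_split /= sumr_const -mulr_suml lerD //.
    rewrite ler_wpM2r ?invr_ge0 //.
    by rewrite [leRHS](bigID (mem O)) /= lerDl sumr_ge0 // => x _; exact: wF0.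
  by rewrite -[_ *+ _]mulr_natl mulrA divff ?mul1r // gt_eqF.
rewrite expect_uniform mulrA mulr_sumr.
apply: ler_sum => x _; rewrite /moved.
case: (leP (weight cs i x) _) => H.
  apply: (@le_trans _ _ (#|O|%:R^-1 * B)); last first.
    by rewrite lerDr mulr_ge0 ?invr_ge0.
  rewrite [al / _]mulrC -mulrA ler_wpM2l ?invr_ge0 //.
  have [q qi ->] := near_pool cs i x.
  apply: (@le_trans _ _ (F (pool cs q))); first by rewrite ler_piMl.
  by rewrite /B (bigD1 (Ordinal qi)) //= lerDl sumr_ge0 // => *; exact: F0.
apply: (@le_trans _ _ (weight cs i x * F (X x) / W)); last first.
  by rewrite lerDl mulr_ge0 ?invr_ge0.
(* If the total weight were 0, so would be the weight of x, and x would not be above the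
   threshold. *)
have Wp : 0 < W.
  rewrite lt_neqAle W0 andbT eq_sym; apply/eqP => Wz.
  have : weight cs i x <= W.
    by rewrite /W /total (bigD1 x) //= lerDl sumr_ge0 // => *; exact: weight_ge0.
  rewrite Wz leNgt => /negP; apply; apply: le_lt_trans H.
  by rewrite divr_ge0 ?(ltW m0) // mulr_ge0.
rewrite [leRHS]mulrAC ler_wpM2r // ler_pdivlMr //.
apply: ltW; rewrite mulrAC; exact: H.
Qed.

End OneCluster.

Variables (O : 'I_k -> {set 'I_n}) (ctr : 'I_k -> vec) (e : R).
Hypotheses (Ocl : clustering O) (e01 : 0 < e < 1) (k0 : (0 < k)%N).

Let cost j (c : vec) := \sum_(x in O j) rho (X x) c.
Let opt := \sum_j cost j (ctr j).

(** Summed over the k clusters, each of the two excess terms amounts to [e / 2 * opt]. *)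
Definition approx (j : 'I_k) (c : vec) : bool :=
  cost j c <= (1 + e / 2) * cost j (ctr j) + e / (2 * k%:R) * opt.

(** The order tau in which the centers serve distinct clusters is unknown to the program and differs
    from run to run. *)
Definition covers (i : nat) cs : Prop := exists tau : seq 'I_k,
  [/\ uniq tau, size tau = i &
      forall q (j : 'I_k), (q < i)%N -> nth j tau q = j -> approx j (cs q)].

Hypothesis inner : forall (A : {set 'I_n}) (y : 'I_n -> vec) (c : vec) zs,
  (0 < #|A|)%N ->
  4^-1 ^+ M <= expect (diter (inner_step gam (uniform A y)) 0 M zs)
    (fun zs' => (\sum_(x in A) rho (y x) zs'.1 <=
       (1 + e / 8) * \sum_(x in A) rho (y x) c)%R%:R).

Let cost_ge0 j c : 0 <= cost j c.
Proof. by apply: sumr_ge0 => x _; exact: rho_ge0. Qed.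

Let opt_ge0 : 0 <= opt.
Proof. by apply: sumr_ge0 => j _; exact: cost_ge0. Qed.

Let kR : 0 < k%:R :> R. Proof. by rewrite ltr0n. Qed.

Lemma sum_clustering (F : 'I_n -> R) :
  \sum_x F x = \sum_j \sum_(x in O j) F x.
Proof.
have [dis cov] := Ocl; rewrite -partition_disjoint_bigcup // cov.
by apply: eq_bigl => x; rewrite inE.
Qed.

(** Chosen so that [16 * al * k = e ^+ 2 / (108 * k)], the relative cost of replacing the points;
    multiplied by [3 * 18 / e] in [approx_moved], this is exactly the slack [e / (2 * k)]. *)
Let al : R := (e / (12 * k%:R)) ^+ 2 / 12.

Let phi cs i j := \sum_(x in O j) weight cs i x.

Let al_ge0 : 0 <= al.
Proof. by rewrite divr_ge0 ?sqr_ge0. Qed.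

Let al_k : al * k%:R = e ^+ 2 / (16 * (108 * k%:R)).
Proof. by rewrite /al; field; rewrite gt_eqF. Qed.

Let al_k_le : al * k%:R <= 12^-1.
Proof.
have /andP[e0 e1] := e01; have k1 : 1 <= k%:R :> R by rewrite ler1n.
have -> : al * k%:R = e * (e / k%:R / 144) / 12.
  by rewrite /al; field; rewrite gt_eqF.
rewrite ler_piMl ?invr_ge0 // mulr_ile1 ?divr_ge0 ?(ltW e0) ?(ltW e1) ?(ltW kR) //.
have : e / k%:R <= 1 by rewrite ler_pdivrMr // mul1r (le_trans (ltW e1)).
lra.
Qed.

Let al_le1 : al <= 1.
Proof.
have k1 : 1 <= k%:R :> R by rewrite ler1n.
have : al * 1 <= al * k%:R by rewrite ler_wpM2l.
have := al_k_le; lra.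
Qed.

Hypothesis g0 : g 0 = 0.

(* With [m] the size of the cluster and [p] the pool element nearest to a moved
   [x], [m * rho x p <= al * total].  As [phi] is at most the cost of [p] for the
   whole cluster, the triangle inequality through [ctr j] bounds [total] by [opt],
   [m * rho x (ctr j)] and [m * rho x p], and the last term is absorbed since
   [al * k] is small. *)
Lemma cost_moved cs i j : (0 < #|O j|)%N ->
  total cs i <= 2 * opt + k%:R * phi cs i j ->
  \sum_(x in O j) rho (X x) (moved (O j) cs i al x) <=
  e ^+ 2 / (108 * k%:R) * opt.
Proof.
move=> O0 HW; set m : R := #|O j|%:R.
have m0 : 0 < m by rewrite ltr0n.
have k1 : 1 <= k%:R :> R by rewrite ler1n.
have Cle : cost j (ctr j) <= opt.
  by rewrite /opt (bigD1 j) //= lerDl sumr_ge0.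
have C0 := cost_ge0 j (ctr j).
have phi_le q : (q < i.+1)%N ->
    phi cs i j <= 2 * cost j (ctr j) + 2 * (m * rho (ctr j) (pool cs q)).
  move=> qi.
  have -> : 2 * (m * rho (ctr j) (pool cs q)) =
      \sum_(x in O j) 2 * rho (ctr j) (pool cs q).
    by rewrite sumr_const -[RHS]mulr_natl mulrCA.
  rewrite /cost mulr_sumr -big_split /=; apply: ler_sum => x _.
  by apply: le_trans (@weight_le cs i x q qi) _; exact: rho2.
set A := al * k%:R; have A0 : 0 <= A by rewrite mulr_ge0.
have Ale : A <= 12^-1 := al_k_le.
have each x : x \in O j -> rho (X x) (moved (O j) cs i al x) <=
    8 * A * (opt / m + rho (X x) (ctr j)).
  move=> xO; rewrite /moved -/m; case: (leP (weight cs i x) _) => H; last first.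
    have -> : rho (X x) (X x) = 0 by rewrite /rho sqdistxx g0.
    apply: mulr_ge0; first by rewrite mulr_ge0.
    by apply: addr_ge0; [rewrite divr_ge0 // ltW|exact: rho_ge0].
  rewrite rho_near; have [q qi nE] := near_pool cs i x.
  have vE := rho_near cs i x; rewrite nE in vE.
  set v := weight cs i x in vE H *; set r := rho (X x) (ctr j).
  have v0 : 0 <= v by exact: weight_ge0.
  have cp : rho (ctr j) (pool cs q) <= 2 * r + 2 * v.
    by rewrite /r (rhoC (X x)) -vE; exact: rho2.
  suff : v * m <= 8 * A * (opt / m + r) * m by rewrite ler_pM2r.
  have : v * m <= al * total cs i by rewrite -ler_pdivlMr.
  have : al * total cs i <= al * (2 * opt + k%:R * (2 * cost j (ctr j) +
      2 * (m * (2 * r + 2 * v)))).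
    apply: ler_wpM2l => //; apply: le_trans HW _; rewrite lerD2l.
    apply: ler_wpM2l; first exact: ltW kR.
    apply: le_trans (phi_le q qi) _; rewrite lerD2l; apply: ler_wpM2l => //.
    by apply: ler_wpM2l => //; exact: ltW m0.
  have -> : al * (2 * opt + k%:R * (2 * cost j (ctr j) +
      2 * (m * (2 * r + 2 * v)))) = 2 * (al * opt) + 2 * (A * cost j (ctr j))
      + 4 * (A * (m * r)) + 4 * (A * (m * v)) by rewrite /A; ring.
  have : al * opt <= A * opt by rewrite ler_wpM2r // /A ler_peMr.
  have : A * cost j (ctr j) <= A * opt by rewrite ler_wpM2l.
  have : A * (m * v) <= 12^-1 * (m * v).
    by rewrite ler_wpM2r // mulr_ge0 // ltW.
  have -> : 8 * A * (opt / m + r) * m = 8 * (A * opt) + 8 * (A * (m * r)).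
    by field; rewrite gt_eqF.
  have : 0 <= A * (m * r).
    by rewrite mulr_ge0 // mulr_ge0 ?(ltW m0) //; exact: rho_ge0.
  have : 0 <= A * opt by rewrite mulr_ge0.
  rewrite (mulrC v m); have : 0 <= m * v by rewrite mulr_ge0 // ltW.
  move: (m * v) (A * opt) (A * (m * r)) (A * (m * v)) (al * opt)
    (A * cost j _) (al * total cs i) => *; lra.
apply: le_trans (ler_sum _ each) _.
rewrite -mulr_sumr big_split /= sumr_const -[_ *+ #|_|]mulr_natl -/m.
rewrite [m * _]mulrC divfK ?gt_eqF // -/(cost j (ctr j)).
have -> : e ^+ 2 / (108 * k%:R) * opt = 8 * A * (opt + opt).
  by rewrite /A al_k; field; rewrite gt_eqF.
by apply: ler_wpM2l; [rewrite mulr_ge0|rewrite lerD2l].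
Qed.

(** Young's inequality with parameter [e / 16] is used twice: towards the modified cluster at
    [ctr j], and back at z. Together with the factor [1 + e / 8] this stays below [1 + e / 2], since
    e < 1. *)
Lemma approx_moved cs i j z : (0 < #|O j|)%N ->
  total cs i <= 2 * opt + k%:R * phi cs i j ->
  \sum_(x in O j) rho (moved (O j) cs i al x) z <=
    (1 + e / 8) * \sum_(x in O j) rho (moved (O j) cs i al x) (ctr j) ->
  approx j z.
Proof.
move=> O0 HW; have := cost_moved O0 HW.
set y := moved (O j) cs i al; set D := \sum_(_ in _) rho _ (y _).
set P := \sum_(_ in _) rho _ z; set Q := \sum_(_ in _) rho _ _ => DP PQ.
have /andP[e0 e1] := e01; set C := cost j (ctr j).
have a0 : 0 < e / 16 by lra.
have D0 : 0 <= D by apply: sumr_ge0 => x _; exact: rho_ge0.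
have C0 : 0 <= C := cost_ge0 _ _.
have QD : Q <= (1 + e / 16) * C + (1 + (e / 16)^-1) * D.
  rewrite /Q /C /cost /D !mulr_sumr -big_split /=; apply: ler_sum => x _.
  by rewrite rhoC (rhoC (X x) (ctr j)); exact: rho_young.
have CD : cost j z <= (1 + e / 16) * P + (1 + (e / 16)^-1) * D.
  rewrite /P /cost /D !mulr_sumr -big_split /=; apply: ler_sum => x _.
  rewrite (rhoC (X x) z) (rhoC _ z) (rhoC (X x)); exact: rho_young.
have inv : (1 + (e / 16)^-1) * D <= 18 / e * D.
  rewrite ler_wpM2r // invf_div.
  have : 1 <= e^-1 by rewrite invf_ge1 // ltW.
  by lra.
set B := (_ + _^-1) * D in QD CD inv.
have B0 : 0 <= B.
  by rewrite mulr_ge0 // addr_ge0 // invr_ge0 ltW.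
have BE : 3 * B <= e / (2 * k%:R) * opt.
  have -> : e / (2 * k%:R) * opt =
      3 * (18 / e * (e ^+ 2 / (108 * k%:R) * opt)).
    by field; rewrite gt_eqF //= gt_eqF.
  rewrite ler_wpM2l // (le_trans inv) // ler_wpM2l //.
  by rewrite divr_ge0 // ltW.
rewrite /approx -/C (le_trans CD) //.
have e2 : e * e <= e by rewrite ler_piMr ?ltW.
have e3 : e * e * e <= e by rewrite (le_trans _ e2) // ler_piMr ?mulr_ge0 ?ltW.
have H1 : (1 + e / 16) * P <= (1 + e / 16) * ((1 + e / 8) * Q).
  by rewrite ler_wpM2l //; lra.
have H2 : (1 + e / 16) * ((1 + e / 8) * Q) <=
    (1 + e / 16) * ((1 + e / 8) * ((1 + e / 16) * C + B)).
  by rewrite ler_wpM2l ?ler_wpM2l //; lra.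
have H3 : (1 + e / 16) * (1 + e / 8) * B <= 2 * B.
  by rewrite ler_wpM2r //; move: (e * e) e2 => *; nra.
have H4 : (1 + e / 16) * (1 + e / 8) * (1 + e / 16) * C <= (1 + e / 2) * C.
  rewrite ler_wpM2r //.
  have -> : (1 + e / 16) * (1 + e / 8) * (1 + e / 16) =
    1 + e / 4 + e * e * (5 / 256) + e * e * e / 2048 by field.
  move: (e * e) (e * e * e) e2 e3 => *; lra.
have H5 : (1 + e / 16) * ((1 + e / 8) * ((1 + e / 16) * C + B)) =
  (1 + e / 16) * (1 + e / 8) * (1 + e / 16) * C +
  (1 + e / 16) * (1 + e / 8) * B by ring.
move: H1 H2; rewrite H5; lra.
Qed.

(** Covered clusters weigh at most their costs for their own centers, in all [(1 + e) * opt]; there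
    are at most k others, none heavier than the chosen j. *)
Lemma exists_next cs i : covers i cs -> (i < k)%N ->
  exists j, total cs i <= 2 * opt + k%:R * phi cs i j /\
    forall z, approx j z -> covers i.+1 (set_center cs i z).
Proof.
move=> [tau [utau stau Htau]] ik; have /andP[e0 e1] := e01.
have [j0 j0P] : exists j, j \notin tau.
  apply/existsP; rewrite -negb_forall; apply/negP => /forallP H.
  have : (#|'I_k| <= size tau)%N.
    by rewrite cardE uniq_leq_size ?enum_uniq // => j _; exact: H.
  by rewrite card_ord stau leqNgt ik.
have [j jP jmax] := @arg_maxP _ R _ j0 (fun j => j \notin tau) (phi cs i) j0P.
exists j; split; last first.
  move=> z zP; exists (rcons tau j); split.
  - by rewrite rcons_uniq jP.
  - by rewrite size_rcons stau.
  move=> q j'; rewrite nth_rcons stau /set_center.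
  rewrite ltnS => qi1; case: (ltngtP q i) qi1 => // [qi _ jE|_ _ <- //].
  exact: Htau jE.
rewrite /total sum_clustering (bigID (fun j => j \in tau)) /=; apply: lerD.
  have H j' : j' \in tau -> phi cs i j' <=
      (1 + e / 2) * cost j' (ctr j') + e / (2 * k%:R) * opt.
    move=> j't; set q := index j' tau.
    have qi : (q < i)%N by rewrite -stau index_mem.
    apply: le_trans (Htau q j' qi (nth_index _ j't)).
    (* Center q is entry [q.+1] of the pool, whose entry 0 is the origin. *)
    by apply: ler_sum => x _; exact: (@weight_le cs i x q.+1).
  apply: le_trans (ler_sum _ H) _.
  apply: (@le_trans _ _ (\sum_j'
      ((1 + e / 2) * cost j' (ctr j') + e / (2 * k%:R) * opt))).
    rewrite [leRHS](bigID (fun j => j \in tau)) /= lerDl sumr_ge0 // => j' _.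
    rewrite addr_ge0 // mulr_ge0 ?divr_ge0 ?mulr_ge0 ?(ltW kR) ?(ltW e0) //.
    by lra.
  rewrite big_split /= -mulr_sumr -/opt sumr_const card_ord -[_ *+ k]mulr_natl.
  have -> : k%:R * (e / (2 * k%:R) * opt) = e / 2 * opt.
    by field; rewrite gt_eqF.
  by rewrite -mulrDl ler_wpM2r //; lra.
apply: (@le_trans _ _ (\sum_(j' | j' \notin tau) phi cs i j)).
  by apply: ler_sum => j' /jmax.
rewrite sumr_const -[leLHS]mulr_natl ler_wpM2r //.
  by apply: sumr_ge0 => x _; exact: weight_ge0.
by rewrite ler_nat -[leqRHS]card_ord max_card.
Qed.

(** Per sample, [al / (k + 1)] comes from [sample_dominates], as [i + 2 <= k + 1], and 1/4 from
    [inner]. *)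
Let beta : R := (al / (k + 1)%:R / 4) ^+ M.

Let beta_ge0 : 0 <= beta.
Proof. by apply: exprn_ge0; rewrite divr_ge0 // divr_ge0. Qed.

Lemma cluster_success cs i s : covers i cs -> (i < k)%N ->
  beta <= expect (cluster_step i (cs, s)) (fun st => `[< covers i.+1 st.1 >]%:R).
Proof.
move=> cov ik; have [j [HW next]] := exists_next cov ik.
have alk : al / (k + 1)%:R <= 1.
  by rewrite ler_pdivrMr ?ltr0n ?addn1 // mul1r (le_trans al_le1) // ler1n.
have ds t zs : isdist (inner_step gam (sample cs i) t zs).
  by apply: isdist_inner_step => //; exact: isdist_sample.
rewrite expect_bind.
rewrite (@eq_expect _ _ _ _ (fun zs =>
    `[< covers i.+1 (set_center cs i zs.1) >]%:R)); last first.
  by move=> zs; rewrite expect_ret.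
(* There is nothing to sample in an empty cluster, but any point approximates it. *)
have [Oz|O0] := posnP #|O j|.
  rewrite (@eq_expect _ _ _ _ (fun=> 1)).
    rewrite expect_cst; last exact: isdist_iter.
    have a0 : 0 <= al / (k + 1)%:R by rewrite divr_ge0.
    by apply: exprn_ile1; move: a0 alk; lra.
  move=> zs; rewrite (asboolT (next _ _)) // /approx /cost.
  have Ozero : O j = finset.set0 by apply/eqP; rewrite -cards_eq0 Oz.
  rewrite Ozero !big_set0 mulr0 add0r; apply: mulr_ge0 => //.
  by apply: divr_ge0; [have /andP[/ltW] := e01|rewrite mulr_ge0].
have du t zs : isdist (inner_step gam
    (uniform (O j) (moved (O j) cs i al)) t zs).
  by apply: isdist_inner_step => //; exact: isdist_uniform.
have dom t zs : dominates (al / (k + 1)%:R)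
    (inner_step gam (sample cs i) t zs)
    (inner_step gam (uniform (O j) (moved (O j) cs i al)) t zs).
  move=> F F0; rewrite !expect_inner_step.
  have al01 : 0 <= al <= 1 by rewrite al_ge0 al_le1.
  apply: le_trans (sample_dominates cs i O0 al01 _); last first.
    by move=> v; apply: (isdist_gam _ _ _).1.
  apply: ler_wpM2r.
    by apply: (isdist_uniform _ O0).1 => v; apply: (isdist_gam _ _ _).1.
  by rewrite ler_wpM2l // lef_pV2 ?posrE ?ltr0n ?addn1 // ler_nat ltnS.
apply: le_trans (@dominates_iter _ _ _ _ _ _ ds du dom M 0 (cs i, s) _ _).
- rewrite /beta exprMn; apply: ler_wpM2l.
    by apply: exprn_ge0; rewrite divr_ge0.
  apply: le_trans (inner (moved (O j) cs i al) (ctr j) (cs i, s) O0) _.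
  apply: le_expect; first exact: isdist_iter.
  move=> zs; case: (boolP (\sum_(x in O j) _ <= _)) => H; last by rewrite ler0n.
  by rewrite (asboolT (next _ _)) //; exact: approx_moved HW H.
- by rewrite divr_ge0.
- by move=> zs; rewrite ler0n.
Qed.

Lemma clusters_success r i cs s : covers i cs -> (i + r <= k)%N ->
  beta ^+ r <= expect (diter cluster_step i r (cs, s))
    (fun st => `[< covers (i + r) st.1 >]%:R).
Proof.
elim: r i cs s => [|r IH] i cs s cov ik /=.
  by rewrite expect_ret addn0 asboolT.
rewrite expect_bind exprSr.
apply: le_trans (le_expect (F := fun st =>
    beta ^+ r * `[< covers i.+1 st.1 >]%:R) _ _); last 2 first.
- exact: isdist_cluster_step.
- move=> [cs' s'] /=; case: asboolP => cov'.
    by rewrite mulr1 -addSnnS IH // addSnnS.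
  rewrite mulr0; apply: (isdist_iter _ _ _ isdist_cluster_step).1 => st.
  exact: ler0n.
rewrite expectZ; apply: ler_wpM2l; first exact: exprn_ge0.
by apply: cluster_success => //; lia.
Qed.

(** The bound holds from every state, so the centers and the scale left by the previous trial may
    stay in memory. *)
Lemma trial_success st :
  beta ^+ k <= expect (trial st) (fun st' => `[< covers k st'.1 >]%:R).
Proof.
by case: st => cs s; apply: (@clusters_success k 0); first by exists [::].
Qed.

Lemma covers_cost cs : covers k cs ->
  min_cost rho X (fun q : 'I_k => cs q) O <= (1 + e) * opt.
Proof.
move=> [tau [utau stau Htau]].
have tauP (q : 'I_k) : (q < size tau)%N by rewrite stau.
pose f (q : 'I_k) := nth q tau q.
have f_inj : injective f.
  move=> q q' /eqP; rewrite /f (set_nth_default q') // nth_uniq //.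
  by move/eqP/val_inj.
(* [min_cost] sends clusters to centers, whereas tau sends centers to clusters. *)
pose s := ((perm f_inj)^-1)%g.
have fs j : f (s j) = j by rewrite -(permE f_inj) permKV.
apply: (bigmin_inf s) => //.
apply: (@le_trans _ _ (\sum_j
    ((1 + e / 2) * cost j (ctr j) + e / (2 * k%:R) * opt))).
  apply: ler_sum => j _; apply: (Htau (s j) j) => //.
  by rewrite -[RHS]fs /f; apply: set_nth_default.
rewrite big_split /= -mulr_sumr -/opt sumr_const card_ord -[_ *+ k]mulr_natl.
have -> : k%:R * (e / (2 * k%:R) * opt) = e / 2 * opt.
  by field; rewrite gt_eqF.
by apply: eq_ler; field.
Qed.

(** Each trial succeeds with probability at least [beta ^+ k] given the past. The term with [has]
    records whether the list built so far is already good. *)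
Lemma trials_success r l b :
  1 - (1 - beta ^+ k) ^+ r *
    (1 - (has (fun C => min_cost rho X C O <= (1 + e) * opt) b.2)%:R) <=
  expect (diter trials_step l r b) (fun b' =>
    (has (fun C => min_cost rho X C O <= (1 + e) * opt) b'.2)%:R).
Proof.
set good := (fun C => _ <= _); set p := beta ^+ k.
elim: r l b => [|r IH] l b /=.
  by rewrite expect_ret expr0 mul1r opprB addrC subrK.
rewrite expect_bind; apply: le_trans (le_expect (isdist_trials_step l b)
  (fun b' => IH l.+1 b')).
have p1 : p <= 1.
  apply: le_trans (trial_success b.1) _.
  rewrite -[leRHS](expect_cst 1 (isdist_trial b.1)).
  apply: le_expect; first exact: isdist_trial.
  by move=> st; rewrite (ler_nat _ _ 1) leq_b1.
have q0 : 0 <= (1 - p) ^+ r by rewrite exprn_ge0 // subr_ge0.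
rewrite expect_bind.
rewrite (@eq_expect _ _ _ _ (fun st => 1 - (1 - p) ^+ r *
  (1 - (has good (rcons b.2 (fun q => st.1 q)))%:R))); last first.
  by move=> st; rewrite expect_ret.
apply: le_trans (le_expect (F := fun st => (1 - (1 - p) ^+ r *
  (1 - (has good b.2)%:R)) + ((1 - p) ^+ r * (1 - (has good b.2)%:R)) *
    `[< covers k st.1 >]%:R) (isdist_trial _) _).
  rewrite expectD expectZ expect_cst; last exact: isdist_trial.
  have H : 0 <= (1 - p) ^+ r * (1 - (has good b.2)%:R).
    by rewrite mulr_ge0 // subr_ge0 (ler_nat _ _ 1) leq_b1.
  have := ler_wpM2l H (trial_success b.1); rewrite -/p exprS.
  by move: (expect _ _) => E; lra.
move=> st; rewrite has_rcons; case: (has good b.2).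
  by rewrite orbT subrr mulr0 mul0r addr0.
rewrite orbF subr0 mulr1; case: asboolP => cov.
  by rewrite /good covers_cost // subrr mulr0 mulr1 subrK subr0.
rewrite mulr0 addr0 lerD2l lerN2 ler_piMr // gerBl.
Qed.

End Trial.

(** * The program and its simulation *)

(* Registers: the cells of natural array 2 and of real array 3.  The points, the
   origin and the centers of the current trial are the rows of real array 0; the
   natural registers [rxp], [rqp], [rzp], [rop], [ryp] and [rorg] hold addresses of
   rows. *)
Local Notation rM := 0%N.
Local Notation rl := 1%N.
Local Notation ri := 2%N.
Local Notation rt := 3%N.
Local Notation rx := 4%N.
Local Notation rxp := 5%N.
Local Notation rq := 6%N.
Local Notation rqp := 7%N.
Local Notation rzp := 8%N.
Local Notation rop := 9%N.
Local Notation ryp := 10%N.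
Local Notation rj := 11%N.
Local Notation rb := 12%N.
Local Notation rorg := 13%N.
Local Notation r_e := 0%N.
Local Notation r_thr := 1%N.
Local Notation r_om := 2%N.
Local Notation r_p := 3%N.
Local Notation r_min := 4%N.
Local Notation r_sum := 5%N.
Local Notation r_sq := 6%N.
Local Notation r_gam := 7%N.
Local Notation r_s := 8%N.

Definition nreg (c : nat) : nexp := NGet 2 (NConst c).
Definition nset (c : nat) (e : nexp) : cmd := NSet 2 (NConst c) e.
Definition rreg (c : nat) : rexp := RGet 3 (NConst c).
Definition rset (c : nat) (e : rexp) : cmd := RSet 3 (NConst c) e.
Definition rnat (c : nat) : rexp := ROfNat (NConst c).
Definition n_in : nexp := NGet 0 (NConst 0).
Definition d_in : nexp := NGet 0 (NConst 1).
Definition k_in : nexp := NGet 0 (NConst 2).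
Definition nlt (e1 e2 : nexp) : bexp := BNot (BNle e2 e1).
Definition inc (c : nat) : cmd := nset c (NAdd (nreg c) (NConst 1)).
Definition next_row (c : nat) : cmd := nset c (NAdd (nreg c) d_in).

Definition coord (a : nat) : rexp := RGet 0 (NAdd (nreg a) (nreg rj)).

Definition sqdist_cmd (a b : nat) : cmd :=
  Seq (rset r_sq (rnat 0)) (Seq (nset rj (NConst 0))
    (While (nlt (nreg rj) d_in)
      (Seq (rset r_sq (RAdd (rreg r_sq)
         (RMul (RSub (coord a) (coord b)) (RSub (coord a) (coord b)))))
       (inc rj)))).

(** Each round also copies the current point to the output row, which thus holds the final center
    after the last round. *)
Definition move_cmd : cmd :=
  Seq (nset rj (NConst 0)) (While (nlt (nreg rj) d_in)
    (Seq (RSet 0 (NAdd (nreg rzp) (nreg rj)) (RAdd (coord rzp)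
       (RMul (rreg r_gam) (RSub (coord ryp) (coord rzp)))))
     (Seq (RSet 2 (NAdd (nreg rop) (nreg rj)) (coord rzp)) (inc rj)))).

Definition min_sqdist_cmd : cmd :=
  Seq (nset rqp (nreg rorg)) (Seq (sqdist_cmd rxp rqp)
  (Seq (rset r_min (rreg r_sq)) (Seq (nset rq (NConst 0))
    (While (nlt (nreg rq) (nreg ri))
      (Seq (next_row rqp) (Seq (sqdist_cmd rxp rqp)
        (Seq (If (BRle (rreg r_sq) (rreg r_min))
                (rset r_min (rreg r_sq)) Skip) (inc rq)))))))).

Section Frames.
Variables (R : realType).
Implicit Types s : state R.

(** Frame condition on the natural memory and the real registers; the rows of points and centers are
    framed apart, by [same_rows], because [move_cmd] modifies them. *)
Definition same_off (ln lr : seq nat) s s' : Prop :=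
  (forall a c, ~~ ((a == 2%N) && (c \in ln)) -> nmem s' a c = nmem s a c) /\
  (forall c, c \notin lr -> rmem s' 3 c = rmem s 3 c).

Definition same_rows s s' : Prop :=
  rmem s' 0 = rmem s 0 /\ rmem s' 2 = rmem s 2.

Lemma same_off_refl ln lr s : same_off ln lr s s.
Proof. by []. Qed.

Lemma same_off_trans ln lr s1 s2 s3 :
  same_off ln lr s1 s2 -> same_off ln lr s2 s3 -> same_off ln lr s1 s3.
Proof.
move=> [N1 R1] [N2 R2]; split=> [a c H|c H]; first by rewrite N2 ?N1.
by rewrite R2 ?R1.
Qed.

Lemma same_off_sub ln lr ln' lr' s s' :
  same_off ln lr s s' -> {subset ln <= ln'} -> {subset lr <= lr'} ->
  same_off ln' lr' s s'.
Proof.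
move=> [N1 R1] Hn Hr; split=> [a c H|c H].
  by apply: N1; apply: contra H => /andP[-> /Hn ->].
by apply: R1; apply: contra H => /Hr.
Qed.

Lemma same_off_nset ln lr s s' c v :
  same_off ln lr s s' -> c \in ln -> same_off ln lr s (set_nat s' 2 c v).
Proof.
move=> [N1 R1] Hc; split=> [a c' H|//]; rewrite /= /upd.
case: ifP => [/andP[/eqP E /eqP E']|_]; last exact: N1.
by move: H; rewrite E E' eqxx Hc.
Qed.

Lemma same_off_rset ln lr s s' c v :
  same_off ln lr s s' -> c \in lr -> same_off ln lr s (set_real s' 3 c v).
Proof.
move=> [N1 R1] Hc; split=> [//|c' H]; rewrite /= /upd /=.
case: eqP => [E|_]; last exact: R1.
by move: H; rewrite E Hc.
Qed.

End Frames.

Ltac solve_same :=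
  repeat (first [ apply: same_off_nset; last done
                | apply: same_off_rset; last done ]);
  try assumption; try exact: same_off_refl.

Section Deterministic.
Variables (R : realType) (n d k : nat).
Implicit Types s : state R.

Definition row_of s (a u : nat) : 'rV[R]_d :=
  \row_(j < d) rmem s a (u * d + j).

Lemma row_of_same s s' : same_rows s s' ->
  (forall u, row_of s' 0 u = row_of s 0 u) /\
  (forall u, row_of s' 2 u = row_of s 2 u).
Proof. by move=> [E0 E2]; split=> u; apply/rowP => j; rewrite !mxE ?E0 ?E2. Qed.

Lemma sim_sqdist a b u v s :
  nmem s 0 1 = d -> nmem s 2 a = (u * d)%N -> nmem s 2 b = (v * d)%N ->
  a != rj -> b != rj ->
  dsim (d * 4 + 5) (sqdist_cmd a b) s (fun s' =>
    [/\ same_off [:: rj] [:: r_sq] s s', same_rows s s' &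
        rmem s' 3 r_sq = sqdist (row_of s 0 u) (row_of s 0 v)]).
Proof.
move=> Hd Ha Hb aj bj.
pose Inv j s' := [/\ same_off [:: rj] [:: r_sq] s s', same_rows s s',
  nmem s' 2 rj = j & rmem s' 3 r_sq = \sum_(0 <= c < j)
    (rmem s 0 (u * d + c)%N - rmem s 0 (v * d + c)%N) ^+ 2].
eapply sim_time.
  eapply sim_rset; eapply sim_nset.
  eapply sim_weak; first eapply (@dsim_while _ _ _ Inv 3 d).
  - move=> j s' jd [F [E0 E2] Hj HS]; split.
      by rewrite /= Hj (F.1 0%N 1%N) // Hd -ltnNge.
    eapply sim_rset; eapply dsim_nset; rewrite /= /upd /=.
    split; [by solve_same|by []|by rewrite Hj addn1|].
    rewrite big_nat_recr //= HS (F.1 2%N a) ?inE // (F.1 2%N b) ?inE //.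
    by rewrite Hj Ha Hb E0 expr2.
  - by move=> s' [F _ Hj _]; rewrite /= Hj (F.1 0%N 1%N) // Hd leqnn.
  - by split; [solve_same| |rewrite /= /upd|rewrite /= /upd /= big_geq].
  - move=> _ s' [F E _ HS]; split=> //; rewrite HS big_mkord.
    by apply: eq_bigr => j _; rewrite !mxE.
by lia.
Qed.

Lemma sim_move z0 y0 w0 s :
  nmem s 0 1 = d -> nmem s 2 rzp = (z0 * d)%N -> nmem s 2 ryp = (y0 * d)%N ->
  nmem s 2 rop = (w0 * d)%N -> y0 != z0 ->
  let z' := row_of s 0 z0 + rmem s 3 r_gam *: (row_of s 0 y0 - row_of s 0 z0) in
  dsim (d * 6 + 4) move_cmd s (fun s' =>
    [/\ same_off [:: rj] [::] s s',
        forall u, row_of s' 0 u = if u == z0 then z' else row_of s 0 u &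
        forall u, row_of s' 2 u = if u == w0 then z' else row_of s 2 u]).
Proof.
move=> Hd Hz Hy Hw yz z'.
pose val c := rmem s 0 (z0 * d + c)%N + rmem s 3 r_gam *
  (rmem s 0 (y0 * d + c)%N - rmem s 0 (z0 * d + c)%N).
pose upto (r j c : nat) (f : nat -> R) :=
  if (r * d <= c < r * d + j)%N then val (c - r * d)%N else f c.
pose Inv j s' := [/\ same_off [:: rj] [::] s s', nmem s' 2 rj = j,
  forall c, rmem s' 0 c = upto z0 j c (rmem s 0) &
  forall c, rmem s' 2 c = upto w0 j c (rmem s 2)].
have rowE s' a r : (forall c, rmem s' a c = upto r d c (rmem s a)) ->
    forall u, row_of s' a u = if u == r then z' else row_of s a u.
  move=> H u; apply/rowP => j; rewrite mxE H /upto.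
  have jd := ltn_ord j; case: eqP => [->|ur].
    by rewrite leq_addr ltn_add2l jd addKn !mxE.
  case: ifP => [/andP[h1 h2]|_]; last by rewrite mxE.
  exfalso; case: (ltngtP u r) ur => // ur _.
    have : (u.+1 * d <= r * d)%N by rewrite leq_mul2r ur orbT.
    by rewrite mulSn; lia.
  have : (r.+1 * d <= u * d)%N by rewrite leq_mul2r ur orbT.
  by rewrite mulSn; lia.
eapply sim_time.
  eapply sim_nset.
  eapply sim_weak; first eapply (@dsim_while _ _ _ Inv 5 d).
  - move=> j s' jd [F Hj H0 H2]; split.
      by rewrite /= Hj (F.1 0%N 1%N) // Hd -ltnNge.
    (* The coordinate of y about to be read is outside the part of row z0 already overwritten. *)
    have yout : (y0 * d + j < z0 * d)%N || (z0 * d + j < y0 * d + j)%N.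
      case: (ltngtP y0 z0) yz => // yz _.
        have : (y0.+1 * d <= z0 * d)%N by rewrite leq_mul2r yz orbT.
        by rewrite mulSn; lia.
      by rewrite ltn_add2r ltn_mul2r yz orbC (leq_ltn_trans _ jd).
    have vj : rmem s' 0 (z0 * d + j)%N + rmem s' 3 r_gam *
        (rmem s' 0 (y0 * d + j)%N - rmem s' 0 (z0 * d + j)%N) = val j.
      rewrite !H0 /upto ltnn andbF F.2 //.
      by case: ifP yout => [|_ _]; [lia|].
    eapply sim_rset; eapply sim_rset; eapply dsim_nset.
    rewrite /= (F.1 2%N rzp) // (F.1 2%N ryp) // (F.1 2%N rop) // Hj Hz Hy Hw vj.
    split.
    + split=> [a c H|c H]; last by rewrite /= /upd /= F.2.
      rewrite /= /upd; case: ifP => [/andP[/eqP E /eqP E']|_]; last exact: F.1.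
      by move: H; rewrite E E'.
    + by rewrite /= /upd /= addn1.
    + move=> c; rewrite /= /upd /=; case: eqP => [->|cj].
        by rewrite /upto leq_addr ltn_add2l ltnSn addKn.
      rewrite H0 /upto; congr (if _ then _ else _); lia.
    + move=> c; rewrite /= /upd /= eqxx; case: eqP => [->|cj].
        by rewrite /upto leq_addr ltn_add2l ltnSn addKn.
      rewrite H2 /upto; congr (if _ then _ else _); lia.
  - by move=> s' [F Hj _ _]; rewrite /= Hj (F.1 0%N 1%N) // Hd leqnn.
  - split; [by solve_same|by rewrite /= /upd| |];
      by move=> c; rewrite /upto; case: ifP => //; lia.
  - by move=> _ s' [F Hj H0 H2]; split=> //; exact: rowE.
by lia.
Qed.

Variable X : 'I_n -> 'rV[R]_d.

Lemma sim_min_sqdist cs x i s :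
  nmem s 0 1 = d -> nmem s 2 rxp = (x * d)%N -> nmem s 2 rorg = (n * d)%N ->
  nmem s 2 ri = i -> (x <= n + i)%N ->
  (forall u, (u <= n + i)%N -> row_of s 0 u = pts X cs u) ->
  dsim (i.+1 * (d * 4 + 20)) min_sqdist_cmd s (fun s' =>
    [/\ same_off [:: rj; rq; rqp] [:: r_sq; r_min] s s', same_rows s s' &
        rmem s' 3 r_min = min_sqdist cs (pts X cs x) i]).
Proof.
move=> Hd Hx Ho Hi xi mem.
set ln := [:: rj; rq; rqp]; set lr := [:: r_sq; r_min].
pose Inv q s' := [/\ same_off ln lr s s', same_rows s s',
  nmem s' 2 rq = q /\ nmem s' 2 rqp = ((n + q) * d)%N &
  rmem s' 3 r_min = min_sqdist cs (pts X cs x) q].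
have sub : {subset [:: rj] <= ln} /\ {subset [:: r_sq] <= lr}.
  by split=> c; rewrite !inE => /eqP ->.
eapply sim_time.
  eapply sim_nset; eapply dsim_seq.
    eapply (@sim_sqdist _ _ x n) => //.
  move=> s1 [F0 E HS]; eapply sim_rset; eapply sim_nset.
  have F : same_off ln lr s s1.
    apply: same_off_trans (same_off_sub F0 sub.1 sub.2).
    by solve_same.
  eapply sim_weak; first eapply (@dsim_while _ _ _ Inv (d * 4 + 12) i).
  - move=> q s' qi [F' [E0 E2] [Hq Hqp] HM]; split.
      by rewrite /= Hq (F'.1 2%N ri) // Hi -ltnNge.
    eapply sim_time.
      eapply sim_nset; eapply dsim_seq.
        eapply (@sim_sqdist _ _ x (n + q.+1)); rewrite //= /upd /=.
        + by rewrite (F'.1 0%N 1%N).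
        + by rewrite (F'.1 2%N rxp).
        + by rewrite Hqp (F'.1 0%N 1%N) // Hd addnS mulSn addnC.
      move=> s2 [F2 [E02 E22] HS2].
      eapply (@dsim_seq R _ _ _ _ _ _ _ (fun s3 =>
          [/\ same_off [::] [:: r_min] s2 s3, same_rows s2 s3 &
          rmem s3 3 r_min = Num.min (rmem s2 3 r_min) (rmem s2 3 r_sq)])).
        eapply (@sim_if R _ _ _ _ _ _ 1).
        rewrite /=; case: leP => H.
          eapply dsim_rset; split; [by solve_same|by []|].
          by rewrite /= /upd /=.
        by eapply dsim_skip; split=> //; solve_same.
      move=> s3 [F3 [E03 E23] HM3]; eapply dsim_nset.
      have FF : same_off ln lr s s3.
        apply: same_off_trans (same_off_sub F3 _ _) => //.
          apply: same_off_trans (same_off_sub F2 sub.1 sub.2).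
          by solve_same.
        by move=> c; rewrite !inE => /eqP ->.
      split; first by solve_same.
      + by split; rewrite /= ?E03 ?E02 ?E0 ?E23 ?E22 ?E2.
      + rewrite /= /upd /= (F3.1 2%N rq) // (F3.1 2%N rqp) // (F2.1 2%N rq) //.
        rewrite (F2.1 2%N rqp) //= /upd /= Hq Hqp (F'.1 0%N 1%N) // Hd addn1.
        by rewrite addnS mulSn addnC.
      + rewrite /= HM3 HS2 F2.2 //= HM; congr (Num.min _ (sqdist _ _)).
          by rewrite -mem //; apply/rowP => j; rewrite !mxE /= E0.
        transitivity (pts X cs (n + q.+1)); last exact: pts_pool.
        rewrite -mem ?leq_add2l //.
        by apply/rowP => j; rewrite !mxE /= E0.
    by lia.
  - by move=> s' [F' _ [Hq _] _]; rewrite /= Hq (F'.1 2%N ri) // Hi leqnn.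
  - split; first by solve_same.
    + by [].
    + split; first by rewrite /= /upd.
      by rewrite /= /upd /= (F0.1 2%N rqp) //= /upd /= Ho addn0.
    + rewrite /= /upd /= HS; congr (sqdist _ _).
        by rewrite -mem //; apply/rowP => j; rewrite !mxE.
      have := pts_pool X cs 0; rewrite addn0 => /= <-.
      by rewrite -mem ?leq_addr //; apply/rowP => j; rewrite !mxE.
  - by move=> _ s' [F' E' _ HM].
by rewrite mulSn; lia.
Qed.

End Deterministic.

Definition reservoir_cmd (wexp : rexp) : cmd :=
  Seq (rset r_sum (rnat 0)) (Seq (nset rx (NConst 0))
  (Seq (nset rxp (NConst 0)) (Seq (nset ryp (NConst 0))
    (While (nlt (nreg rx) n_in)
      (Seq min_sqdist_cmd
      (Seq (rset r_sum (RAdd (rreg r_sum) wexp))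
      (Seq (Flip 2 (NConst rb) (RDiv wexp (rreg r_sum)))
      (Seq (If (BNle (NConst 1) (nreg rb)) (nset ryp (nreg rxp)) Skip)
      (Seq (inc rx) (next_row rxp)))))))))).

Definition pool_cmd : cmd :=
  Seq (nset rq (NConst 0)) (Seq (nset rqp (nreg rorg))
    (While (BNle (nreg rq) (nreg ri))
      (Seq (Flip 2 (NConst rb)
         (RDiv (rnat 1) (ROfNat (NAdd (nreg rq) (NConst 2)))))
      (Seq (If (BNle (NConst 1) (nreg rb)) (nset ryp (nreg rqp)) Skip)
      (Seq (inc rq) (next_row rqp)))))).

Definition round_cmd (wexp : rexp) (stepc : cmd) : cmd :=
  Seq (reservoir_cmd wexp) (Seq pool_cmd (Seq (sqdist_cmd ryp rzp)
    (Seq stepc (Seq move_cmd (inc rt))))).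

Definition cluster_cmd (wexp : rexp) (stepc : cmd) : cmd :=
  Seq (nset rt (NConst 0))
  (Seq (While (nlt (nreg rt) (nreg rM)) (round_cmd wexp stepc))
  (Seq (inc ri) (Seq (next_row rzp) (next_row rop)))).

Definition trial_cmd (wexp : rexp) (stepc : cmd) : cmd :=
  Seq (nset ri (NConst 0)) (Seq (nset rzp (NAdd (nreg rorg) d_in))
    (While (nlt (nreg ri) k_in) (cluster_cmd wexp stepc))).

(** Reals cannot be rounded to naturals, so the number of trials is found on the way, as the first l
    with [1 <= l * p]. *)
Definition trials_cmd (wexp : rexp) (stepc : cmd) : cmd :=
  While (BNot (BRle (rnat 1) (RMul (ROfNat (nreg rl)) (rreg r_p))))
    (Seq (trial_cmd wexp stepc) (inc rl)).

Section Simulation.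
Variables (R : realType) (n d k : nat) (X : 'I_n -> 'rV[R]_d).
Variables (g : R -> R) (gam : nat -> R -> R -> seq (R * (R * R))) (M : nat).
Variables (wexp : rexp) (stepc : cmd) (e : R).
Implicit Types s : state R.

Hypothesis wexpE : forall s, reval s wexp = g (rmem s 3 r_min).
Hypothesis sim_stepc : forall s, rmem s 3 r_e = e ->
  sim 20 stepc s (gam (nmem s 2 rt) (rmem s 3 r_s) (rmem s 3 r_sq))
    (fun gs s' => [/\ same_off [:: rb] [:: r_gam; r_s] s s', same_rows s s',
       rmem s' 3 r_gam = gs.1 & rmem s' 3 r_s = gs.2]).

Lemma sim_reservoir cs i s :
  nmem s 0 0 = n -> nmem s 0 1 = d -> nmem s 2 rorg = (n * d)%N ->
  nmem s 2 ri = i ->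
  (forall u, (u <= n + i)%N -> row_of d s 0 u = pts X cs u) ->
  sim (n * (i.+1 * (d * 4 + 20) + 13) + 9) (reservoir_cmd wexp) s
    (diter (reservoir_step (weight X g cs i)) 0 n (0, 0%N)) (fun a s' =>
      [/\ same_off [:: rj; rq; rqp; rx; rxp; ryp; rb] [:: r_sq; r_min; r_sum]
            s s', same_rows s s', nmem s' 2 ryp = (a.2 * d)%N & (a.2 <= n)%N]).
Proof.
move=> Hn Hd Ho Hi mem.
set ln := [:: rj; rq; rqp; rx; rxp; ryp; rb].
set lr := [:: r_sq; r_min; r_sum].
pose Inv x (a : R * nat) s' := [/\ same_off ln lr s s', same_rows s s',
  nmem s' 2 rx = x /\ nmem s' 2 rxp = (x * d)%N &
  [/\ nmem s' 2 ryp = (a.2 * d)%N, rmem s' 3 r_sum = a.1 & (a.2 <= n)%N]].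
eapply sim_time.
  eapply sim_rset; eapply sim_nset; eapply sim_nset; eapply sim_nset.
  eapply sim_weak; first eapply (@sim_while R _ _ _ _ Inv
    (i.+1 * (d * 4 + 20) + 12) n).
  - move=> x a s' xn [F E [Hx Hxp] [Hy HS an]]; split.
      by rewrite /= Hx (F.1 0%N 0%N) // Hn -ltnNge.
    eapply sim_time.
      eapply dsim_seq.
        apply: (@sim_min_sqdist R n d X cs x i) => //.
        + by rewrite (F.1 0%N 1%N).
        + by rewrite (F.1 2%N rorg).
        + by rewrite (F.1 2%N ri).
        + by lia.
        + by move=> u ui; rewrite (row_of_same d E).1 mem.
      move=> s1 [F1 [E01 E21] HM].
      have {F1}F1 : same_off ln lr s s1 /\ (nmem s1 2 rx = x /\
          nmem s1 2 rxp = (x * d)%N) /\ nmem s1 2 ryp = (a.2 * d)%N /\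
          rmem s1 3 r_sum = a.1.
        split; last by rewrite !F1.1 // F1.2.
        by apply: same_off_trans F (same_off_sub F1 _ _);
          move=> c; rewrite !inE; repeat (case/orP => [/eqP->//|]); move/eqP->.
      move: F1 => [F1 [[Hx1 Hxp1] [Hy1 HS1]]]; case: E => E0 E2.
      eapply sim_rset; eapply sim_expect.
        eapply sim_flip; eapply sim_if_seq; rewrite /=.
          eapply sim_nset; eapply sim_nset; eapply sim_ret; eapply dsim_nset.
          instantiate (1 := (a.1 + weight X g cs i x, x)).
          split; [by solve_same|by split; [exact: etrans E01 E0|exact: etrans E21 E2]| |];
            rewrite /= /upd /= ?Hx1 ?Hxp1 ?Hy1 ?(F1.1 0%N 1%N) // ?Hd.
            by rewrite addn1 mulSn addnC.
          by rewrite wexpE HM HS1; split=> //; exact: ltnW.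
        eapply sim_skip; eapply sim_nset; eapply sim_ret; eapply dsim_nset.
        instantiate (1 := (a.1 + weight X g cs i x, a.2)).
        split; [by solve_same|by split; [exact: etrans E01 E0|exact: etrans E21 E2]| |];
          rewrite /= /upd /= ?Hx1 ?Hxp1 ?Hy1 ?(F1.1 0%N 1%N) // ?Hd.
          by rewrite addn1 mulSn addnC.
        by rewrite wexpE HM HS1.
      move=> G; rewrite /reservoir_step; congr (expect (dmix (clip _) _ _) _).
      by rewrite /= !wexpE /= /upd /= HM HS1.
    by lia.
  - by move=> a s' [F _ [Hx _] _]; rewrite /= Hx (F.1 0%N 0%N) // Hn leqnn.
  - by split; [solve_same|by []|by rewrite /= /upd|by rewrite /= /upd].
  - by move=> a s' [F E _ [Hy _ an]].
by lia.
Qed.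

Lemma sim_pool i u s :
  nmem s 0 1 = d -> nmem s 2 rorg = (n * d)%N -> nmem s 2 ri = i ->
  nmem s 2 ryp = (u * d)%N -> (u <= n + i)%N ->
  sim (i.+1 * 9 + 5) pool_cmd s (diter (pool_step R n) 0 i.+1 u)
    (fun u' s' => [/\ same_off [:: rq; rqp; ryp; rb] [::] s s', same_rows s s',
       nmem s' 2 ryp = (u' * d)%N & (u' <= n + i)%N]).
Proof.
move=> Hd Ho Hi Hy ui; set ln := [:: rq; rqp; ryp; rb].
pose Inv q (u' : nat) s' := [/\ same_off ln [::] s s', same_rows s s',
  nmem s' 2 rq = q /\ nmem s' 2 rqp = ((n + q) * d)%N &
  nmem s' 2 ryp = (u' * d)%N /\ (u' <= n + i)%N].
eapply sim_time.
  eapply sim_nset; eapply sim_nset.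
  eapply sim_weak; first eapply (@sim_while R _ _ _ _ Inv 8 i.+1).
  - move=> q u' s' qi [F [E0 E2] [Hq Hqp] [Hy' u'i]]; split.
      by rewrite /= Hq (F.1 2%N ri) // Hi.
    eapply sim_time.
      eapply sim_expect.
        eapply sim_flip; eapply sim_if_seq; rewrite /=.
          eapply sim_nset; eapply sim_nset; eapply sim_ret; eapply dsim_nset.
          instantiate (1 := (n + q)%N).
          split; [by solve_same|by []| |];
            rewrite /= /upd /= ?Hq ?Hqp ?Hy' ?(F.1 0%N 1%N) // ?Hd.
            by rewrite addn1 addnS mulSn addnC.
          by split=> //; rewrite leq_add2l.
        eapply sim_skip; eapply sim_nset; eapply sim_ret; eapply dsim_nset.
        instantiate (1 := u').
        split; [by solve_same|by []| |];
          rewrite /= /upd /= ?Hq ?Hqp ?Hy' ?(F.1 0%N 1%N) // ?Hd.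
        by rewrite addn1 addnS mulSn addnC.
      by move=> G; rewrite /pool_step /= Hq.
    by lia.
  - by move=> u' s' [F _ [Hq _] _]; rewrite /= Hq (F.1 2%N ri) // Hi ltnn.
  - split; [by solve_same|by []| |by rewrite /= /upd].
    by rewrite /= /upd /= Ho addn0.
  - by move=> u' s' [F E _ []].
by lia.
Qed.

(** The rows are the n points, the origin and then the centers; hence the successor in the address
    of center i. *)
Lemma pts_set_center cs i z u :
  pts X (set_center cs i z) u = if u == (n + i).+1 then z else pts X cs u.
Proof.
rewrite /pts; case: insubP => [x xn xE|]; first by case: eqP => // uE; lia.
rewrite -leqNgt => nu; rewrite -(subnKC nu) addKn -addnS eqn_add2l.
by case: (u - n)%N => [|q] //=; rewrite /set_center eqSS.
Qed.

Let lnR : seq nat := [:: rj; rq; rqp; rx; rxp; ryp; rb; rt].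
Let lrR : seq nat := [:: r_sq; r_min; r_sum; r_gam; r_s].

Let subR ln lr s s' : same_off ln lr s s' ->
  all (fun c => c \in lnR) ln -> all (fun c => c \in lrR) lr ->
  same_off lnR lrR s s'.
Proof. by move=> F /allP Hn /allP Hr; apply: same_off_sub F _ _. Qed.

Definition round_time (i : nat) : nat :=
  n * (i.+1 * (d * 4 + 20) + 13) + i.+1 * 9 + d * 10 + 60.

(** The center under construction is in row [(n + i).+1], just beyond the rows read by the sampling,
    so the sample does not depend on its current value. *)
Lemma sim_round cs i t zs w s :
  nmem s 0 0 = n -> nmem s 0 1 = d -> nmem s 2 rorg = (n * d)%N ->
  nmem s 2 ri = i -> rmem s 3 r_e = e -> nmem s 2 rzp = ((n + i).+1 * d)%N ->
  nmem s 2 rop = (w * d)%N -> nmem s 2 rt = t -> rmem s 3 r_s = zs.2 ->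
  (forall u, row_of d s 0 u = pts X (set_center cs i zs.1) u) ->
  sim (round_time i) (round_cmd wexp stepc) s
    (inner_step gam (sample X g cs i) t zs) (fun zs' s' =>
    [/\ same_off lnR lrR s s', nmem s' 2 rt = t.+1, rmem s' 3 r_s = zs'.2,
        forall u, row_of d s' 0 u = pts X (set_center cs i zs'.1) u &
        forall v, row_of d s' 2 v = if v == w then zs'.1 else row_of d s 2 v]).
Proof.
case: zs => z sc Hn Hd Ho Hi He Hz Hw Ht Hs mem /=.
have memP u : (u <= n + i)%N -> row_of d s 0 u = pts X cs u.
  by move=> ui; rewrite mem pts_set_center; case: eqP => // uE; lia.
eapply sim_time.
  (* [inner_step] nests two of the draws inside [sample]; the program makes all of them in
     sequence. *)
  apply: (@sim_expect R _ _ _ _ (dbind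
    (diter (reservoir_step (weight X g cs i)) 0 n (0, 0%N)) (fun a =>
     dbind (diter (pool_step R n) 0 i.+1 a.2) (fun u =>
     dbind (gam t sc (sqdist (pts X cs u) z)) (fun gs =>
       dret R (z + gs.1 *: (pts X cs u - z), gs.2)))))); last first.
    move=> F; rewrite /inner_step [LHS]expect_bind /sample [LHS]expect_bind.
    rewrite [RHS]expect_bind; apply: eq_expect => a.
    rewrite [LHS]expect_bind [RHS]expect_bind; apply: eq_expect => u.
    by rewrite [LHS]expect_ret.
  eapply sim_seq; first exact: (@sim_reservoir cs i s).
  move=> a s1 [F1 E1 Hy1 an].
  eapply sim_seq.
    by apply: (@sim_pool i a.2 s1) => //; rewrite ?F1.1 //; lia.
  move=> u s2 [F2 E2 Hy2 un].
  have F12 : same_off lnR lrR s s2.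
    by apply: same_off_trans (subR F1 _ _) (subR F2 _ _).
  have un' : u != (n + i).+1 by apply/eqP => uE; move: un; rewrite uE ltnn.
  have E20 v : row_of d s2 0 v = row_of d s 0 v.
    by rewrite (row_of_same d E2).1 (row_of_same d E1).1.
  have E22 v : row_of d s2 2 v = row_of d s 2 v.
    by rewrite (row_of_same d E2).2 (row_of_same d E1).2.
  eapply dsim_seq; first apply: (@sim_sqdist R d ryp rzp u (n + i).+1) => //.
  - by rewrite F2.1 // F1.1.
  - by rewrite F2.1 // F1.1.
  move=> s3 [F3 E3 HS3].
  have F13 : same_off lnR lrR s s3 by apply: same_off_trans F12 (subR F3 _ _).
  have He3 : rmem s3 3 r_e = e by rewrite F13.2.
  have := sim_stepc He3.
  rewrite F3.1 // F2.1 // F1.1 // Ht F3.2 // F2.2 // F1.2 // Hs HS3 !E20.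
  rewrite memP // mem pts_set_center eqxx => Hstep.
  eapply sim_seq; first exact: Hstep.
  move=> gs s4 [F4 E4 Hg Hs4].
  have E40 v : row_of d s4 0 v = row_of d s 0 v.
    by rewrite (row_of_same d E4).1 (row_of_same d E3).1.
  have E42 v : row_of d s4 2 v = row_of d s 2 v.
    by rewrite (row_of_same d E4).2 (row_of_same d E3).2.
  eapply dsim_seq; first apply: (@sim_move R d (n + i).+1 u w s4) => //.
  - by rewrite F4.1 // F13.1.
  - by rewrite F4.1 // F13.1.
  - by rewrite F4.1 // F3.1 // Hy2.
  - by rewrite F4.1 // F13.1.
  move=> s5 [F5 H0 H2]; eapply sim_ret; apply: dsim_nset.
  have F15 : same_off lnR lrR s s5.
    apply: same_off_trans F13 _; apply: same_off_trans (subR F4 _ _) _ => //.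
    exact: subR F5 _ _.
  have zE : row_of d s4 0 (n + i).+1 = z by rewrite E40 mem pts_set_center eqxx.
  have uE : row_of d s4 0 u = pts X cs u by rewrite E40 memP.
  rewrite zE uE Hg in H0 H2.
  split.
  - by solve_same.
  - rewrite /= /upd /= F5.1 // F4.1 // F3.1 // F2.1 // F1.1 // Ht addn1 //.
  - by rewrite /= F5.2.
  - move=> v; transitivity (row_of d s5 0 v); first by apply/rowP => j; rewrite !mxE.
    by rewrite H0 E40 mem !pts_set_center; case: eqP.
  - move=> v; transitivity (row_of d s5 2 v); first by apply/rowP => j; rewrite !mxE.
    by rewrite H2 E42.
by rewrite /round_time; lia.
Qed.

Let lnT : seq nat := [:: ri; rzp; rop] ++ lnR.

Definition cluster_time (i : nat) : nat := M * (round_time i).+1 + 12.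

Hypothesis M0 : (0 < M)%N.

Lemma sim_cluster i st w s :
  nmem s 0 0 = n -> nmem s 0 1 = d -> nmem s 2 rorg = (n * d)%N ->
  nmem s 2 rM = M -> nmem s 2 ri = i -> rmem s 3 r_e = e ->
  nmem s 2 rzp = ((n + i).+1 * d)%N ->
  nmem s 2 rop = (w * d)%N -> rmem s 3 r_s = st.2 ->
  (forall u, row_of d s 0 u = pts X st.1 u) ->
  sim (cluster_time i) (cluster_cmd wexp stepc) s
    (cluster_step X g gam M i st) (fun st' s' =>
    [/\ same_off lnT lrR s s',
        [/\ nmem s' 2 ri = i.+1, nmem s' 2 rzp = ((n + i.+1).+1 * d)%N,
            nmem s' 2 rop = (w.+1 * d)%N & rmem s' 3 r_s = st'.2],
        forall u, row_of d s' 0 u = pts X st'.1 u,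
        forall v, row_of d s' 2 v = if v == w then st'.1 i else row_of d s 2 v &
        forall q, (q < i)%N -> st'.1 q = st.1 q]).
Proof.
case: st => cs sc Hn Hd Ho HM Hi He Hz Hw Hs mem /=.
(* The output row w is written by each round, so its content is known only once [0 < t]; this is why
   [M0] is assumed. *)
pose Inv t (zs : 'rV[R]_d * R) s' := [/\ same_off lnR lrR s s',
  nmem s' 2 rt = t, rmem s' 3 r_s = zs.2,
  forall u, row_of d s' 0 u = pts X (set_center cs i zs.1) u &
  forall v, row_of d s' 2 v =
    if (v == w) && (0 < t)%N then zs.1 else row_of d s 2 v].
have Hloop := @sim_while R (nlt (nreg rt) (nreg rM)) (round_cmd wexp stepc) _
  (inner_step gam (sample X g cs i)) Inv (round_time i) M.
eapply sim_time.
  eapply sim_nset; eapply sim_seq; first apply: Hloop.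
  - move=> t zs s' tM [F Ht Hs' H0 H2]; split.
      by rewrite /= Ht F.1 // HM -ltnNge.
    apply: sim_weak.
      by apply: (@sim_round cs i t zs w) => //; rewrite ?F.1 ?F.2.
    move=> zs' s2 [F2 Ht2 Hs2 H02 H22]; split=> //.
      exact: same_off_trans F F2.
    by move=> v; rewrite H22 andbT H2; case: (v == w).
  - by move=> zs s' [F Ht _ _ _]; rewrite /= Ht F.1 // HM leqnn.
  - split; [by solve_same|by rewrite /= /upd|by []| |].
      move=> u; transitivity (row_of d s 0 u); first by apply/rowP => j; rewrite !mxE.
      rewrite mem pts_set_center; case: eqP => // ->.
      by rewrite -addnS pts_pool.
    by move=> v; rewrite andbF; apply/rowP => j; rewrite !mxE.
  move=> zs s' [F Ht Hs' H0 H2].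
  have FT : same_off lnT lrR s s'.
    by apply: same_off_sub F _ _ => c // H; rewrite /lnT mem_cat H orbT.
  eapply sim_nset; eapply sim_nset; eapply sim_ret; apply: dsim_nset.
  split.
  - by solve_same.
  - split; rewrite /= /upd /= ?F.1 ?Hi ?addn1 ?Hz ?Hw ?Hd //.
      by rewrite addnS [in RHS]mulSn addnC.
    by rewrite mulSn addnC.
  - move=> u; transitivity (row_of d s' 0 u); first by apply/rowP => j; rewrite !mxE.
    by rewrite H0.
  - move=> v; transitivity (row_of d s' 2 v); first by apply/rowP => j; rewrite !mxE.
    by rewrite H2 M0 andbT /= /set_center eqxx.
  - by move=> q qi /=; rewrite /set_center; case: eqP => // qE; lia.
by rewrite /cluster_time; lia.
Qed.

Definition trial_time : nat := k * (cluster_time k).+1 + 5.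

Lemma sim_trial st w s :
  nmem s 0 0 = n -> nmem s 0 1 = d -> nmem s 0 2 = k ->
  nmem s 2 rorg = (n * d)%N -> nmem s 2 rM = M -> rmem s 3 r_e = e ->
  nmem s 2 rop = (w * d)%N -> rmem s 3 r_s = st.2 ->
  (forall u, row_of d s 0 u = pts X st.1 u) ->
  sim trial_time (trial_cmd wexp stepc) s (trial k X g gam M st) (fun st' s' =>
    [/\ same_off lnT lrR s s', nmem s' 2 rop = ((w + k) * d)%N,
        rmem s' 3 r_s = st'.2, forall u, row_of d s' 0 u = pts X st'.1 u &
        (forall v, (v < w)%N -> row_of d s' 2 v = row_of d s 2 v) /\
        (forall q : 'I_k, row_of d s' 2 (w + q) = st'.1 q)]).
Proof.
move=> Hn Hd Hk Ho HM He Hw Hs mem.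
pose Inv i (st' : (nat -> 'rV[R]_d) * R) s' := [/\ same_off lnT lrR s s',
  [/\ nmem s' 2 ri = i, nmem s' 2 rzp = ((n + i).+1 * d)%N,
      nmem s' 2 rop = ((w + i) * d)%N & rmem s' 3 r_s = st'.2],
  forall u, row_of d s' 0 u = pts X st'.1 u,
  forall v, (v < w)%N -> row_of d s' 2 v = row_of d s 2 v &
  forall q, (q < i)%N -> row_of d s' 2 (w + q) = st'.1 q].
have Hloop := @sim_while R (nlt (nreg ri) k_in) (cluster_cmd wexp stepc) _
  (cluster_step X g gam M) Inv (cluster_time k) k.
eapply sim_time.
  eapply sim_nset; eapply sim_nset; eapply sim_weak; first apply: Hloop.
  - move=> i st' s' ik [F [Hi Hz Hw' Hs'] H0 H2 H3]; split.
      by rewrite /= Hi F.1 // Hk -ltnNge.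
    eapply sim_time.
      eapply sim_weak; first by
        apply: (@sim_cluster i st' (w + i)) => //; rewrite ?F.1 ?F.2.
      move=> st2 s2 [F2 [Hi2 Hz2 Hw2 Hs2] H02 H22 H32]; split=> //.
      + exact: same_off_trans F F2.
      + by split=> //; rewrite addnS.
      + by move=> v vw; rewrite H22; case: eqP => [vE|_]; [lia|exact: H2].
      + move=> q; rewrite ltnS leq_eqVlt => /predU1P[->|qi].
          by rewrite H22 eqxx.
        by rewrite H22 eqn_add2l ltn_eqF // H3 // H32.
    by rewrite /cluster_time /round_time leq_add2r leq_mul2l ltnS !leq_add2r;
      apply/orP; right; apply: leq_add; rewrite ?leq_mul2l ?leq_mul2r ?leq_add2r
        ?leq_mul2r; lia.
  - by move=> st' s' [F [Hi _ _ _] _ _ _]; rewrite /= Hi F.1 // Hk leqnn.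
  - split=> //.
    + by rewrite /lnT; solve_same.
    + split; rewrite /= /upd //= ?addn0 // Ho Hd.
      by rewrite mulSn addnC.
  - move=> st' s' [F [_ _ Hw' Hs'] H0 H2 H3]; split=> //.
    by split=> // q; exact: H3.
by rewrite /trial_time; lia.
Qed.

Lemma sim_trials (L : nat) (p : R) s :
  nmem s 0 0 = n -> nmem s 0 1 = d -> nmem s 0 2 = k ->
  nmem s 2 rorg = (n * d)%N -> nmem s 2 rM = M -> rmem s 3 r_e = e ->
  nmem s 2 rop = 0%N -> nmem s 2 rl = 0%N -> rmem s 3 r_p = p ->
  (forall l, (l < L)%N -> l%:R * p < 1) -> 1 <= L%:R * p ->
  (forall u, row_of d s 0 u = pts X (fun=> 0) u) ->
  sim (L * (trial_time + 3)).+1 (trials_cmd wexp stepc) s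
    (diter (@trials_step R n d k X g gam M) 0 L ((fun=> 0, rmem s 3 r_s), [::]))
    (fun b s' =>
    [/\ nmem s' 0 = nmem s 0, nmem s' 2 rl = L, size b.2 = L &
        forall l (q : 'I_k), (l < L)%N ->
          row_of d s' 2 (l * k + q) = nth (fun=> 0) b.2 l q]).
Proof.
move=> Hn Hd Hk Ho HM He Hw Hl Hp pL L1 mem.
pose Inv l (b : ((nat -> 'rV[R]_d) * R) * seq ('I_k -> 'rV[R]_d)) s' :=
  [/\ same_off (rl :: lnT) lrR s s',
    [/\ nmem s' 2 rl = l, nmem s' 2 rop = (l * k * d)%N &
        rmem s' 3 r_s = b.1.2],
    forall u, row_of d s' 0 u = pts X b.1.1 u, size b.2 = l &
    forall l' (q : 'I_k), (l' < l)%N ->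
      row_of d s' 2 (l' * k + q) = nth (fun=> 0) b.2 l' q].
have Hloop := @sim_while R _ (Seq (trial_cmd wexp stepc) (inc rl)) _
  (@trials_step R n d k X g gam M) Inv (trial_time + 2) L.
eapply sim_time.
  eapply sim_weak; first apply: Hloop.
  - move=> l b s' lL [F [Hl' Hw' Hs'] H0 Hsz H2]; split.
      by rewrite /= Hl' F.2 // Hp -ltNge pL.
    eapply sim_time.
      eapply sim_seq; first by
        apply: (@sim_trial b.1 (l * k)) => //; rewrite ?F.1 ?F.2.
      move=> st2 s2 [F2 Hw2 Hs2 H02 [H22 H32]]; eapply sim_ret; apply: dsim_nset.
      have FF : same_off (rl :: lnT) lrR s s2.
        apply: same_off_trans F (same_off_sub F2 _ _) => // c Hc.
        by rewrite inE Hc orbT.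
      split.
      + by rewrite /lnT; solve_same.
      + split; rewrite /= /upd //= ?Hw2 ?mulSn ?[(k + _)%N]addnC //.
        by rewrite F2.1 // Hl' addn1.
      + move=> u; transitivity (row_of d s2 0 u); first by apply/rowP => j; rewrite !mxE.
        exact: H02.
      + by rewrite size_rcons Hsz.
      + move=> l' q; rewrite ltnS => l'l.
        transitivity (row_of d s2 2 (l' * k + q)).
          by apply/rowP => j; rewrite !mxE.
        rewrite nth_rcons Hsz; case: (ltngtP l' l) l'l => // [l'l _|-> _].
          rewrite H22 ?H2 //.
          have : (l'.+1 * k <= l * k)%N by rewrite leq_mul2r l'l orbT.
          by have := ltn_ord q; rewrite mulSn; lia.
        by rewrite H32.
    by lia.
  - move=> b s' [F [Hl' _ _] _ _ _].
    by rewrite /= Hl' F.2 // Hp L1.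
  - by split.
  - move=> b s' [F [Hl' _ _] _ Hsz H2]; split=> //.
    by apply/funext => c; rewrite F.1.
by lia.
Qed.

End Simulation.

(** The cube [(e / (24 * k)) ^+ 3] is a simple lower bound for the success factor [al / (k + 1) / 4]
    of one sample, because [e / (2 * k) <= 1 / (k + 1)]. *)
Definition om_exp : rexp :=
  let q := RDiv (rreg r_e) (RMul (rnat 24) (ROfNat k_in)) in RMul (RMul q q) q.

(** Naturals have no product and reals no rounding: the address [n * d] comes from repeated
    additions, M from a search for the first multiple of the threshold reaching 1, and p from nested
    multiplications. *)
Definition init_cmd (thre : rexp) : cmd :=
  Seq (rset r_e (RDiv (RGet 1 (NConst 0)) (RAdd (rnat 1) (RGet 1 (NConst 0)))))
  (Seq (While (nlt (nreg rx) n_in) (Seq (next_row rorg) (inc rx)))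
  (Seq (rset r_thr thre)
  (Seq (While (BNot (BRle (rnat 1) (RMul (ROfNat (nreg rM)) (rreg r_thr))))
          (inc rM))
  (Seq (rset r_om om_exp) (Seq (rset r_p (rnat 1))
    (While (nlt (nreg ri) k_in) (Seq (nset rt (NConst 0))
      (Seq (While (nlt (nreg rt) (nreg rM))
              (Seq (rset r_p (RMul (rreg r_p) (rreg r_om))) (inc rt)))
        (inc ri))))))))).

Definition program (thre wexp : rexp) (stepc : cmd) : cmd :=
  Seq (init_cmd thre)
    (Seq (trials_cmd wexp stepc) (NSet 1 (NConst 0) (nreg rl))).

Section Initialization.
Variables (R : realType) (n d k : nat) (X : 'I_n -> 'rV[R]_d) (eps : R).

(** Quotient and remainder by d recover row and column, so the sum in [input] has at most one term.
    The rows from n on are 0, which supplies the origin and the initial centers. *)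
Lemma row_of_input u : row_of d (input k eps X) 0 u = pts X (fun=> 0) u.
Proof.
have inj x (j' j : 'I_d) : (x * d + j' == u * d + j)%N = (x == u) && (j' == j).
  apply/eqP/andP => [E|[/eqP -> /eqP -> //]].
  have d0 : (0 < d)%N by apply: leq_ltn_trans (ltn_ord j).
  have : ((x * d + j') %/ d = (u * d + j) %/ d)%N by rewrite E.
  rewrite !divnMDl // !divn_small // !addn0 => xu.
  by rewrite xu eqxx; split=> //; apply/eqP/val_inj/(addnI (etrans _ E)); rewrite xu.
apply/rowP => j; rewrite mxE /= /pts.
under eq_bigr => x _ do under eq_bigl => j' do rewrite inj.
case: insubP => [x _ xu|nu].
  rewrite (bigD1 x) //= xu eqxx /= big_pred1_eq big1 ?addr0 // => x' x'x.
  apply: big_pred0 => j'; rewrite -xu.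
  by rewrite (inj_eq val_inj) (negPf x'x).
rewrite big1 => [|x _].
  by case: (u - n)%N => [|q]; rewrite /= mxE.
by apply: big_pred0 => j'; case: eqP => // xu; rewrite -xu ltn_ord in nu.
Qed.

Variables (th : R) (thre : rexp) (M : nat).
Let e := eps / (1 + eps).
Let om := (e / (24 * k%:R)) ^+ 3.
Hypothesis threE : forall s : state R, rmem s 3 r_e = e -> reval s thre = th.
Hypothesis M_min : forall m, (m < M)%N -> m%:R * th < 1.
Hypothesis M_th : 1 <= M%:R * th.

Definition init_time : nat := n * 4 + M * 2 + k * (M * 4 + 6) + 13.

Lemma sim_init : let s := input k eps X in
  dsim init_time (init_cmd thre) s (fun s' =>
    [/\ same_off [:: rx; rorg; rM; ri; rt] [:: r_e; r_thr; r_om; r_p] s s',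
        same_rows s s', nmem s' 2 rorg = (n * d)%N /\ nmem s' 2 rM = M &
        rmem s' 3 r_e = e /\ rmem s' 3 r_p = (om ^+ M) ^+ k]).
Proof.
move=> s; set ln := [:: rx; rorg; rM; ri; rt].
set lr := [:: r_e; r_thr; r_om; r_p].
pose Inv1 x s' := [/\ same_off ln lr s s', same_rows s s',
  nmem s' 2 rx = x, nmem s' 2 rorg = (x * d)%N &
  [/\ nmem s' 2 rM = 0%N, nmem s' 2 ri = 0%N & rmem s' 3 r_e = e]].
pose Inv2 m s' := [/\ same_off ln lr s s', same_rows s s',
  nmem s' 2 rM = m, nmem s' 2 rorg = (n * d)%N &
  [/\ rmem s' 3 r_thr = th, nmem s' 2 ri = 0%N & rmem s' 3 r_e = e]].
pose Inv3 i s' := [/\ same_off ln lr s s', same_rows s s',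
  nmem s' 2 rM = M /\ nmem s' 2 ri = i, nmem s' 2 rorg = (n * d)%N &
  [/\ rmem s' 3 r_om = om, rmem s' 3 r_p = (om ^+ M) ^+ i &
      rmem s' 3 r_e = e]].
pose Inv4 i t s' := [/\ same_off ln lr s s', same_rows s s',
  [/\ nmem s' 2 rM = M, nmem s' 2 ri = i & nmem s' 2 rt = t],
  nmem s' 2 rorg = (n * d)%N &
  [/\ rmem s' 3 r_om = om, rmem s' 3 r_p = (om ^+ M) ^+ i * om ^+ t &
      rmem s' 3 r_e = e]].
eapply sim_time.
  eapply sim_rset; eapply dsim_seq.
    eapply (@dsim_while R _ _ Inv1 3 n).
    - move=> x s' xn [F E Hx Ho [HM Hi He]]; split.
        by rewrite /= Hx F.1 //= -ltnNge.
      eapply sim_nset; apply: dsim_nset.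
      split; [by solve_same|by []| | |]; rewrite /= /upd //= ?Hx ?Ho ?addn1 //.
      by rewrite F.1 //= mulSn addnC.
    - by move=> s' [F E Hx _ _]; rewrite /= Hx F.1 //= leqnn.
    - by split; [solve_same|by []|by []|by []|split].
  move=> s1 [F1 [E10 E12] _ Ho1 [HM1 Hi1 He1]].
  eapply sim_rset; eapply dsim_seq.
    eapply (@dsim_while R _ _ Inv2 1 M).
    - move=> m s' mM [F E HM Ho [Ht Hi He]]; split.
        by rewrite /= HM Ht -ltNge M_min.
      apply: dsim_nset.
      by split; [solve_same|by []| | |]; rewrite /= /upd //= ?HM ?addn1.
    - by move=> s' [_ _ HM _ [Ht _ _]]; rewrite /= HM Ht M_th.
    - split; [by solve_same|by []|by []|by []|split=> //].
      by rewrite /= /upd /= threE.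
  move=> s2 [F2 [E20 E22] HM2 Ho2 [Ht2 Hi2 He2]].
  eapply sim_rset; eapply sim_rset.
  eapply sim_weak; first eapply (@dsim_while R _ _ Inv3 (M * 4 + 5) k).
  - move=> i s' ik [F [E0 E2] [HM Hi] Ho [Hom Hp He]]; split.
      by rewrite /= Hi F.1 //= -ltnNge.
    eapply sim_time.
      eapply sim_nset; eapply dsim_seq.
        eapply (@dsim_while R _ _ (Inv4 i) 3 M).
        + move=> t s3 tM [F3 E3 [HM3 Hi3 Ht3] Ho3 [Hom3 Hp3 He3]]; split.
            by rewrite /= HM3 Ht3 -ltnNge.
          eapply sim_rset; apply: dsim_nset.
          split; [by solve_same|by []|split|by []|split];
            rewrite /= /upd //= ?Ht3 ?addn1 //.
          by rewrite Hp3 Hom3 -mulrA exprSr.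
        + by move=> s3 [_ _ [HM3 _ Ht3] _ _]; rewrite /= HM3 Ht3 leqnn.
        + split; [by solve_same|by []|split|by []|split]; rewrite /= /upd //=.
          by rewrite expr0 mulr1.
      move=> s3 [F3 E3 [HM3 Hi3 Ht3] Ho3 [Hom3 Hp3 He3]]; apply: dsim_nset.
      split; [by solve_same|by []|split|by []|split];
        rewrite /= /upd //= ?Hi3 ?addn1 //.
      by rewrite Hp3 exprSr.
    by lia.
  - by move=> s' [F _ [_ Hi] _ _]; rewrite /= Hi F.1 //= leqnn.
  - split; [by solve_same|by []|split|by []|split]; rewrite /= /upd //=.
    by rewrite He2 F2.1 //= /om; ring.
  - by move=> _ s' [F E [HM Hi] Ho [_ Hp He]].
by rewrite /init_time; lia.
Qed.

End Initialization.

(** * Boosting, running time and list size *)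

Section Boosting.
Variable R : realType.

Lemma least_multiple (th : R) : 0 < th -> exists M : nat,
  [/\ forall m, (m < M)%N -> m%:R * th < 1, 1 <= M%:R * th &
      M%:R <= th^-1 + 1].
Proof.
move=> th0; have ex : exists m, 1 <= m%:R * th.
  exists (Num.bound th^-1); rewrite -ler_pdivrMr // div1r.
  by apply/ltW/archi_boundP; rewrite invr_ge0 ltW.
exists (ex_minn ex); case: ex_minnP => M M1 Mmin.
have lt1 m : (m < M)%N -> m%:R * th < 1.
  by move=> mM; rewrite ltNge; apply: contraL mM => /Mmin; rewrite -leqNgt.
split=> //; case: M M1 Mmin lt1 => [|M] _ _ lt1.
  by rewrite addr_ge0 ?invr_ge0 ?ltW.
by rewrite -natr1 lerD2r -[th^-1]mul1r ler_pdivlMr // ltW // lt1.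
Qed.

(** By Bernoulli's inequality, [(1 - p) ^+ L * (1 + L%:R * p)] is at most [(1 - p ^+ 2) ^+ L], hence
    at most 1, while [1 + L%:R * p] is at least 2. *)
Lemma pow_le_half (p : R) L : 0 <= p <= 1 -> 1 <= L%:R * p ->
  (1 - p) ^+ L <= 1 / 2.
Proof.
move=> /andP[p0 p1] Lp.
have bern m : 1 + m%:R * p <= (1 + p) ^+ m.
  elim: m => [|m IH]; first by rewrite mul0r addr0.
  rewrite exprS; apply: (@le_trans _ _ ((1 + p) * (1 + m%:R * p))).
    rewrite -natr1; have : 0 <= m%:R * p * p by rewrite !mulr_ge0.
    by rewrite mulrDl mul1r mulrDr !mulrDl mul1r; lra.
  by rewrite ler_wpM2l // addr_ge0.
have q0 : 0 <= (1 - p) ^+ L by rewrite exprn_ge0 // subr_ge0.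
have : (1 - p) ^+ L * (1 + L%:R * p) <= 1.
  apply: le_trans (ler_wpM2l q0 (bern L)) _; rewrite -exprMn.
  have -> : (1 - p) * (1 + p) = 1 - p * p by ring.
  rewrite exprn_ile1 ?gerBl ?mulr_ge0 // subr_ge0.
  by rewrite -[leRHS]mul1r ler_pM.
have : (1 - p) ^+ L * 2 <= (1 - p) ^+ L * (1 + L%:R * p).
  by rewrite ler_wpM2l //; lra.
lra.
Qed.

Lemma steps_ge0 T (cf : config R) : all (fun q => 0 <= q.1) (steps T cf).
Proof.
elim: T cf => [|T IH] cf /=; first by rewrite ler01.
have step0 : all (fun q => 0 <= q.1) (step cf).
  case: cf => -[|[|a i e|a i e|a i e|c1 c2|b c1 c2|b c] K] s /=; rewrite ?ler01 //.
  have /andP[h0 h1] := clip_itv (reval s e).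
  by rewrite -/(clip _) h0 subr_ge0 h1.
elim: (step cf) step0 => //= q D IHD /andP[q0 D0]; rewrite all_cat IHD // andbT.
rewrite all_map; have := IH q.2; apply: sub_all => r /= r0.
exact: mulr_ge0.
Qed.

(** Turns an expectation bound into the statement on every possible outcome that [list_solves] asks
    for. *)
Lemma all_of_expect A (D : seq (R * A)) (b : A -> bool) :
  all (fun q => 0 <= q.1) D -> isdist D -> 1 <= expect D (fun a => (b a)%:R) ->
  all (fun q => (0 < q.1) ==> b q.2) D.
Proof.
move=> D0 [_ D1] H; have : expect D (fun a => (~~ b a)%:R) <= 0.
  have E : expect D (fun a => (b a)%:R) + expect D (fun a => (~~ b a)%:R) = 1.
    rewrite -expectD -D1; apply: eq_expect => a.
    by case: (b a); rewrite ?addr0 ?add0r.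
  by move: E H; lra.
elim: D D0 {D1 H} => //= q D IH /andP[q0 D0]; rewrite /expect big_cons => H.
have D1 : 0 <= \sum_(j <- D) j.1 * (~~ b j.2)%:R.
  elim: D D0 {IH H} => [|r D IHD] /=; first by rewrite big_nil.
  by move=> /andP[r0 /IHD]; rewrite big_cons; apply: addr_ge0; rewrite mulr_ge0.
have q1 : 0 <= q.1 * (~~ b q.2)%:R by rewrite mulr_ge0.
rewrite IH // ?andbT; last by rewrite /expect; move: q1 D1 H; lra.
apply/implyP => qp; case: (b q.2) H q1 => //=; rewrite mulr1; lra.
Qed.

Lemma list_solves_sim P n d k eps (X : 'I_n -> 'rV[R]_d) cost opt T (L : nat)
    (B : R) A (D : seq (R * A)) (out : A -> seq ('I_k -> 'rV[R]_d)) :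
  sim T P (input k eps X) D
    (fun a s' => output d k s' = out a /\ size (out a) = L) ->
  isdist D -> L%:R <= B ->
  (forall O, clustering O -> 1 / 2 <= expect D (fun a =>
     (has (fun C => cost X C O <= (1 + eps) * opt X O) (out a))%:R)) ->
  list_solves P eps X cost opt T B.
Proof.
move=> H hD LB good; split.
  apply: (@all_of_expect _ _ (fun cf : config R =>
    halted cf && ((size (output d k cf.2))%:R <= B))).
  - exact: steps_ge0.
  - exact: isdist_steps.
  (* With payoff 1, the runs that halt in time with a short list have total probability 1. *)
  have H1 := H [::] 0%N (fun s => ((size (output d k s))%:R <= B)%R%:R) (fun=> 1).
  rewrite hD.2 addn0 in H1; apply: le_trans (H1 _ _) _.
  - by move=> s; exact: ler0n.
  - by move=> a s' [Es sz]; rewrite /after /= expect_ret /on_halt /= Es sz LB.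
  rewrite /after; apply/eq_ler/eq_expect => -[K s] /=.
  by rewrite /on_halt /halted; case: K.
move=> O /good good_O; apply: le_trans good_O _.
have H1 := H [::] 0%N (fun s => (has (fun C => cost X C O <= (1 + eps) * opt X O)
  (output d k s))%:R) (fun a => (has (fun C =>
    cost X C O <= (1 + eps) * opt X O) (out a))%:R).
rewrite addn0 in H1; apply: le_trans (H1 _ _) _.
- by move=> s; exact: ler0n.
- by move=> a s' [Es sz]; rewrite /after /= expect_ret /on_halt /= Es.
rewrite /after big_mkcond /=.
apply: le_trans (le_expect (isdist_steps _ _) (G := fun cf : config R =>
  (has (fun C => cost X C O <= (1 + eps) * opt X O) (output d k cf.2))%:R) _) _.
  by move=> [K s]; rewrite /on_halt /=; case: K => // *; exact: ler0n.
apply: eq_ler; apply: eq_bigr => q _.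
by case: ifP => _; rewrite ?mulr1 ?mulr0.
Qed.

End Boosting.

Definition total_time (n d k M L : nat) : nat :=
  init_time n k M + L * (trial_time n d k M + 3) + 5.

Section Program.
Variables (R : realType) (thre wexp : rexp) (stepc : cmd).
Variables (g : R -> R) (gam : R -> nat -> R -> R -> seq (R * (R * R))).
Variable thf : R -> R.

Hypothesis threE : forall s : state R, reval s thre = thf (rmem s 3 r_e).
Hypothesis wexpE : forall s : state R, reval s wexp = g (rmem s 3 r_min).
Hypothesis sim_stepc : forall (e : R) (s : state R), rmem s 3 r_e = e ->
  sim 20 stepc s (gam e (nmem s 2 rt) (rmem s 3 r_s) (rmem s 3 r_sq))
    (fun gs s' => [/\ same_off [:: rb] [:: r_gam; r_s] s s', same_rows s s',
       rmem s' 3 r_gam = gs.1 & rmem s' 3 r_s = gs.2]).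
Hypothesis isdist_gam : forall e t s r, isdist (gam e t s r).
Hypothesis g_ge0 : forall r, 0 <= r -> 0 <= g r.
Hypothesis g_mono : forall r r', 0 <= r -> r <= r' -> g r <= g r'.
Hypothesis g0 : g 0 = 0.
Let rho (d : nat) (u v : 'rV[R]_d) : R := g (sqdist u v).
Hypothesis rho_young : forall d (a : R) (u v w : 'rV[R]_d), 0 < a ->
  rho u w <= (1 + a) * rho u v + (1 + a^-1) * rho v w.
Hypothesis inner : forall n d (A : {set 'I_n}) (y : 'I_n -> 'rV[R]_d) c zs e M,
  (0 < #|A|)%N -> 0 < e < 1 -> 1 <= M%:R * thf e ->
  4^-1 ^+ M <= expect (diter (inner_step (gam e) (uniform A y)) 0 M zs)
    (fun zs' => (\sum_(x in A) rho (y x) zs'.1 <=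
       (1 + e / 8) * \sum_(x in A) rho (y x) c)%R%:R).

(** The reference centers need only be optimal up to the ratio of [1 + eps] to [1 + e]; for k-median
    this avoids a minimizer of the cost. *)
Lemma program_solves n d k eps (X : 'I_n -> 'rV[R]_d)
    (opt : ('I_n -> 'rV[R]_d) -> ('I_k -> {set 'I_n}) -> R) M L (B : R) :
  let e := eps / (1 + eps) in
  let p := ((e / (24 * k%:R)) ^+ 3 ^+ M) ^+ k in
  (0 < k)%N -> 0 < eps ->
  (forall m, (m < M)%N -> m%:R * thf e < 1) -> 1 <= M%:R * thf e ->
  (forall l, (l < L)%N -> l%:R * p < 1) -> 1 <= L%:R * p -> L%:R <= B ->
  (forall O, clustering O -> exists ctr : 'I_k -> 'rV[R]_d,
     (1 + e) * \sum_j \sum_(x in O j) rho (X x) (ctr j) <=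
     (1 + eps) * opt X O) ->
  list_solves (program thre wexp stepc) eps X (@min_cost R n d k (@rho d)) opt
    (total_time n d k M L) B.
Proof.
move=> e p k0 eps0 Mmin M1 Lmin L1 LB Hopt.
have e01 : 0 < e < 1.
  have h : 0 < 1 + eps by lra.
  by rewrite divr_gt0 //= ltr_pdivrMr //; lra.
have /andP[e0 e1] := e01.
have M0 : (0 < M)%N by case: M M1 {Mmin p Lmin L1} => //; rewrite mul0r; lra.
pose D s0 := diter (trials_step (k := k) X g (gam e) M) 0 L ((fun=> 0, s0), [::]).
have hD s0 : isdist (D s0).
  by apply: isdist_iter => *; apply: isdist_trials_step => *; exact: isdist_gam.
apply: (@list_solves_sim R _ n d k eps X _ _ _ L B _ (D 0) snd) => //.
- eapply sim_time.
    eapply dsim_seq.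
      apply: (@sim_init R n d k X eps (thf e) thre M) => //.
      by move=> s He; rewrite threE He.
    move=> s [F E [Ho HM] [He Hp]].
    have Fn c : nmem s 0 c = nth 0%N [:: n; d; k] c by rewrite F.1.
    have Hs : rmem s 3 r_s = 0 by rewrite F.2.
    have H := @sim_trials R n d k X g (gam e) M wexp stepc e wexpE
      (@sim_stepc e) M0 L p s (Fn 0%N) (Fn 1%N) (Fn 2%N) Ho HM He.
    rewrite Hs in H.
    apply: (@sim_expect R _ _ _ _ (dbind (D 0) (fun b => dret R b))); last first.
      move=> f; rewrite expect_bind; apply: eq_expect => b.
      by rewrite expect_ret.
    eapply sim_seq; first apply: H => //.
    + by rewrite F.1.
    + by rewrite F.1.
    + move=> u; rewrite -(@row_of_input R n d k X eps).
      by rewrite (row_of_same d E).1.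
    move=> b s' [_ Hl Hsz H2]; eapply sim_ret; apply: dsim_nset; split=> //.
    have -> : output d k (set_nat s' 1 (neval s' (NConst 0))
        (neval s' (nreg rl))) =
        mkseq (fun l (q : 'I_k) => row_of d s' 2 (l * k + q)) L by rewrite -Hl.
    apply: (@eq_from_nth _ (fun=> 0)); rewrite size_mkseq ?Hsz // => l lL.
    by rewrite nth_mkseq //; apply/funext => q; rewrite -H2.
  by rewrite /total_time; lia.
move=> O /[dup] Ocl /Hopt[ctr Hctr].
have inner' (A : {set 'I_n}) (y : 'I_n -> 'rV[R]_d) c zs : (0 < #|A|)%N ->
    4^-1 ^+ M <= expect (diter (inner_step (gam e) (uniform A y)) 0 M zs)
    (fun zs' => (\sum_(x in A) rho (y x) zs'.1 <=
       (1 + e / 8) * \sum_(x in A) rho (y x) c)%R%:R).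
  by move=> A0; exact: inner.
have H := @trials_success R n d k X g (gam e) M (isdist_gam e) g_ge0 g_mono
  (@rho_young d) O ctr e Ocl e01 k0 inner' g0 L 0 ((fun=> 0, 0), [::]).
rewrite /= subr0 mulr1 in H; move: H.
set beta := (_ ^+ M) ^+ k => H.
have kR : 0 < k%:R :> R by rewrite ltr0n.
have base01 : 0 <= (e / (12 * k%:R)) ^+ 2 / 12 / (k + 1)%:R / 4 <= 1.
  have t01 : 0 <= e / (12 * k%:R) <= 1.
    rewrite divr_ge0 ?(ltW e0) ?mulr_ge0 //= ler_pdivrMr ?mulr_gt0 //.
    have k1 : 1 <= k%:R :> R by rewrite ler1n.
    lra.
  have i1 : (k + 1)%:R^-1 <= 1 :> R by rewrite invf_le1 ?ltr0n ?ler1n addn1.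
  have i0 : 0 <= (k + 1)%:R^-1 :> R by rewrite invr_ge0.
  move: t01 => /andP[t0 t1]; set t := e / _ in t0 t1 *.
  have t2 : 0 <= t ^+ 2 <= 1 by rewrite sqr_ge0 exprn_ile1.
  move: t2 i0 i1; move: (t ^+ 2) (_^-1) => a b /andP[a0 a1] b0 b1.
  have : 0 <= a / 12 * b by rewrite mulr_ge0 // divr_ge0.
  have : a / 12 * b <= 1 * 1 by rewrite ler_pM // ?divr_ge0 //; lra.
  by move: (a / 12 * b) => c; lra.
(* The program counts its trials with p, a lower bound for the success probability beta of the
   analysis, so it makes enough of them. *)
have pb : p <= beta.
  have [b0 b1] := andP base01; have [h0 h1] := andP e01.
  have q1 : 0 <= e / (24 * k%:R).
    by rewrite divr_ge0 ?(ltW e0) // mulr_ge0.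
  have q0 : 0 <= (e / (24 * k%:R)) ^+ 3 by exact: exprn_ge0.
  rewrite /p /beta; apply: lerXn2r; rewrite ?nnegrE ?exprn_ge0 //.
  apply: lerXn2r; rewrite ?nnegrE //.
  have -> : (e / (24 * k%:R)) ^+ 3 =
      (e / (12 * k%:R)) ^+ 2 / 12 / 4 * (e / (2 * k%:R)).
    by field; rewrite gt_eqF.
  rewrite [leRHS]mulrAC; apply: ler_wpM2l.
    by rewrite divr_ge0 // divr_ge0 // sqr_ge0.
  have k1 : 0 < (k + 1)%:R :> R by rewrite ltr0n addn1.
  rewrite ler_pdivrMr ?mulr_gt0 // mulrC ler_pdivlMr //.
  have k2 : 1 <= k%:R :> R by rewrite ler1n.
  have : e * (k + 1)%:R <= 1 * (k + 1)%:R by rewrite ler_wpM2r // ltW.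
  by rewrite natrD; lra.
apply: le_trans (le_trans _ H) _; last first.
  apply: (le_expect (hD 0)) => b; rewrite ler_nat.
  case: (boolP (has _ b.2)) => // Hh; rewrite (sub_has _ Hh) // => C HC.
  exact: le_trans HC Hctr.
have beta01 : 0 <= beta <= 1.
  have [b0 b1] := andP base01.
  by rewrite /beta !exprn_ge0 //= exprn_ile1 ?exprn_ge0 // exprn_ile1.
have := pow_le_half beta01 (le_trans L1 (ler_wpM2l (ler0n R L) pb)).
by rewrite -/beta; lra.
Qed.

End Program.

(** Each of the L trials has [k * M] rounds, and a round compares n points with at most k pool
    elements in dimension d. *)
Lemma total_time_le : exists K : nat, forall n d k M L : nat,
  (0 < n)%N -> (0 < d)%N -> (0 < k)%N -> (0 < M)%N -> (0 < L)%N ->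
  (total_time n d k M L <= K * (n * d * (L * M * k * k)))%N.
Proof.
exists 300 => n d k M L n0 d0 k0 M0 L0.
set P := (n * (k * d))%N; set Q := (k * (M * P))%N.
have -> : (300 * (n * d * (L * M * k * k)) = 300 * (L * Q))%N.
  by rewrite /Q /P; ring.
have kd0 : (0 < k * d)%N by rewrite muln_gt0 k0.
have P0 : (0 < P)%N by rewrite muln_gt0 n0.
have Q0 : (0 < Q)%N by rewrite muln_gt0 k0 muln_gt0 M0 P0.
have kP : (k <= P)%N.
  by rewrite (leq_trans (leq_pmulr k d0)) // leq_pmull.
have dP : (d <= P)%N.
  by rewrite (leq_trans (leq_pmull d k0)) // leq_pmull.
have nP : (n <= P)%N by rewrite leq_pmulr.
have PQ : (P <= Q)%N.
  by rewrite (leq_trans (leq_pmull P M0)) // leq_pmull.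
have MQ : (k * M <= Q)%N by rewrite leq_mul2l leq_pmulr // orbT.
have MM : (M <= k * M)%N by rewrite leq_pmull.
have QL : (Q <= L * Q)%N by rewrite leq_pmull.
have R1 : (k.+1 * (d * 4 + 20) <= 48 * (k * d))%N.
  by apply: (@leq_trans ((2 * k) * (24 * d))%N); [apply: leq_mul; lia|lia].
have R2 : ((round_time n d k).+1 <= 160 * P)%N.
  have : (n * (k.+1 * (d * 4 + 20) + 13) <= n * (61 * (k * d)))%N.
    by rewrite leq_mul2l; apply/orP; right; lia.
  have -> : (n * (61 * (k * d)) = 61 * P)%N by rewrite /P; ring.
  by rewrite /round_time; lia.
have R3 : ((cluster_time n d M k).+1 <= 180 * (M * P))%N.
  have : (M * (round_time n d k).+1 <= M * (160 * P))%N.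
    by rewrite leq_mul2l R2 orbT.
  have -> : (M * (160 * P) = 160 * (M * P))%N by ring.
  have : (0 < M * P)%N by rewrite muln_gt0 M0.
  by rewrite /cluster_time; lia.
have R4 : (trial_time n d k M + 3 <= 190 * Q)%N.
  have : (k * (cluster_time n d M k).+1 <= k * (180 * (M * P)))%N.
    by rewrite leq_mul2l R3 orbT.
  have -> : (k * (180 * (M * P)) = 180 * Q)%N by rewrite /Q; ring.
  by rewrite /trial_time; lia.
have R5 : (L * (trial_time n d k M + 3) <= 190 * (L * Q))%N.
  by rewrite mulnCA leq_mul2l R4 orbT.
have R6 : (k * (M * 4 + 6) <= 10 * Q)%N.
  have -> : (k * (M * 4 + 6) = 4 * (k * M) + 6 * k)%N by ring.
  by lia.
by rewrite /total_time /init_time; lia.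
Qed.

Section Bounds.
Variable R : realType.

(** Let [u = 2 + k / eps] and [x = k / eps ^+ a]. The main factor is at most [u ^+ b] to the power
    [M * k], where [M * k <= C0 * x]. The factors k and M are bounded by constants times powers of
    u, and since [eps <= E] keeps x away from 0, such powers are at most [expR (const * x * ln u)]
    too. *)
Lemma exp2_bounds (a : nat) (E C0 : R) : 0 <= C0 -> exists A c : R,
  forall (n d k M L : nat) (eps : R),
  (0 < n)%N -> (0 < d)%N -> (0 < k)%N -> (0 < M)%N -> (0 < L)%N ->
  0 < eps -> eps <= E -> M%:R <= C0 / eps ^+ a ->
  L%:R <= (((eps / (1 + eps) / (24 * k%:R)) ^+ 3 ^+ M) ^+ k)^-1 + 1 ->
  L%:R <= exp2_tilde k eps c (k%:R / eps ^+ a) /\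
  (total_time n d k M L)%:R <=
    A * (n%:R * d%:R * exp2_tilde k eps c (k%:R / eps ^+ a)).
Proof.
move=> C00; have [K HK] := total_time_le.
set E1 := 1 + `|E|; have E1_1 : 1 <= E1 by rewrite /E1 lerDl.
have E10 : 0 < E1 by rewrite (lt_le_trans _ E1_1).
set H := E1 ^+ a; have H0 : 0 <= H by rewrite exprn_ge0 // ltW.
have [m0 Hm0] : exists m0, 24 * E1 ^+ 2 <= 2 ^+ m0.
  exists (Num.bound (24 * E1 ^+ 2)).
  apply: (@le_trans _ _ (Num.bound (24 * E1 ^+ 2))%:R).
    by apply/ltW/archi_boundP; rewrite mulr_ge0 ?sqr_ge0.
  by rewrite -natrX ler_nat ltnW // ltn_expl.
(* As [2 <= u], the constant [24 * E1 ^+ 2] is at most [u ^+ m0]; with [u ^+ 2] for [k / eps] and k,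
   and the cube in p, this gives b. *)
pose b : nat := (3 * (m0 + 2))%N.
(* The list size uses [b * C0 + H], where H absorbs the additive 1; in the running time, M uses
   [a * H] and the two factors k use H each. *)
pose c' := b%:R * C0 + (3 + a%:R) * H.
have ln2 : 0 < ln (2 : R) by rewrite ln_gt0 // ltr1n.
exists (K%:R * (C0 * E1 ^+ 2)), (c' / ln 2).
move=> n d k M L eps n0 d0 k0 M0 L0 eps0 epsE HM HL.
have epsE1 : eps <= `|E| by apply: le_trans epsE (ler_norm E).
have kR : 1 <= k%:R :> R by rewrite ler1n.
set u := 2 + k%:R / eps; set x := k%:R / eps ^+ a; set la := ln u.
have ke0 : 0 < k%:R / eps by rewrite divr_gt0 // (lt_le_trans _ kR).
have u2 : 2 <= u by rewrite /u lerDl ltW.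
have u1 : 1 <= u by apply: le_trans u2; rewrite ler1n.
have u0 : 0 < u by lra.
have uE : u = expR la by rewrite /la lnK // posrE.
have la0 : 0 <= la by rewrite /la ln_ge0.
have epsa : 0 < eps ^+ a by rewrite exprn_gt0.
have x0 : 0 <= x by rewrite divr_ge0 // ltW.
have xH : 1 <= H * x.
  rewrite /x mulrA ler_pdivlMr // mul1r.
  apply: (@le_trans _ _ (H * 1)); last by rewrite ler_wpM2l.
  by rewrite mulr1 /H lerXn2r ?nnegrE ?(ltW eps0) ?(ltW E10) // /E1; lra.
set y := x * la; have y0 : 0 <= y by rewrite mulr_ge0.
have laH : la <= H * y.
  by rewrite /y mulrA -[leLHS]mul1r ler_wpM2r.
have uH : u <= expR (H * y) by rewrite uE ler_expR.
have kE : k%:R <= E1 * u.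
  have -> : k%:R = eps * (k%:R / eps) by field; rewrite gt_eqF.
  by apply: ler_pM; rewrite ?(ltW eps0) ?(ltW ke0) // /E1 /u; lra.
have epsu : eps^-1 <= u.
  apply: (@le_trans _ _ (k%:R / eps)); last by rewrite /u; lra.
  by rewrite ler_peMl // invr_ge0 ltW.
have Mu : M%:R <= C0 * expR (a%:R * (H * y)).
  apply: le_trans HM _; rewrite ler_wpM2l // -exprVn.
  rewrite expRM_natl.
  rewrite lerXn2r ?nnegrE ?invr_ge0 ?(ltW eps0) ?expR_ge0 //.
  exact: le_trans epsu uH.
have omu : ((eps / (1 + eps) / (24 * k%:R)) ^+ 3)^-1 <= u ^+ b.
  rewrite /b mulnC exprM -exprVn.
  have f0 : 0 <= (eps / (1 + eps) / (24 * k%:R))^-1.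
    by rewrite invr_ge0 divr_ge0 ?divr_ge0 ?mulr_ge0 ?addr_ge0 // ltW.
  rewrite lerXn2r ?nnegrE ?exprn_ge0 ?(ltW u0) //.
  have -> : (eps / (1 + eps) / (24 * k%:R))^-1 =
      24 * (((1 + eps) * eps^-1) * k%:R).
    by field; rewrite !gt_eqF //; lra.
  apply: (@le_trans _ _ (24 * ((E1 * u) * (E1 * u)))).
    rewrite ler_wpM2l // ler_pM // ?mulr_ge0 ?invr_ge0 ?addr_ge0 ?(ltW eps0) //.
    by rewrite ler_pM ?invr_ge0 ?addr_ge0 ?(ltW eps0) // /E1; lra.
  have -> : 24 * ((E1 * u) * (E1 * u)) = 24 * E1 ^+ 2 * u ^+ 2 by ring.
  rewrite exprD ler_wpM2r ?exprn_ge0 ?(ltW u0) // (le_trans Hm0) //.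
  by rewrite lerXn2r ?nnegrE ?(ltW u0).
have om0 : 0 <= ((eps / (1 + eps) / (24 * k%:R)) ^+ 3)^-1.
  by rewrite invr_ge0 exprn_ge0 // divr_ge0 ?divr_ge0 ?mulr_ge0 ?addr_ge0 // ltW.
have pu : (((eps / (1 + eps) / (24 * k%:R)) ^+ 3 ^+ M) ^+ k)^-1 <=
    expR (b%:R * C0 * y).
  rewrite -exprVn -exprVn -exprM.
  apply: (@le_trans _ _ ((u ^+ b) ^+ (M * k))).
    by rewrite lerXn2r ?nnegrE ?exprn_ge0 ?(ltW u0).
  rewrite -exprM uE -expRM_natl ler_expR -mulr_natl natrM natrM.
  rewrite -!mulrA ler_wpM2l // /y !mulrA ler_wpM2r //.
  by rewrite mulr1 [leRHS]mulrAC ler_wpM2r.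
have ypos : 1 <= expR (b%:R * C0 * y).
  have h : 0 <= b%:R * C0 * y by apply: mulr_ge0 => //; exact: mulr_ge0.
  by have := expR_ge1Dx (b%:R * C0 * y); lra.
have LH : L%:R <= expR ((b%:R * C0 + H) * y).
  apply: le_trans HL _; rewrite [(_ + H) * y]mulrDl expRD.
  have : 2 * expR (b%:R * C0 * y) <= expR (H * y) * expR (b%:R * C0 * y).
    by rewrite ler_wpM2r ?expR_ge0 // (le_trans u2).
  by rewrite [expR (H * y) * _]mulrC; lra.
have -> : exp2_tilde k eps (c' / ln 2) x = expR (c' * y).
  rewrite /exp2_tilde /powR ifF ?pnatr_eq0 //; congr expR.
  by rewrite -/u -/la /y; field; rewrite gt_eqF.
split.
  apply: le_trans LH _; rewrite ler_expR ler_wpM2r // /c' lerD2l.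
  by rewrite ler_peMl //; have : 0 <= a%:R :> R by []; lra.
have : (total_time n d k M L)%:R <= K%:R * (n%:R * d%:R *
    (L%:R * M%:R * k%:R * k%:R)) :> R by rewrite -!natrM ler_nat HK.
move=> /le_trans; apply.
have -> : K%:R * (C0 * E1 ^+ 2) * (n%:R * d%:R * expR (c' * y)) =
  K%:R * (n%:R * d%:R * (C0 * E1 ^+ 2 * expR (c' * y))) by ring.
rewrite ler_wpM2l // ler_wpM2l ?mulr_ge0 //.
have kH : k%:R <= E1 * expR (H * y).
  by apply: le_trans kE _; rewrite ler_wpM2l // ltW.
have -> : C0 * E1 ^+ 2 * expR (c' * y) = expR ((b%:R * C0 + H) * y) *
    (C0 * expR (a%:R * (H * y))) * (E1 * expR (H * y)) * (E1 * expR (H * y)).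
  have -> : c' * y = (b%:R * C0 + H) * y + a%:R * (H * y) + H * y + H * y.
    by rewrite /c'; ring.
  by rewrite !expRD; ring.
by do 3 (apply: ler_pM; rewrite ?mulr_ge0 //).
Qed.

End Bounds.

(** * The two programs and the theorem *)

Definition means_step : cmd :=
  rset r_gam (RDiv (rnat 1) (ROfNat (NAdd (nreg rt) (NConst 1)))).

Definition median_step : cmd :=
  If (BNle (nreg rt) (NConst 0)) (rset r_gam (rnat 1))
  (If (BNle (nreg rt) (NConst 1))
    (Seq (rset r_s (RMul (RDiv (rreg r_e) (rnat 96)) (RSqrt (rreg r_sq))))
      (rset r_gam (rnat 0)))
    (Seq (Flip 2 (NConst rb) (RDiv (rnat 1) (rnat 2)))
    (Seq (If (BNle (NConst 1) (nreg rb)) (rset r_s (rnat 0)) Skip)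
      (rset r_gam (RDiv (rreg r_s) (RSqrt (rreg r_sq))))))).

Definition means_prog : cmd :=
  program (RDiv (rreg r_e) (rnat 16)) (rreg r_min) means_step.

Definition median_prog : cmd :=
  let q := RDiv (rreg r_e) (rnat 64) in
  program (RMul (RMul q q) q) (RSqrt (rreg r_min)) median_step.

Section Steps.
Variable R : realType.

Lemma sim_means_step (e : R) (s : state R) : rmem s 3 r_e = e ->
  sim 20 means_step s (gam_means (nmem s 2 rt) (rmem s 3 r_s) (rmem s 3 r_sq))
    (fun gs s' => [/\ same_off [:: rb] [:: r_gam; r_s] s s', same_rows s s',
       rmem s' 3 r_gam = gs.1 & rmem s' 3 r_s = gs.2]).
Proof.
move=> _; eapply sim_time.
  eapply sim_ret; apply: dsim_rset.
  by split; [solve_same|by []|rewrite /= /upd /= addn1 div1r|].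
by [].
Qed.

Lemma sim_median_step (e : R) (s : state R) : rmem s 3 r_e = e ->
  sim 20 median_step s
    (gam_median e (nmem s 2 rt) (rmem s 3 r_s) (rmem s 3 r_sq))
    (fun gs s' => [/\ same_off [:: rb] [:: r_gam; r_s] s s', same_rows s s',
       rmem s' 3 r_gam = gs.1 & rmem s' 3 r_s = gs.2]).
Proof.
move=> He; case Ht : (nmem s 2 rt) => [|[|t]].
- eapply sim_time.
    eapply sim_if; rewrite /= Ht /=; eapply sim_ret; apply: dsim_rset.
    by split; [solve_same|by []|rewrite /= /upd|].
  by [].
- eapply sim_time.
    eapply sim_if; rewrite /= Ht /=; eapply sim_if; rewrite /= Ht /=.
    eapply sim_rset; eapply sim_ret; apply: dsim_rset.
    by split; [solve_same|by []|rewrite /= /upd|rewrite /= /upd /= He].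
  by [].
- eapply sim_time.
    eapply sim_if; rewrite /= Ht /=; eapply sim_if; rewrite /= Ht /=.
    eapply sim_expect.
      eapply sim_flip; eapply sim_if_seq; rewrite /=.
        eapply sim_rset; eapply sim_ret; apply: dsim_rset.
        instantiate (1 := (0, 0)).
        by split; [solve_same|by []|rewrite /= /upd /= mul0r|rewrite /= /upd].
      eapply sim_skip; eapply sim_ret; apply: dsim_rset.
      instantiate (1 := (rmem s 3 r_s / Num.sqrt (rmem s 3 r_sq), rmem s 3 r_s)).
      by split; [solve_same|by []|rewrite /= /upd|].
    by move=> F; rewrite /= clip_id //; lra.
  by [].
Qed.

(** Two distinct points make the infimum positive, by the triangle inequality, so some value lies
    below [(1 + th)] times it; with at most one point the value 0 is attained. Injectivity of X
    makes distinct indices distinct points. *)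
Lemma near_median n d (X : 'I_n -> 'rV[R]_d) (O : {set 'I_n}) (th : R) :
  injective X -> 0 < th -> exists c,
  \sum_(x in O) edist (X x) c <=
  (1 + th) * inf (range (fun c : 'rV[R]_d => \sum_(x in O) edist (X x) c)).
Proof.
move=> Xinj th0; pose f (c : 'rV[R]_d) := \sum_(x in O) edist (X x) c.
rewrite -/f; set S := range f.
have f0 c : 0 <= f c by apply: sumr_ge0 => x _; exact: edist_ge0.
have Sn : nonempty S by exists (f 0); exists 0.
have Slb (q : R) : (forall c, q <= f c) -> q <= inf S.
  by move=> H; apply: lb_le_inf => // _ [c _ <-].
have iS : has_inf S by split=> //; exists 0 => _ [c _ <-].
case: (leqP #|O| 1) => O1.
  have [c fc] : exists c, f c = 0.
    have [Oe|[x xO]] := set_0Vmem O.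
      by exists 0; rewrite /f Oe big_set0.
    exists (X x); rewrite /f (_ : O = [set x]%SET).
      by rewrite big_set1 /edist sqdistxx sqrtr0.
    by apply/eqP; rewrite eq_sym eqEcard finset.sub1set xO cards1.
  exists c; rewrite -/(f c) fc mulr_ge0 ?Slb //.
  by rewrite addr_ge0 // ltW.
have /card_gt1P[x [x' [xO x'O xx']]] := O1.
have del0 : 0 < edist (X x) (X x').
  rewrite lt_neqAle edist_ge0 andbT eq_sym; apply/eqP => /edist_eq0 /Xinj E.
  by rewrite E eqxx in xx'.
have inf0 : 0 < inf S.
  apply: lt_le_trans del0 _; apply: Slb => c.
  apply: le_trans (edist_triangle c _ _) _.
  rewrite /f (bigD1 x) //= lerD2l (bigD1 x') /=; last by rewrite x'O eq_sym.
  by rewrite edistC lerDl sumr_ge0 // => *; exact: edist_ge0.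
have [_ [c _ <-] H] := inf_adherent (mulr_gt0 th0 inf0) iS.
by exists c; rewrite -/(f c) mulrDl mul1r ltW.
Qed.

End Steps.

Theorem theorem1 (R : realType) :
  (exists P : cmd, forall E : R, exists A c : R,
     forall (n d k : nat) (eps : R) (X : 'I_n -> 'rV[R]_d),
       (0 < n)%N -> (0 < d)%N -> (0 < k)%N -> 0 < eps -> eps <= E ->
       injective X ->
       exists T : nat,
         T%:R <= A * (n%:R * d%:R * exp2_tilde k eps c (k%:R / eps)) /\
         list_solves P eps X (@kmeans_cost R n d k) (@kmeans_opt R n d k)
           T (exp2_tilde k eps c (k%:R / eps)))
  /\
  (exists (P : cmd) (a : nat), forall E : R, exists A c : R,
     forall (n d k : nat) (eps : R) (X : 'I_n -> 'rV[R]_d),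
       (0 < n)%N -> (0 < d)%N -> (0 < k)%N -> 0 < eps -> eps <= E ->
       injective X ->
       exists T : nat,
         T%:R <= A * (n%:R * d%:R * exp2_tilde k eps c (k%:R / eps ^+ a)) /\
         list_solves P eps X (@kmedian_cost R n d k) (@kmedian_opt R n d k)
           T (exp2_tilde k eps c (k%:R / eps ^+ a))).
Proof.
have e_gt0 (eps : R) : 0 < eps -> 0 < eps / (1 + eps).
  by move=> eps0; rewrite divr_gt0 // addr_gt0.
have p_gt0 (eps : R) (k M : nat) : (0 < k)%N -> 0 < eps ->
    0 < ((eps / (1 + eps) / (24 * k%:R)) ^+ 3 ^+ M) ^+ k.
  by move=> k0 eps0; rewrite !exprn_gt0 // divr_gt0 ?e_gt0 ?mulr_gt0 // ltr0n.
have pos (m : nat) (q : R) : 1 <= m%:R * q -> (0 < m)%N.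
  by case: m => //; rewrite mul0r; lra.
split.
  exists means_prog => E.
  (* M is at most [16 * (1 + eps) / eps + 1]; multiplying by eps and bounding eps by the absolute
     value of E gives this constant. *)
  have [A [c H]] := exp2_bounds 1 E (C0 := 16 * (1 + `|E|) + `|E|)
    ltac:(by rewrite addr_ge0 ?mulr_ge0 ?addr_ge0).
  exists A, c => n d k eps X n0 d0 k0 eps0 epsE Xinj.
  have epsE1 : eps <= `|E| by apply: le_trans epsE (ler_norm E).
  have th0 : 0 < eps / (1 + eps) / 16 by rewrite divr_gt0 ?e_gt0.
  have [M [Mmin M1 Mle]] := least_multiple th0.
  have [L [Lmin L1 Lle]] := least_multiple (p_gt0 eps k M k0 eps0).
  have HM : M%:R <= (16 * (1 + `|E|) + `|E|) / eps ^+ 1.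
    rewrite expr1; apply: le_trans Mle _; rewrite ler_pdivlMr //.
    have -> : ((eps / (1 + eps) / 16)^-1 + 1) * eps = 16 * (1 + eps) + eps.
      by field; rewrite !gt_eqF // addr_gt0.
    lra.
  have [] := H n d k M L eps n0 d0 k0 (pos _ _ M1) (pos _ _ L1) eps0 epsE HM Lle.
  rewrite expr1 => LB TB; exists (total_time n d k M L); split=> //.
  apply: (@program_solves R _ _ _ id (fun=> @gam_means R) (fun e => e / 16)) => //.
  - exact: sim_means_step.
  - by move=> *; exact: isdist_ret.
  - by move=> *; exact: sqdist_young.
  - by move=> m d' O y ctr zs e M' O0 /andP[e0 _] M1'; exact: inner_means.
  move=> O _; exists (fun j => centroid X (O j)).
  apply: ler_wpM2r.
    by do 2 (apply: sumr_ge0 => * ); exact: sqdist_ge0.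
  by rewrite lerD2l ler_pdivrMr ?addr_gt0 // ler_peMr ?(ltW eps0) // lerDl ltW.
exists median_prog, 3%N => E.
have [A [c H]] := exp2_bounds 3 E (C0 := (64 * (1 + `|E|)) ^+ 3 + `|E| ^+ 3)
  ltac:(by rewrite addr_ge0 ?exprn_ge0 ?mulr_ge0 ?addr_ge0).
exists A, c => n d k eps X n0 d0 k0 eps0 epsE Xinj.
have epsE1 : eps <= `|E| by apply: le_trans epsE (ler_norm E).
have th0 : 0 < (eps / (1 + eps) / 64) ^+ 3 by rewrite exprn_gt0 // divr_gt0 ?e_gt0.
have [M [Mmin M1 Mle]] := least_multiple th0.
have [L [Lmin L1 Lle]] := least_multiple (p_gt0 eps k M k0 eps0).
have HM : M%:R <= ((64 * (1 + `|E|)) ^+ 3 + `|E| ^+ 3) / eps ^+ 3.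
  apply: le_trans Mle _; rewrite ler_pdivlMr ?exprn_gt0 //.
  have -> : (((eps / (1 + eps) / 64) ^+ 3)^-1 + 1) * eps ^+ 3 =
      (64 * (1 + eps)) ^+ 3 + eps ^+ 3.
    by field; rewrite !gt_eqF // addr_gt0.
  apply: lerD; rewrite lerXn2r ?nnegrE ?mulr_ge0 ?addr_ge0 ?(ltW eps0) //.
  by rewrite ler_wpM2l // lerD2l.
have [LB TB] := H n d k M L eps n0 d0 k0 (pos _ _ M1) (pos _ _ L1) eps0 epsE
  HM Lle.
exists (total_time n d k M L); split=> //.
apply: (@program_solves R _ _ _ Num.sqrt (@gam_median R)
  (fun e => (e / 64) ^+ 3)) => //.
- by move=> s; rewrite /=; ring.
- exact: sim_median_step.
- exact: isdist_gam_median.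
- by move=> r r' r0 rr'; rewrite ler_wsqrtr.
- exact: sqrtr0.
- by move=> *; exact: edist_young.
- by move=> m d' O y ctr zs e M' O0 e01 M1'; exact: inner_median.
move=> O _; set e := eps / (1 + eps).
have e0 : 0 < e by exact: e_gt0.
have ee : e < eps.
  by rewrite /e ltr_pdivrMr ?addr_gt0 // ltr_pMr // ltrDl.
(* The near-minimizers may use the whole gap between [1 + e] and [1 + eps]. *)
have th1 : 0 < (1 + eps) / (1 + e) - 1.
  by rewrite subr_gt0 ltr_pdivlMr ?addr_gt0 // mul1r ltrD2l.
have [ctr Hctr] := choice (fun j => near_median (O j) Xinj th1).
exists ctr; rewrite /kmedian_opt !mulr_sumr; apply: ler_sum => j _.
have := ler_wpM2l (ltW (addr_gt0 ltr01 e0)) (Hctr j).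
rewrite mulrA; have -> // : (1 + e) * (1 + ((1 + eps) / (1 + e) - 1)) = 1 + eps.
by field; rewrite gt_eqF // addr_gt0.
Qed.
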